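(* Let $\mathcal A_\Theta$ be a noncommutative $n$-torus and $\mathcal A_\Phi$ a noncommutative $m$-torus, with their spectral triples $(\mathcal A_\Theta,\mathcal H_\Theta,D_\Theta)$ and $(\mathcal A_\Phi,\mathcal H_\Phi,D_\Phi)$, the first made even with grading operator $\gamma$. Let $D=D_\Theta\otimes1+\gamma\otimes D_\Phi$ and $\mathcal A_\Psi=\mathcal A_\Theta\otimes\mathcal A_\Phi$. Then $$\Omega_D^2(\mathcal A_\Psi)\cong\Omega_{D_\Theta}^2(\mathcal A_\Theta)\otimes\mathcal A_\Phi\,\bigoplus\,\mathcal A_\Theta\otimes\Omega_{D_\Phi}^2(\mathcal A_\Phi)\,\bigoplus\,\Omega_{D_\Theta}^1(\mathcal A_\Theta)\otimes\Omega_{D_\Phi}^1(\mathcal A_\Phi)$$ as $\mathcal A_\Psi$-bimodules.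
   Context: For a real skew-symmetric $\Theta\in M_n(\mathbb R)$, consider the universal $C^*$-algebra generated by unitaries $U_1,\dots,U_n$ with $U_kU_m=e^{2\pi i\Theta_{mk}}U_mU_k$; $\mathcal A_\Theta$ denotes its smooth subalgebra $\{\sum a_{\mathbf r}U^{\mathbf r}:(a_{\mathbf r})\text{ rapidly decreasing on }\mathbb Z^n\}$ (the noncommutative $n$-torus). $\tau(\sum a_{\mathbf r}U^{\mathbf r})=a_{\mathbf 0}$; $L^2(\mathcal A_\Theta,\tau)\cong\ell^2(\mathbb Z^n)$ is the GNS space; $\delta_j(\sum a_{\mathbf r}U^{\mathbf r})=\sum2\pi i\,r_ja_{\mathbf r}U^{\mathbf r}$. With $N=2^{\lfloor n/2\rfloor}$ and Clifford matrices $\gamma_1,\dots,\gamma_n\in M_N(\mathbb C)$, $\gamma_r\gamma_s+\gamma_s\gamma_r=2\delta_{rs}$, from the irreducible representation of $\mathbb C\ell(n)$ on $\mathbb C^N$, set $\mathcal H_\Theta=L^2(\mathcal A_\Theta,\tau)\otimes\mathbb C^N$, $D_\Theta=-i\sum_j\delta_j\otimes\gamma_j$. For $n$ even this is an even spectral triple with grading coming from the Clifford representation. If it is not even it is replaced by $(\mathcal A_\Theta,\mathcal H_\Theta\otimes\mathbb C^2,D_\Theta\otimes\sigma,\gamma=1\otimes\sigma')$ with $\sigma,\sigma'$ two distinct $2\times2$ Pauli matrices (still written $\mathcal H_\Theta,D_\Theta$). Similarly for $\Phi\in M_m(\mathbb R)$. $\mathcal A_\Theta\otimes\mathcal A_\Phi$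 is identified with the noncommutative $(n+m)$-torus $\mathcal A_\Psi$, $\Psi=\Theta\oplus\Phi$ block diagonal; $D$ acts on $\mathcal H_\Theta\otimes\mathcal H_\Phi$. For a spectral triple $(\mathcal A,\mathcal H,D)$ (with $\mathcal A$ identified with its image in $\mathcal B(\mathcal H)$): $\Omega_D^1(\mathcal A)=\{\sum a_j[D,b_j]\}$, $\pi(\Omega^2(\mathcal A))=\{\sum a_j[D,b_j][D,c_j]\}$, $\pi(dJ_0^1(\mathcal A))=\{\sum[D,b_j][D,c_j]:\sum b_j[D,c_j]=0\}$ (subspaces of $\mathcal B(\mathcal H)$), and $\Omega_D^2(\mathcal A)=\pi(\Omega^2(\mathcal A))/\pi(dJ_0^1(\mathcal A))$; all are $\mathcal A$-bimodules. *)

(* Defs.v *)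
From HB Require Import structures.
From mathcomp Require Import all_boot all_order all_algebra.
From mathcomp Require Import all_classical all_reals all_analysis.
From mathcomp Require Import complex mxtens ring.

Set Implicit Arguments.
Unset Strict Implicit.
Unset Printing Implicit Defensive.

Import Order.TTheory GRing.Theory Num.Theory.
Import ComplexField.Normc.

Local Open Scope classical_set_scope.
Local Open Scope ring_scope.

Section Ell2.
Variables (R : realType) (I : choiceType).

Definition sqnorm (x : I -> R[i]^o) : \bar R :=
  (\esum_(i in [set: I]) ((normc (x i)) ^+ 2)%:E)%R.

Definition sqsummable : {pred (I -> R[i]^o)} :=
  fun x => `[< (sqnorm x < +oo)%E >].

Lemma sqnormZ_fin (c : R) (f : I -> \bar R) : (0 <= c)%R ->
  (forall i, (0 <= f i)%E) -> (esum [set: I] f < +oo)%E ->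
  (esum [set: I] (fun i => (c%:E * f i)%E) < +oo)%E.
Proof.
move=> c0 f0 fin; apply: (@le_lt_trans _ _ (c%:E * esum [set: I] f)%E).
  apply: ge_ereal_sup => /= _ [F [finF FI] <-].
  rewrite -ge0_mule_fsumr//; apply: lee_wpmul2l; first by rewrite lee_fin.
  by apply: ereal_sup_ubound; exists F.
by apply: lte_mul_pinfty.
Qed.

Lemma normc_sqr (z : R[i]) : normc z ^+ 2 = complex.Re z ^+ 2 + complex.Im z ^+ 2.
Proof. by case: z => a b; rewrite sqr_sqrtr// addr_ge0// sqr_ge0. Qed.

Fact sqsummable_submod : submod_closed sqsummable.
Proof.
split=> [|a x y /asboolP hx /asboolP hy]; apply/asboolP.
  by rewrite /sqnorm esum1 ?ltry// => i _; rewrite normc0 expr0n.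
pose c : R := 2 * normc a ^+ 2.
have c0 : 0 <= c by rewrite mulr_ge0// sqr_ge0.
have sq0 (z : R[i]) : (0%:E <= ((normc z) ^+ 2)%:E)%E by rewrite lee_fin sqr_ge0.
apply: (@le_lt_trans _ _ (\esum_(i in [set: I])
    (c%:E * ((normc (x i)) ^+ 2)%:E + 2%:E * ((normc (y i)) ^+ 2)%:E)%E)%R).
  apply: le_esum => i _; rewrite -!EFinM -EFinD lee_fin /c.
  have -> : (a *: x + y) i = a * x i + y i by [].
  rewrite -mulrA -exprMn -normcM !normc_sqr !raddfD /=.
  case: (a * x i) (y i) => [p q] [r s] /=.
  rewrite -subr_ge0 (_ : _ - _ = (p - r) ^+ 2 + (q - s) ^+ 2); last by ring.
  by rewrite addr_ge0// sqr_ge0.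
rewrite esumD; last 2 first.
- by move=> i _; rewrite mule_ge0// lee_fin.
- by move=> i _; rewrite mule_ge0// lee_fin.
by apply: lte_add_pinfty; apply: sqnormZ_fin.
Qed.

HB.instance Definition _ :=
  GRing.isSubmodClosed.Build R[i] (I -> R[i]^o) sqsummable sqsummable_submod.

Record ell2 := Ell2 { ell2_val :> I -> R[i]^o; ell2_valP : ell2_val \in sqsummable }.

HB.instance Definition _ := [isSub for ell2_val].
HB.instance Definition _ := [Choice of ell2 by <:].
HB.instance Definition _ := [SubChoice_isSubLmodule of ell2 by <:].

Fact basis_sqsummable (j : I) : (fun i => (i == j)%:R : R[i]^o) \in sqsummable.
Proof.
apply/asboolP; rewrite /sqnorm (esumID [set j]); last first.
  by move=> i _; rewrite lee_fin sqr_ge0.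
rewrite setTI esum_set1 ?lee_fin ?sqr_ge0// esum1 ?adde0 ?ltry// => i [_ /= /eqP/negPf ->].
by rewrite normc0 expr0n.
Qed.

Definition basis (j : I) : ell2 := Ell2 (basis_sqsummable j).

End Ell2.

(* Operators on l^2(I) are plain functions, with pointwise addition and
   composition as product; B(l^2(I)) is the subset [bounded_op]. *)
Notation op R I := (ell2 R I -> ell2 R I).

Section Operators.
Variables (R : realType) (I : choiceType).

Definition bounded_op (T : op R I) : Prop :=
  linear T /\
  exists M : R, forall x, (sqnorm (T x) <= M%:E * sqnorm x)%E.

(* The matrix entry <e_i, T e_j>; it determines a bounded T. *)
Definition entry (T : op R I) (i j : I) : R[i] := T (basis R j) i.

End Operators.

(* Bimodules presented as quotients [bm_num / bm_den] of additive subgroups of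
   an ambient group, over an algebra A of operators on l^2(K). *)
Record bimod (R : realType) (K : choiceType) := Bimod {
  bm_amb : zmodType;
  bm_num : set bm_amb;
  bm_den : set bm_amb;
  bm_l : op R K -> bm_amb -> bm_amb;
  bm_r : bm_amb -> op R K -> bm_amb }.
Arguments bm_num {R K} M x : rename.
Arguments bm_den {R K} M x : rename.

Section Bimodules.
Variables (R : realType) (K : choiceType) (A : set (op R K)).
Implicit Types M N : bimod R K.

Definition bimod_stable M (X : set (bm_amb M)) : Prop :=
  [/\ X 0,
      forall x y, X x -> X y -> X (x - y) &
      forall a x, A a -> X x -> X (bm_l a x) /\ X (bm_r x a)].

Definition is_bimodule M : Prop :=
  [/\ bimod_stable (bm_num M), bimod_stable (bm_den M),
      bm_den M `<=` bm_num M &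
   forall a b x y, A a -> A b -> bm_num M x -> bm_num M y ->
   [/\ bm_l a (x + y) = bm_l a x + bm_l a y
         /\ bm_r (x + y) a = bm_r x a + bm_r y a,
       bm_l (a + b) x = bm_l a x + bm_l b x
         /\ bm_r x (a + b) = bm_r x a + bm_r x b,
       bm_l (a \o b) x = bm_l a (bm_l b x)
         /\ bm_r x (a \o b) = bm_r (bm_r x a) b,
       bm_l id x = x /\ bm_r x id = x &
       bm_l a (bm_r x b) = bm_r (bm_l a x) b]].

(* [f] is a lift, to representatives, of an isomorphism of A-bimodules
   M -> N; linearity over the complex scalars follows from A-linearity when A
   contains them. *)
Definition induces_iso M N (f : bm_amb M -> bm_amb N) : Prop :=
  [/\ (forall x, bm_num M x -> bm_num N (f x)),
      (forall x y, bm_num M x -> bm_num M y ->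
         bm_den N (f (x + y) - (f x + f y))),
      (forall a x, A a -> bm_num M x ->
         bm_den N (f (bm_l a x) - bm_l a (f x)) /\
         bm_den N (f (bm_r x a) - bm_r (f x) a)),
      (forall x, bm_num M x -> (bm_den N (f x) <-> bm_den M x)) &
      (forall y, bm_num N y -> exists2 x, bm_num M x & bm_den N (f x - y))].

Definition bimod_iso M N : Prop :=
  [/\ is_bimodule M, is_bimodule N & exists f, @induces_iso M N f].

Definition dsum M N : bimod R K :=
  @Bimod R K (bm_amb M * bm_amb N)%type
    [set p | bm_num M p.1 /\ bm_num N p.2]
    [set p | bm_den M p.1 /\ bm_den N p.2]
    (fun a p => (bm_l a p.1, bm_l a p.2))
    (fun p a => (bm_r p.1 a, bm_r p.2 a)).

Definition op_bimod (X X0 : set (op R K)) : bimod R K :=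
  @Bimod R K (ell2 R K -> ell2 R K) X X0 (fun a T => a \o T) (fun T a => T \o a).

End Bimodules.

(* The unbounded operator D is given by its action on all functions on I; as an
   operator on l^2(I) it has the maximal domain {x in l^2(I) | D x in l^2(I)}. *)
Section ConnesForms.
Variables (R : realType) (I : choiceType).
Variables (A : set (op R I)) (D : (I -> R[i]^o) -> (I -> R[i]^o)).

(* T = [D, a]: a preserves the domain of D, and D a = a D + T there. *)
Definition is_commutator (a T : op R I) : Prop :=
  bounded_op T /\
  forall x y : ell2 R I, D x = y -> D (a x) = (a y + T x : ell2 R I).

Definition Omega1 : set (op R I) := [set W |
  exists k (a b T : 'I_k -> op R I),
    (forall l, [/\ A (a l), A (b l) & is_commutator (b l) (T l)]) /\
    W = \sum_(l < k) (a l \o T l)].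

Definition pi_Omega2 : set (op R I) := [set W |
  exists k (a b c S T : 'I_k -> op R I),
    (forall l, [/\ A (a l), A (b l), A (c l),
       is_commutator (b l) (S l) & is_commutator (c l) (T l)]) /\
    W = \sum_(l < k) (a l \o S l \o T l)].

Definition pi_dJ1 : set (op R I) := [set W |
  exists k (b c S T : 'I_k -> op R I),
    [/\ forall l, [/\ A (b l), A (c l),
          is_commutator (b l) (S l) & is_commutator (c l) (T l)],
        \sum_(l < k) (b l \o T l) = 0 &
        W = \sum_(l < k) (S l \o T l)]].

End ConnesForms.

(* For subspaces X, Y of bounded operators, the algebraic tensor product is
   [alg_tensor X Y], the span of the operators x (x) y on l^2(I * J).  It is
   completed in the Frechet topology of the seminorms
     sup_{i,j} (1 + |pos i - pos j|)^k |T_{ij}|,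
   which on the smooth noncommutative torus are the usual ones (rapid decrease
   of the coefficients); so the completion of A_Theta (x) A_Phi is the smooth
   torus of Theta (+) Phi, as in [prod_alg]. *)
Section Weights.
Variable R : realType.

Definition weight d (r : 'rV[int]_d) : R[i] := (1 + \sum_j `|r 0 j|)%:~R.

Definition rapidly_decreasing d (a : 'rV[int]_d -> R[i]) : Prop :=
  forall k : nat, exists M : R[i], forall r, weight r ^+ k * `|a r| <= M.

Definition smooth_closure (K : choiceType) d (pos : K -> 'rV[int]_d)
    (X : set (op R K)) : set (op R K) := [set T |
  bounded_op T /\
  forall (k : nat) (e : R[i]), 0 < e -> exists2 T', X T' &
    forall i j, weight (pos i - pos j) ^+ k * `|entry T i j - entry T' i j| <= e].

End Weights.

Section Tensor.
Variables (R : realType) (I J : choiceType).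

Definition is_tensor_op (x : op R I) (y : op R J) (T : op R (I * J)%type) : Prop :=
  bounded_op T /\
  forall i j, entry T i j = entry x i.1 j.1 * entry y i.2 j.2.

Definition alg_tensor (X : set (op R I)) (Y : set (op R J)) :
    set (op R (I * J)%type) := [set W |
  exists k (x : 'I_k -> op R I) (y : 'I_k -> op R J) (t : 'I_k -> op R (I * J)%type),
    (forall l, [/\ X (x l), Y (y l) & is_tensor_op (x l) (y l) (t l)]) /\
    W = \sum_(l < k) t l].

(* (X / X0) (x) (Y / Y0) = (X (x) Y) / (X0 (x) Y + X (x) Y0), completed: the
   completion of this quotient is the quotient of the closures. *)
Definition ctensor d (pos : I * J -> 'rV[int]_d)
    (X X0 : set (op R I)) (Y Y0 : set (op R J)) : bimod R (I * J)%type :=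
  op_bimod
    (smooth_closure pos (alg_tensor X Y))
    (smooth_closure pos [set W | exists S T,
       [/\ alg_tensor X0 Y S, alg_tensor X Y0 T & W = S + T]]).

(* F (x) 1 and 1 (x) G on functions on I * J. *)
Definition fun_tensl (F : (I -> R[i]^o) -> (I -> R[i]^o)) :
    (I * J -> R[i]^o) -> (I * J -> R[i]^o) :=
  fun x p => F (fun i => x (i, p.2)) p.1.

Definition fun_tensr (G : (J -> R[i]^o) -> (J -> R[i]^o)) :
    (I * J -> R[i]^o) -> (I * J -> R[i]^o) :=
  fun x p => G (fun j => x (p.1, j)) p.2.

End Tensor.

(* With U^r = U_1^{r_1} ... U_n^{r_n}, the relations
     U_k U_m = e^{2 pi i Theta_{mk}} U_m U_k
   give U^r U^s = torus_cocycle Theta r s U^{r+s}, hence, on the GNS space with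
   orthonormal basis e_s = [U^s], U^r e_s = torus_cocycle Theta r s e_{r+s}. *)
Section Torus.
Variables (R : realType) (n : nat).

Definition expi (t : R) : R[i] := (cos t +i* sin t)%C.

Definition torus_cocycle (Theta : 'M[R]_n) (r s : 'rV[int]_n) : R[i] :=
  expi (2 * pi *
    \sum_(m < n) \sum_(k < n | (m < k)%N) Theta m k * (r 0 k)%:~R * (s 0 m)%:~R).

(* The image of A_Theta on l^2(K) for an identification [(pos, fib)] of K with
   Z^n * S, i.e. of l^2(K) with L^2(A_Theta, tau) (x) l^2(S): the operators
   (sum_r a_r U^r) (x) 1 with (a_r) rapidly decreasing. *)
Definition torus_alg (Theta : 'M[R]_n) (K : choiceType) (S : eqType)
    (pos : K -> 'rV[int]_n) (fib : K -> S) : set (op R K) := [set T |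
  bounded_op T /\
  exists2 a : 'rV[int]_n -> R[i], rapidly_decreasing a &
    forall i j, entry T i j =
      if fib i == fib j
      then a (pos i - pos j) * torus_cocycle Theta (pos i - pos j) (pos j)
      else 0].

(* 1 (x) G on L^2(A_Theta, tau) (x) C^N *)
Definition fib_mx N (G : 'M[R[i]]_N) (x : 'rV[int]_n * 'I_N -> R[i]^o) :
    'rV[int]_n * 'I_N -> R[i]^o :=
  fun p => \sum_k G p.2 k * x (p.1, k).

Definition torus_deriv N (j : 'I_n) (x : 'rV[int]_n * 'I_N -> R[i]^o) :
    'rV[int]_n * 'I_N -> R[i]^o :=
  fun p => 2 * (pi : R)%:C%C * 'i * (p.1 0 j)%:~R * x p.

Definition torus_dirac N (g : 'I_n -> 'M[R[i]]_N) (x : 'rV[int]_n * 'I_N -> R[i]^o) :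
    'rV[int]_n * 'I_N -> R[i]^o :=
  fun p => - 'i * \sum_j fib_mx (g j) (torus_deriv j x) p.

(* Hermitian Clifford matrices (so that D_Theta is self-adjoint); in dimension
   2^(n/2) such a representation is automatically irreducible. *)
Definition clifford N (g : 'I_n -> 'M[R[i]]_N) : Prop :=
  [/\ N = (2 ^ n./2)%N,
      forall r s, g r *m g s + g s *m g r = (2 * (r == s)%:R)%:M &
      forall r, (map_mx Num.conj (g r))^T = g r].

Definition chirality N (g : 'I_n -> 'M[R[i]]_N) : 'M[R[i]]_N :=
  'i ^+ n./2 *: \big[mulmx/1%:M]_(j < n) g j.

End Torus.

Definition pauli (R : realType) (k : 'I_3) : 'M[R[i]]_2 :=
  \matrix_(i, j)
    if k == 0 then (i != j)%:R
    else if k == 1 then (if i == j then 0 else if (i < j)%N then - 'i else 'i)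
    else (if i == j then (-1) ^+ i else 0).

(* [even_spinors g G]: g are the matrices defining the Dirac operator, and G
   the grading, of the even spectral triple of the noncommutative n-torus: for
   n even the Clifford one (the sign of the grading is a convention), for n odd
   the one on H (x) C^2 with D (x) sigma_k and grading 1 (x) sigma_l. *)
Inductive even_spinors (R : realType) (n : nat) :
    forall N, ('I_n -> 'M[R[i]]_N) -> 'M[R[i]]_N -> Prop :=
| EvenSpinors N (g : 'I_n -> 'M[R[i]]_N) (e : bool) :
    ~~ odd n -> clifford g ->
    even_spinors g ((-1) ^+ e *: chirality g)
| DoubledSpinors N (g : 'I_n -> 'M[R[i]]_N) (k l : 'I_3) :
    odd n -> clifford g -> k != l ->
    even_spinors (fun j => g j *t pauli R k) (1%:M *t pauli R l).

Section Product.
Variables (R : realType) (n m N M : nat).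

(* H_Theta (x) H_Phi = l^2(spinor_idx n N * spinor_idx m M) *)
Definition spinor_idx (d P : nat) : choiceType := ('rV[int]_d * 'I_P)%type.

Definition prod_pos (p : spinor_idx n N * spinor_idx m M) : 'rV[int]_(n + m) :=
  row_mx p.1.1 p.2.1.

Definition prod_fib (p : spinor_idx n N * spinor_idx m M) : 'I_N * 'I_M :=
  (p.1.2, p.2.2).

Definition spinor_alg d P (Theta : 'M[R]_d) : set (op R (spinor_idx d P)) :=
  torus_alg Theta (fun p : spinor_idx d P => p.1) (fun p : spinor_idx d P => p.2).

(* A_Theta (x) A_Phi, identified with the noncommutative (n + m)-torus of
   Theta (+) Phi, acting on H_Theta (x) H_Phi. *)
Definition prod_alg (Theta : 'M[R]_n) (Phi : 'M[R]_m) :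
    set (op R (spinor_idx n N * spinor_idx m M)%type) :=
  torus_alg (block_mx Theta 0 0 Phi) prod_pos prod_fib.

(* D_Theta (x) 1 + gamma (x) D_Phi *)
Definition prod_dirac (g : 'I_n -> 'M[R[i]]_N) (G : 'M[R[i]]_N)
    (h : 'I_m -> 'M[R[i]]_M)
    (x : spinor_idx n N * spinor_idx m M -> R[i]^o) :
    spinor_idx n N * spinor_idx m M -> R[i]^o :=
  fun_tensl (torus_dirac g) x
  + fun_tensl (fib_mx G) (fun_tensr (torus_dirac h) x).

End Product.

(* Main.v *)
Require Import Defs.
From HB Require Import structures.
From mathcomp Require Import all_boot all_order all_algebra.
From mathcomp Require Import all_classical all_reals all_analysis.
From mathcomp Require Import finmap complex mxtens ring lra zify.

(** Write A for the smooth algebra of a torus acting on l^2 of its lattice with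
    spinor fibre, and, for a space V of matrices on the fibre, A V for the set
    of finite sums of a (1 (x) v) with a in A and v in V ([amod]).  Everything
    in the theorem is of the form A V, which turns an isomorphism of bimodules
    into finite-dimensional linear algebra.

    For a Dirac operator with symbol 2 pi sum_l r_l G_l, the commutator with b in A
    is [grad b] = sum_l (d_l b) (1 (x) G_l), with d_l b of Fourier coefficients
    2 pi r_l b_r ([commutatorE]).  Since the generators U_l satisfy
    [D, U_l] = 2 pi U_l G_l, one-forms are A <G_l> and two-forms are
    A <G_k G_l> ([Omega1E], [Omega2E]).  If sum b [D, c] = 0, then
    sum b d_l c = 0 for every l by independence of the gamma matrices, so the
    Leibniz rule makes sum (d_k b)(d_l c) = - sum b d_k d_l c symmetric in k
    and l, and only the squares G_l G_l = 1 survive in sum [D, b][D, c].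
    Conversely U_l and its inverse produce all of A, so the junk two-forms are
    A 1, or 0 for the torus of dimension 0 ([dJ1E]).

    The product Dirac operator has the same shape on the lattice Z^(n+m), with
    gamma matrices g_j (x) 1 and gamma (x) h_k ([prod_gamma]); they satisfy the
    Clifford relations because gamma is an involution anticommuting with the
    g_j.  The smooth closure of an algebraic tensor product of A_1 V and A_2 W
    is A (V (x) W) ([closure_alg_tensor]): rapidly decreasing series are limits
    of trigonometric polynomials, and A (V (x) W) is closed because entries
    converge and a projection onto V (x) W can be applied fibrewise.

    What remains is that a product of two gamma matrices splits, modulo
    scalars, into its parts in g g, in h h and in the mixed products
    g_j gamma (x) h_k; right multiplication by gamma (x) 1 identifies the
    latter with g_j (x) h_k.  The three parts are read off by traces
    ([proj2], [mixed2]), applied fibrewise to operators ([fib_map]); such maps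
    commute with A on both sides, which gives the isomorphism [amod_iso]. *)

Set Implicit Arguments.
Unset Strict Implicit.
Unset Printing Implicit Defensive.

Import Order.TTheory GRing.Theory Num.Theory.
Import ComplexField.Normc.

Local Open Scope classical_set_scope.
Local Open Scope ring_scope.

(** * Square-summable families and bounded operators *)

Section Ell2Theory.
Variables (R : realType) (I : choiceType).
Local Notation C := R[i].
Implicit Types (x y z : ell2 R I) (F : seq I).

Lemma ell2E0 i : (0 : ell2 R I) i = 0. Proof. by []. Qed.
Lemma ell2ED x y i : (x + y) i = x i + y i. Proof. by []. Qed.
Lemma ell2EN x i : (- x) i = - x i. Proof. by []. Qed.
Lemma ell2EZ (c : C) x i : (c *: x) i = c * x i. Proof. by []. Qed.
Lemma ell2Esum J (r : seq J) (P : pred J) (f : J -> ell2 R I) i :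
  (\sum_(j <- r | P j) f j) i = \sum_(j <- r | P j) f j i.
Proof. by apply: (big_morph (fun x : ell2 R I => x i)). Qed.

Lemma ell2P x y : (forall i, x i = y i) -> x = y.
Proof. by move=> h; apply/val_inj/funext. Qed.

Lemma normc_ge0 (a : C) : 0 <= normc a.
Proof. by case: a => a b; rewrite sqrtr_ge0. Qed.

Lemma normc_sum J (r : seq J) (P : pred J) (f : J -> C) :
  normc (\sum_(j <- r | P j) f j) <= \sum_(j <- r | P j) normc (f j).
Proof.
apply: (big_rec2 (fun a b => normc a <= b)); first by rewrite normc0.
by move=> j a b _ h; apply: le_trans (le_normcD _ _) _; rewrite lerD2l.
Qed.

Lemma norm_normc (a : C) : `|a| = (normc a)%:C%C.
Proof. by rewrite normc_def; case: a. Qed.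

Definition sqsum F (x : I -> C) : R := \sum_(i <- F) normc (x i) ^+ 2.

Lemma sqsum_le_sqnorm (x : I -> C) F : uniq F -> ((sqsum F x)%:E <= sqnorm x)%E.
Proof.
move=> uF; apply: (esum_ge (x := (sqsum F x)%:E)).
exists [set` F]; first by split => //; exact: finite_seq.
rewrite /sqsum -sumEFin fsbig_seq//.
Qed.

Lemma sqnorm_le (x : I -> C) (B : R) :
  (forall F, uniq F -> sqsum F x <= B) -> (sqnorm x <= B%:E)%E.
Proof.
move=> h; apply: ge_ereal_sup => /= _ [F [finF _] <-].
rewrite fsbig_finite//= sumEFin lee_fin; exact/h/fset_uniq.
Qed.

Lemma sqnorm_fin x : exists B : R, sqnorm x = B%:E.
Proof.
have /asboolP := ell2_valP x; rewrite ltey_eq => /orP[/fineK <-|/eqP e].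
  by exists (fine (sqnorm x)).
have : ((sqsum [::] x)%:E <= sqnorm x)%E by apply: sqsum_le_sqnorm.
by rewrite e.
Qed.

Definition sqn x : R := fine (sqnorm x).

Lemma sqnE x : sqnorm x = (sqn x)%:E.
Proof. by rewrite /sqn; have [B ->] := sqnorm_fin x. Qed.

Lemma sqsum_sqn x F : uniq F -> sqsum F x <= sqn x.
Proof. by move=> uF; rewrite -lee_fin -sqnE sqsum_le_sqnorm. Qed.

Lemma sqn_le x (B : R) : (forall F, uniq F -> sqsum F x <= B) -> sqn x <= B.
Proof. by move=> h; rewrite -lee_fin -sqnE sqnorm_le. Qed.

Lemma sqn_ge0 x : 0 <= sqn x.
Proof. by apply: le_trans (sqsum_sqn x (F := [::]) _) => //; rewrite /sqsum big_nil. Qed.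

Lemma sqn_coord x i : normc (x i) ^+ 2 <= sqn x.
Proof. by have := sqsum_sqn x (F := [:: i]) isT; rewrite /sqsum big_seq1. Qed.

Lemma sqn_sup x (e : R) : 0 < e -> exists2 F, uniq F & sqn x - e < sqsum F x.
Proof.
move=> e0; have : ((sqn x - e)%:E < sqnorm x)%E by rewrite sqnE lte_fin ltrBlDr ltrDl.
move=> /ereal_sup_gt [_ [F [finF _] <-]] h.
rewrite fsbig_finite//= sumEFin lte_fin in h.
by exists (fset_set F); first exact: fset_uniq.
Qed.

Lemma sqsummable_le (x : I -> R[i]^o) (B : R) :
  (forall F, uniq F -> sqsum F x <= B) -> x \in @sqsummable R I.
Proof. by move=> h; apply/asboolP; apply: le_lt_trans (sqnorm_le h) (ltry _). Qed.

Lemma normcD_sqr (a b : C) : normc (a + b) ^+ 2 <= 2 * normc a ^+ 2 + 2 * normc b ^+ 2.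
Proof.
apply: (@le_trans _ _ ((normc a + normc b) ^+ 2)).
  by rewrite ler_sqr ?nnegrE ?addr_ge0 ?normc_ge0// le_normcD.
by have := sqr_ge0 (normc a - normc b); nra.
Qed.

Lemma sqn0 : sqn 0 = 0.
Proof.
apply/eqP; rewrite eq_le sqn_ge0 andbT; apply: sqn_le => F _.
by rewrite /sqsum big1// => i _; rewrite ell2E0 normc0 expr0n.
Qed.

Lemma sqnD x y : sqn (x + y) <= 2 * sqn x + 2 * sqn y.
Proof.
apply: sqn_le => F uF.
apply: (@le_trans _ _ (2 * sqsum F x + 2 * sqsum F y)); last first.
  by rewrite lerD// ler_wpM2l// sqsum_sqn.
rewrite /sqsum !mulr_sumr -big_split/=; apply: ler_sum => i _; exact: normcD_sqr.
Qed.

Lemma sqnZ (c : C) x : sqn (c *: x) <= normc c ^+ 2 * sqn x.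
Proof.
apply: sqn_le => F uF; apply: (@le_trans _ _ (normc c ^+ 2 * sqsum F x)); last first.
  by rewrite ler_wpM2l ?sqr_ge0// sqsum_sqn.
by rewrite /sqsum mulr_sumr; apply: ler_sum => i _; rewrite ell2EZ normcM exprMn.
Qed.

(** The form of the Cauchy-Schwarz inequality that bounds an l^1 combination of
    vectors in l^2, see [sqn_sum]; by induction it reduces to
    2 b S <= A b^2 + Q when S^2 <= A Q. *)
Lemma weighted_Cauchy_Schwarz J (r : seq J) (a b : J -> R) : (forall j, 0 <= a j) ->
  (\sum_(j <- r) a j * b j) ^+ 2 <= (\sum_(j <- r) a j) * \sum_(j <- r) a j * b j ^+ 2.
Proof.
move=> a0; elim: r => [|j r ih]; first by rewrite !big_nil mul0r expr0n.
rewrite !big_cons.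
set S := \sum_(j <- r) a j * b j in ih *; set A := \sum_(j <- r) a j in ih *.
set Q := \sum_(j <- r) _ in ih *.
have talg0 : 0 <= A by apply: sumr_ge0.
have Q0 : 0 <= Q by apply: sumr_ge0 => k _; rewrite mulr_ge0// sqr_ge0.
suff h : 2 * b j * S <= A * b j ^+ 2 + Q by have := ler_wpM2l (a0 j) h; nra.
have [Ae|An] := eqVneq A 0.
  have : S = 0 by apply/eqP; rewrite -sqrf_eq0 eq_le sqr_ge0 andbT (le_trans ih)// Ae mul0r.
  by move=> ->; rewrite Ae mulr0 mul0r add0r.
have Ap : 0 < A by rewrite lt_def An.
by rewrite -(ler_pM2l Ap); have := sqr_ge0 (A * b j - S); nra.
Qed.

Lemma sqn_sum J (r : seq J) (c : J -> C) (y : J -> ell2 R I) (B : R) :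
  (forall j, sqn (y j) <= B) ->
  sqn (\sum_(j <- r) c j *: y j) <= (\sum_(j <- r) normc (c j)) ^+ 2 * B.
Proof.
move=> yB; apply: sqn_le => F uF; set A := \sum_(j <- r) _.
have talg0 : 0 <= A by apply: sumr_ge0 => j _; exact: normc_ge0.
apply: (@le_trans _ _ (\sum_(i <- F) A * \sum_(j <- r) normc (c j) * normc (y j i) ^+ 2)).
  apply: ler_sum => i _; rewrite ell2Esum.
  apply: le_trans (weighted_Cauchy_Schwarz _ _ _) => [|j]; last exact: normc_ge0.
  rewrite ler_sqr ?nnegrE ?normc_ge0 ?sumr_ge0// => [|j _]; last by rewrite mulr_ge0 ?normc_ge0.
  by apply: le_trans (normc_sum _ _ _) _; apply: ler_sum => j _; rewrite ell2EZ normcM.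
rewrite -mulr_sumr expr2 -mulrA ler_wpM2l// exchange_big/= mulr_suml.
apply: ler_sum => j _; rewrite -mulr_sumr ler_wpM2l ?normc_ge0//.
exact: le_trans (sqsum_sqn _ uF) (yB j).
Qed.

Lemma bounded_lin (T : op R I) : bounded_op T -> linear T. Proof. by case. Qed.

Lemma bounded_bound (T : op R I) : bounded_op T ->
  exists2 M : R, 0 <= M & forall x, sqn (T x) <= M * sqn x.
Proof.
case=> _ [M hM]; exists `|M| => // x.
rewrite -lee_fin -sqnE; apply: le_trans (hM x) _.
by rewrite sqnE -EFinM lee_fin ler_wpM2r ?sqn_ge0// ler_norm.
Qed.

Lemma boundedI (T : op R I) (M : R) : linear T ->
  (forall x, sqn (T x) <= M * sqn x) -> bounded_op T.
Proof. by move=> lT h; split=> //; exists M => x; rewrite !sqnE -EFinM lee_fin. Qed.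

Lemma lin0 (T : op R I) : linear T -> T 0 = 0.
Proof.
move=> lT; have := lT (-1) 0 0.
by rewrite scaler0 addr0 scaleN1r addNr.
Qed.
Lemma linD (T : op R I) x y : linear T -> T (x + y) = T x + T y.
Proof. by move=> lT; have := lT 1 x y; rewrite !scale1r. Qed.
Lemma linZ (T : op R I) (c : C) x : linear T -> T (c *: x) = c *: T x.
Proof. by move=> lT; have := lT c x 0; rewrite !addr0 lin0// addr0. Qed.
Lemma linB (T : op R I) x y : linear T -> T (x - y) = T x - T y.
Proof. by move=> lT; rewrite linD// -scaleN1r linZ// scaleN1r. Qed.
Lemma linsum (T : op R I) J (r : seq J) (P : pred J) (f : J -> ell2 R I) : linear T ->
  T (\sum_(j <- r | P j) f j) = \sum_(j <- r | P j) T (f j).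
Proof. by move=> lT; apply: big_morph => [x y|]; [exact: linD|exact: lin0]. Qed.

Lemma opE0 x : (0 : op R I) x = 0. Proof. by []. Qed.
Lemma opED (S T : op R I) x : (S + T) x = S x + T x. Proof. by []. Qed.
Lemma opEZ c (T : op R I) x : (c *: T) x = c *: T x. Proof. by []. Qed.
Lemma opEN (T : op R I) x : (- T) x = - T x. Proof. by []. Qed.
Lemma opEsum J (r : seq J) (P : pred J) (f : J -> op R I) x :
  (\sum_(j <- r | P j) f j) x = \sum_(j <- r | P j) f j x.
Proof. by apply: (big_morph (fun T : op R I => T x)). Qed.

Lemma bounded0 : bounded_op (0 : op R I).
Proof.
apply: (@boundedI _ 0) => [c x y|x]; first by rewrite /= !opE0 scaler0 addr0.
by rewrite mul0r opE0 sqn0.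
Qed.

Lemma boundedD (S T : op R I) : bounded_op S -> bounded_op T -> bounded_op (S + T).
Proof.
move=> bS bT; have [MS _ hS] := bounded_bound bS; have [MT _ hT] := bounded_bound bT.
apply: (@boundedI _ (2 * MS + 2 * MT)) => [c x y|x].
  by rewrite !opED (bounded_lin bS) (bounded_lin bT) scalerDr addrACA.
rewrite opED; apply: le_trans (sqnD _ _) _.
by rewrite [leRHS]mulrDl -[in leRHS]mulrA -[in leRHS]mulrA lerD// ler_wpM2l.
Qed.

Lemma boundedZ c (T : op R I) : bounded_op T -> bounded_op (c *: T).
Proof.
move=> bT; have [M _ hT] := bounded_bound bT.
apply: (@boundedI _ (normc c ^+ 2 * M)) => [d x y|x].
  by rewrite !opEZ (bounded_lin bT) scalerDr !scalerA mulrC.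
by rewrite opEZ; apply: le_trans (sqnZ _ _) _; rewrite -[leRHS]mulrA ler_wpM2l ?sqr_ge0.
Qed.

Lemma boundedN (T : op R I) : bounded_op T -> bounded_op (- T).
Proof. by move=> bT; rewrite -scaleN1r; exact: boundedZ. Qed.

Lemma boundedB (S T : op R I) : bounded_op S -> bounded_op T -> bounded_op (S - T).
Proof. by move=> bS bT; apply: boundedD => //; exact: boundedN. Qed.

Lemma bounded_comp (S T : op R I) : bounded_op S -> bounded_op T -> bounded_op (S \o T).
Proof.
move=> bS bT; have [MS MS0 hS] := bounded_bound bS; have [MT _ hT] := bounded_bound bT.
apply: (@boundedI _ (MS * MT)) => [c x y|x]; first by rewrite /= (bounded_lin bT) (bounded_lin bS).
by apply: le_trans (hS _) _; rewrite -[leRHS]mulrA ler_wpM2l.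
Qed.

Lemma bounded_sum J (r : seq J) (P : pred J) (f : J -> op R I) :
  (forall j, P j -> bounded_op (f j)) -> bounded_op (\sum_(j <- r | P j) f j).
Proof. by move=> h; apply: big_ind => //; [exact: bounded0|exact: boundedD]. Qed.

Lemma compDl (S T U : op R I) : (S + T) \o U = (S \o U) + (T \o U). Proof. by []. Qed.
Lemma compNl (S U : op R I) : (- S) \o U = - (S \o U). Proof. by []. Qed.
Lemma compZl c (S U : op R I) : (c *: S) \o U = c *: (S \o U). Proof. by []. Qed.
Lemma comp0l (U : op R I) : (0 : op R I) \o U = 0. Proof. by []. Qed.
Lemma compDr (S T U : op R I) : linear U -> U \o (S + T) = (U \o S) + (U \o T).
Proof. by move=> lU; apply/funext => x; rewrite /= !opED linD. Qed.
Lemma compBr (S T U : op R I) : linear U -> U \o (S - T) = (U \o S) - (U \o T).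
Proof. by move=> lU; apply/funext => x; exact: linB. Qed.
Lemma compZr c (S U : op R I) : linear U -> U \o (c *: S) = c *: (U \o S).
Proof. by move=> lU; apply/funext => x; rewrite /= !opEZ linZ. Qed.
Lemma comp0r (U : op R I) : linear U -> U \o (0 : op R I) = 0.
Proof. by move=> lU; apply/funext => x; rewrite /= !opE0 lin0. Qed.
Lemma comp_suml J (r : seq J) (P : pred J) (f : J -> op R I) (U : op R I) :
  (\sum_(j <- r | P j) f j) \o U = \sum_(j <- r | P j) (f j \o U).
Proof. by apply/funext => x; rewrite /= !opEsum. Qed.
Lemma comp_sumr J (r : seq J) (P : pred J) (f : J -> op R I) (U : op R I) : linear U ->
  U \o (\sum_(j <- r | P j) f j) = \sum_(j <- r | P j) (U \o f j).
Proof. by move=> lU; apply/funext => x; rewrite /= !opEsum linsum. Qed.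

Lemma entryD (S T : op R I) i j : entry (S + T) i j = entry S i j + entry T i j.
Proof. by []. Qed.
Lemma entryB (S T : op R I) i j : entry (S - T) i j = entry S i j - entry T i j.
Proof. by []. Qed.
Lemma entryZ c (T : op R I) i j : entry (c *: T) i j = c * entry T i j.
Proof. by []. Qed.
Lemma entry0 i j : entry (0 : op R I) i j = 0. Proof. by []. Qed.
Lemma entry_sum J (r : seq J) (P : pred J) (f : J -> op R I) i j :
  entry (\sum_(k <- r | P k) f k) i j = \sum_(k <- r | P k) entry (f k) i j.
Proof. by rewrite /entry opEsum ell2Esum. Qed.

(** The value is 0 where the formula leaves l^2, which spares a proof of
    square-summability inside each definition. *)
Definition op_of (phi : ell2 R I -> (I -> R[i]^o)) : op R I :=
  fun x => insubd (0 : ell2 R I) (phi x).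

Lemma op_ofE (phi : ell2 R I -> (I -> R[i]^o)) x i : phi x \in @sqsummable R I -> op_of phi x i = phi x i.
Proof. by move=> h; rewrite /op_of -[LHS]/(val (insubd 0 (phi x)) i) insubdK. Qed.

(** Both the unitaries and the matrix units of the fibre move coordinates
    injectively, up to bounded weights; hence they are bounded. *)
Section PartialPermutation.
Variables (w : I -> C) (sigma : I -> I) (M : R).
Hypothesis w_le : forall i, normc (w i) <= M.
Hypothesis sigma_inj : forall i j, w i != 0 -> w j != 0 -> sigma i = sigma j -> i = j.

Let perm_bound x F : uniq F -> sqsum F (fun i => w i * x (sigma i)) <= M ^+ 2 * sqn x.
Proof.
move=> uF; rewrite /sqsum.
rewrite (bigID (fun i => w i == 0))/= big1 ?add0r => [|i /eqP ->]; last first.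
  by rewrite mul0r normc0 expr0n.
rewrite -big_filter; set F' := [seq i <- F | _].
apply: (@le_trans _ _ (\sum_(i <- F') M ^+ 2 * normc (x (sigma i)) ^+ 2)).
  apply: ler_sum => i _; rewrite normcM exprMn ler_wpM2r ?sqr_ge0//.
  by rewrite ler_sqr ?nnegrE ?normc_ge0// (le_trans (normc_ge0 (w i))).
rewrite -mulr_sumr ler_wpM2l ?sqr_ge0//.
have <- : sqsum [seq sigma i | i <- F'] x = \sum_(i <- F') normc (x (sigma i)) ^+ 2.
  by rewrite /sqsum big_map.
apply: sqsum_sqn; rewrite map_inj_in_uniq ?filter_uniq// => i j.
by rewrite !mem_filter => /andP[wi _] /andP[wj _]; exact: sigma_inj.
Qed.

Lemma pperm_sqsummable x : (fun i => w i * x (sigma i)) \in @sqsummable R I.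
Proof. exact: sqsummable_le (@perm_bound x). Qed.

Lemma pperm_sqn x : sqn (op_of (fun x i => w i * x (sigma i)) x) <= M ^+ 2 * sqn x.
Proof.
apply: sqn_le => F uF; apply: le_trans (perm_bound x uF); rewrite le_eqVlt; apply/orP; left.
by apply/eqP/eq_bigr => i _; rewrite op_ofE ?pperm_sqsummable.
Qed.

Lemma pperm_bounded : bounded_op (op_of (fun x i => w i * x (sigma i))).
Proof.
apply: (@boundedI _ (M ^+ 2)) => [c x y|x]; last exact: pperm_sqn.
apply: ell2P => i; rewrite ell2ED ell2EZ !op_ofE ?pperm_sqsummable//.
by rewrite ell2ED ell2EZ mulrDr mulrCA.
Qed.

End PartialPermutation.

End Ell2Theory.

(** * Weights on the lattice *)

Section WeightTheory.
Variables (R : realType) (d : nat).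
Local Notation C := R[i].
Implicit Types r : 'rV[int]_d.

(** The weight of the seminorms, as a real number. *)
Definition wt r : R := (1 + \sum_j `|r 0 j|)%:~R.

Lemma weightE r : weight R r = (wt r)%:C%C.
Proof. by rewrite /weight /wt; rewrite rmorph_int. Qed.

Lemma wt_ge1 r : 1 <= wt r.
Proof. by rewrite /wt rmorphD/= lerDl ler0z sumr_ge0. Qed.
Lemma wt_gt0 r : 0 < wt r. Proof. exact: lt_le_trans ltr01 (wt_ge1 r). Qed.
Lemma wt_ge0 r : 0 <= wt r. Proof. exact: ltW (wt_gt0 r). Qed.
Lemma wtX_gt0 r k : 0 < wt r ^+ k. Proof. by rewrite exprn_gt0// wt_gt0. Qed.
Lemma wtX_ge0 r k : 0 <= wt r ^+ k. Proof. exact: ltW (wtX_gt0 r k). Qed.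
Lemma wtD r (s : 'rV[int]_d) : wt (r + s) <= wt r * wt s.
Proof.
rewrite /wt -rmorphM/= ler_int.
apply: (@le_trans _ _ (1 + (\sum_j `|r 0 j| + \sum_j `|s 0 j|))).
  rewrite lerD2l -big_split; apply: ler_sum => j _; rewrite mxE; exact: ler_normD.
have a0 : 0 <= \sum_j `|r 0 j| by apply: sumr_ge0.
have b0 : 0 <= \sum_j `|s 0 j| by apply: sumr_ge0.
move: (\sum_j `|r 0 j|) (\sum_j `|s 0 j|) a0 b0 => a b a0 b0.
by rewrite -subr_ge0 (_ : _ - _ = a * b) ?mulr_ge0//; ring.
Qed.

Lemma wtDX r (s : 'rV[int]_d) k : wt (r + s) ^+ k <= wt r ^+ k * wt s ^+ k.
Proof. by rewrite -exprMn lerXn2r ?nnegrE ?mulr_ge0 ?wt_ge0 ?wtD. Qed.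

Lemma wt_coord r j : `|r 0 j|%:~R <= wt r :> R.
Proof.
rewrite /wt ler_int (bigD1 j)//= addrCA lerDl addr_ge0// sumr_ge0//.
Qed.

Lemma wt_coord1 r j : 1 + `|r 0 j|%:~R <= wt r :> R.
Proof.
by rewrite /wt rmorphD/= lerD2l ler_int (bigD1 j)//= lerDl sumr_ge0.
Qed.

Let f (z : int) : R := ((1 + `|z|%:~R) ^+ 2)^-1.

Let f_ge0 z : 0 <= f z. Proof. by rewrite invr_ge0 sqr_ge0. Qed.

(** Telescoping: 1 / (k + 1)^2 <= 1 / k - 1 / (k + 1) on both sides of 0. *)
Let sum_f n : \sum_(i < n.*2.+1) f (i%:Z - n%:Z) <= 3 - 2 / n.+1%:R.
Proof.
elim: n => [|n ih].
  by rewrite big_ord1 /f subrr normr0 addr0 expr1n invr1; lra.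
rewrite doubleS big_ord_recl big_ord_recr/= /bump/=.
have -> : \sum_(i < n.*2.+1) f (Posz (1 + i) - Posz n.+1) = \sum_(i < n.*2.+1) f (i%:Z - n%:Z).
  by apply: eq_bigr => i _; congr f; lia.
have -> : f (0%:Z - n.+1%:Z) = (n.+2%:R ^+ 2)^-1.
  rewrite /f (_ : `|_| = n.+1%:Z); last by lia.
  by rewrite -(natrD _ 1%N).
have -> : f ((1 + n.*2.+1)%N%:Z - n.+1%:Z) = (n.+2%:R ^+ 2)^-1.
  rewrite /f (_ : `|_| = n.+1%:Z); last by lia.
  by rewrite -(natrD _ 1%N).
apply: (@le_trans _ _ (3 - 2 / n.+1%:R + 2 * (n.+2%:R ^+ 2)^-1)).
  move: ih; move: (2 / n.+1%:R : R) ((n.+2%:R ^+ 2)^-1 : R) (\sum_(i < _) _) => a b c.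
  by lra.
rewrite -!addrA lerD2l -subr_ge0.
have n1 : 0 < n.+1%:R :> R by [].
have -> : n.+2%:R = n.+1%:R + 1 :> R by rewrite -natr1.
set t : R := n.+1%:R in n1 *.
rewrite (_ : _ - _ = 2 / (t * (t + 1) ^+ 2)); last by field; rewrite !gt_eqF//; lra.
by rewrite divr_ge0// mulr_ge0 ?sqr_ge0// ltW.
Qed.

(** The weight dominates the product of the 1 + |r_j|, so the sum over a box is at
    most a product of one-dimensional sums, each at most 3. *)
Lemma sum_wt (s : seq 'rV[int]_d) : uniq s ->
  \sum_(r <- s) (wt r ^+ (2 * d))^-1 <= 3 ^+ d.
Proof.
move=> us; pose n := (\max_(r <- s) \max_j absz (r 0%R j))%N.
have sn r j : r \in s -> (absz (r 0%R j) <= n)%N.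
  move=> rs.
  have h1 := @leq_bigmax_seq _ s xpredT (fun r : 'rV[int]_d => \max_j absz (r 0%R j))%N r rs isT.
  have h2 := @leq_bigmax _ (fun j => absz (r 0%R j)) j.
  exact: leq_trans h2 h1.
pose c r : {ffun 'I_d -> 'I_(n.*2.+1)} := [ffun j => inord `|(r 0 j + n%:Z)%R|].
pose G (h : {ffun 'I_d -> 'I_(n.*2.+1)}) := \prod_j f ((h j)%:Z - n%:Z).
have cE r j : r \in s -> (c r j)%:Z - n%:Z = r 0 j.
  by move=> rs; have := sn r j rs; rewrite ffunE; move: (r 0%R j) => z hz; rewrite inordK; lia.
apply: (@le_trans _ _ (\sum_(r <- s) G (c r))).
  rewrite big_seq [leRHS]big_seq; apply: ler_sum => r rs.
  rewrite /G (eq_bigr (fun j => f (r 0 j))) => [|j _]; last by rewrite cE.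
  have P0 : 0 < \prod_j f (r 0 j).
    by apply: prodr_gt0 => j _; rewrite invr_gt0 exprn_gt0// ltr_pwDl.
  rewrite -[leRHS]invrK lef_pV2 ?posrE ?wtX_gt0 ?invr_gt0//.
  rewrite /f prodfV invrK exprM.
  rewrite (_ : wt r ^+ 2 ^+ d = \prod_(j < d) wt r ^+ 2); last first.
    by rewrite prodr_const card_ord.
  apply: ler_prod => j _; rewrite sqr_ge0/= lerXn2r ?nnegrE ?wt_ge0 ?addr_ge0//.
  exact: wt_coord1.
have c_inj : {in s &, injective c}.
  move=> r r' rs r's /(congr1 (fun h : {ffun _} => h)) e.
  by apply/rowP => j; rewrite -(cE r j rs) -(cE r' j r's) e.
rewrite -(big_map c predT G) /= big_uniq ?map_inj_in_uniq//=.
apply: (@le_trans _ _ (\sum_h G h)).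
  rewrite [leRHS](bigID (fun h => h \in [seq c r | r <- s]))/= lerDl.
  by apply: sumr_ge0 => h _; apply: prodr_ge0.
rewrite -(bigA_distr_bigA (fun _ (i : 'I_(n.*2.+1)) => f (i%:Z - n%:Z))) /=.
rewrite prodr_const card_ord lerXn2r ?nnegrE ?sumr_ge0//.
by apply: le_trans (sum_f n) _; rewrite lerBlDr lerDl.
Qed.

Lemma wt_ball (B : R) : exists2 s : seq 'rV[int]_d, uniq s & forall r, r \notin s -> B < wt r.
Proof.
have [n Bn] : exists n : nat, B < n%:R by exists (Num.trunc B).+1; rewrite truncnS_gt.
pose u (h : {ffun 'I_d -> 'I_(n.*2.+1)}) : 'rV[int]_d := \row_j ((h j)%:Z - n%:Z).
exists (undup [seq u h | h : {ffun 'I_d -> 'I_(n.*2.+1)}]); first exact: undup_uniq.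
move=> r; rewrite mem_undup => rs; rewrite ltNge; apply/negP => wB; case/negP: rs.
have rn j : `|r 0 j| <= n%:Z.
  by rewrite -(ler_int R) ltW// (le_lt_trans _ Bn)// (le_trans _ wB)// wt_coord.
apply/mapP; exists [ffun j => inord `|(r 0 j + n%:Z)%R|]; first by rewrite mem_enum.
by apply/rowP => j; rewrite mxE ffunE; have := rn j; move: (r 0%R j) => z hz; rewrite inordK; lia.
Qed.

(** Rapid decrease with real bounds, see [rdecrP]. *)
Definition rdecr (a : 'rV[int]_d -> C) : Prop :=
  forall k : nat, exists2 M : R, 0 <= M & forall r, wt r ^+ k * normc (a r) <= M.

Lemma rdecrP a : rapidly_decreasing a <-> rdecr a.
Proof.
split=> h k; have [M] := h k.
  move=> hM; exists (complex.Re M) => [|r].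
    have := hM 0; rewrite weightE norm_normc -rmorphXn -rmorphM/= lecE => /andP[_ /=].
    by apply: le_trans; rewrite mulr_ge0 ?normc_ge0 ?wtX_ge0.
  by have := hM r; rewrite weightE norm_normc -rmorphXn -rmorphM/= lecE => /andP[_ /=].
move=> _ hM; exists M%:C%C => r.
by rewrite weightE norm_normc -rmorphXn -rmorphM/= lecR.
Qed.

Lemma rdecr_sum a : rdecr a ->
  exists2 B : R, 0 <= B & forall s : seq 'rV[int]_d, uniq s -> \sum_(r <- s) normc (a r) <= B.
Proof.
move=> /(_ (2 * d)%N) [M M0 hM]; exists (M * 3 ^+ d) => [|s us].
  by rewrite mulr_ge0// exprn_ge0.
apply: (@le_trans _ _ (\sum_(r <- s) M * (wt r ^+ (2 * d))^-1)).
  by apply: ler_sum => r _; rewrite ler_pdivlMr ?wtX_gt0// mulrC hM.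
by rewrite -mulr_sumr ler_wpM2l// sum_wt.
Qed.

Lemma rdecr_tail a k (e : R) : rdecr a -> 0 < e ->
  exists2 s : seq 'rV[int]_d, uniq s & forall r, r \notin s -> wt r ^+ k * normc (a r) <= e.
Proof.
move=> /(_ k.+1) [M M0 hM] e0; have [s us hs] := wt_ball (M / e); exists s => // r rs.
have := hs r rs; rewrite ltr_pdivrMr// => lt1.
have := hM r; rewrite exprS -mulrA; set A := wt r ^+ k * _ => h.
have := le_lt_trans h lt1; rewrite ltr_pM2l ?wt_gt0//; exact: ltW.
Qed.

Lemma rdecr0 : rdecr (fun _ => 0).
Proof. by move=> k; exists 0 => // r; rewrite normc0 mulr0. Qed.

Lemma rdecrD a b : rdecr a -> rdecr b -> rdecr (fun r => a r + b r).
Proof.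
move=> ha hb k; have [M M0 hM] := ha k; have [M' M0' hM'] := hb k.
exists (M + M') => [|r]; first by rewrite addr_ge0.
apply: le_trans (lerD (hM r) (hM' r)); rewrite -mulrDr ler_wpM2l ?wtX_ge0//.
exact: le_normcD.
Qed.

Lemma rdecrZ c a : rdecr a -> rdecr (fun r => c * a r).
Proof.
move=> ha k; have [M M0 hM] := ha k; exists (normc c * M) => [|r].
  by rewrite mulr_ge0 ?normc_ge0.
by rewrite normcM mulrCA ler_wpM2l ?normc_ge0.
Qed.

Lemma rdecr_delta r0 : rdecr (fun r => (r == r0)%:R).
Proof.
move=> k; exists (wt r0 ^+ k) => [|r]; first exact: wtX_ge0.
by case: eqP => [->|_]; rewrite ?normc1 ?normc0 ?mulr1 ?mulr0 ?wtX_ge0.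
Qed.

Lemma rdecr_coord (j : 'I_d) a : rdecr a -> rdecr (fun r => (r 0 j)%:~R * a r).
Proof.
move=> ha k; have [M M0 hM] := ha k.+1; exists M => // r.
rewrite normcM; apply: le_trans (hM r); rewrite exprSr -mulrA ler_wpM2l ?wtX_ge0//.
rewrite ler_wpM2r ?normc_ge0//.
have -> : normc (r 0 j)%:~R = `|r 0 j|%:~R :> R.
  by apply: (@complexI R); rewrite -norm_normc rmorph_int intr_norm.
exact: wt_coord.
Qed.

End WeightTheory.

(** * Convergence along finite sets *)

Section Nets.
Variables (R : realType) (T : eqType).
Local Notation C := R[i].
Implicit Types (u v : seq T -> C) (l : C).

Lemma normc_small (z : C) : (forall e : R, 0 < e -> normc z <= e) -> z = 0.
Proof.
move=> h; apply: eq0_normc; apply/eqP; rewrite eq_le normc_ge0 andbT.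
by apply/ler_addgt0Pr => e e0; rewrite add0r h.
Qed.

(** Convergence along the directed family of finite subsets: unconditional
    summation, with subsets listed as duplicate-free sequences. *)
Definition scvg u l := forall e : R, 0 < e ->
  exists s0 : seq T, forall s, uniq s -> {subset s0 <= s} -> normc (u s - l) <= e.

Lemma scvg_const l : scvg (fun _ => l) l.
Proof. by move=> e e0; exists [::] => s _ _; rewrite subrr normc0 ltW. Qed.

Lemma scvgD u v l m : scvg u l -> scvg v m -> scvg (fun s => u s + v s) (l + m).
Proof.
move=> hu hv e e0; have e2 : 0 < e / 2 by rewrite divr_gt0.
have [s1 h1] := hu _ e2; have [s2 h2] := hv _ e2; exists (s1 ++ s2) => s us ss.
rewrite opprD addrACA (le_trans (le_normcD _ _))// [leRHS](splitr e).
by rewrite lerD ?h1 ?h2// => x xs; apply: ss; rewrite mem_cat xs ?orbT.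
Qed.

Lemma scvgZ c u l : scvg u l -> scvg (fun s => c * u s) (c * l).
Proof.
move=> hu e e0; have c0 : 0 < normc c + 1 by rewrite ltr_wpDl ?normc_ge0.
have [s0 h] := hu _ (divr_gt0 e0 c0); exists s0 => s us ss.
rewrite -mulrBr normcM; apply: le_trans (ler_wpM2l (normc_ge0 c) (h s us ss)) _.
by rewrite mulrA ler_pdivrMr// mulrC ler_pM2l// lerDl.
Qed.

Lemma scvg_sum J (r : seq J) (u : J -> seq T -> C) (l : J -> C) :
  (forall j, scvg (u j) (l j)) -> scvg (fun s => \sum_(j <- r) u j s) (\sum_(j <- r) l j).
Proof.
move=> h; elim: r => [|j r ih].
  by rewrite big_nil; under eq_fun do rewrite big_nil; exact: scvg_const.
by rewrite big_cons; under eq_fun do rewrite big_cons; exact: scvgD.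
Qed.

Lemma scvg_uniq u l m : scvg u l -> scvg u m -> l = m.
Proof.
move=> hl hm; apply/eqP; rewrite -subr_eq0; apply/eqP/normc_small => e e0.
have e2 : 0 < e / 2 by rewrite divr_gt0.
have [s1 h1] := hl _ e2; have [s2 h2] := hm _ e2.
have us := undup_uniq (s1 ++ s2).
have -> : l - m = (u (undup (s1 ++ s2)) - m) - (u (undup (s1 ++ s2)) - l).
  by ring.
rewrite (le_trans (le_normcD _ _))// [leRHS](splitr e) normcN.
by rewrite lerD ?h1 ?h2// => x xs; rewrite mem_undup mem_cat xs ?orbT.
Qed.

Lemma scvg_le u l (B : R) : scvg u l -> (forall s, uniq s -> normc (u s) <= B) -> normc l <= B.
Proof.
move=> h hB; apply/ler_addgt0Pr => e e0; have [s0 hs] := h e e0.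
have us := undup_uniq s0.
have -> : l = u (undup s0) - (u (undup s0) - l) by ring.
rewrite (le_trans (le_normcD _ _))// normcN lerD ?hB ?hs// => x.
by rewrite mem_undup.
Qed.

End Nets.

(** * The cocycle of a noncommutative torus *)

Section Cocycle.
Variables (R : realType) (n : nat) (Theta : 'M[R]_n).
Local Notation sg := (torus_cocycle Theta).

Lemma expiD (s t : R) : expi (s + t) = expi s * expi t.
Proof.
rewrite /expi cosD sinD; apply/eqP; rewrite eq_complex /= eqxx/=.
by apply/eqP; ring.
Qed.

Lemma expi0 : expi (0 : R) = 1. Proof. by rewrite /expi cos0 sin0. Qed.

Lemma normc_expi (t : R) : normc (expi t) = 1.
Proof. by rewrite /expi /= cos2Dsin2 sqrtr1. Qed.

Lemma normc_cocycle r s : normc (sg r s) = 1. Proof. exact: normc_expi. Qed.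

Lemma cocycleDl r r' s : sg (r + r') s = sg r s * sg r' s.
Proof.
rewrite /torus_cocycle -expiD -mulrDr -big_split/=; congr (expi (_ * _)).
apply: eq_bigr => i _; rewrite -big_split/=; apply: eq_bigr => j _.
by rewrite mxE rmorphD/= mulrDr mulrDl.
Qed.

Lemma cocycleDr r s s' : sg r (s + s') = sg r s * sg r s'.
Proof.
rewrite /torus_cocycle -expiD -mulrDr -big_split/=; congr (expi (_ * _)).
apply: eq_bigr => i _; rewrite -big_split/=; apply: eq_bigr => j _.
by rewrite mxE rmorphD/= mulrDr.
Qed.

Lemma cocycle0l s : sg 0 s = 1.
Proof.
rewrite /torus_cocycle big1 ?mulr0 ?expi0// => i _; rewrite big1// => j _.
by rewrite mxE mulr0 mul0r.
Qed.

Lemma cocycle0r r : sg r 0 = 1.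
Proof.
rewrite /torus_cocycle big1 ?mulr0 ?expi0// => i _; rewrite big1// => j _.
by rewrite mxE mulr0.
Qed.

End Cocycle.

(** * Operators over a lattice *)

(** The spinor index sets of the two tori and of their product, seen uniformly as
    Z^d times a finite fibre; for the product this flattens the pair of fibres
    into one, so that matrices on it can be Kronecker products. *)
Record lattice (d P : nat) (K : choiceType) := Lattice {
  lpos : K -> 'rV[int]_d;
  lfib : K -> 'I_P;
  lmk : 'rV[int]_d -> 'I_P -> K;
  lposK : forall r f, lpos (lmk r f) = r;
  lfibK : forall r f, lfib (lmk r f) = f;
  lmkK : forall p, lmk (lpos p) (lfib p) = p }.

(** The unitary U^r on the GNS space, acting trivially on the fibre. *)
HB.lock Definition monomial (R : realType) (d P : nat) (K : choiceType) (X : lattice d P K)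
    (Theta : 'M[R]_d) (r : 'rV[int]_d) : op R K :=
  op_of (fun x i => torus_cocycle Theta r (lpos X i - r) *
    x (lmk X (lpos X i - r) (lfib X i))).
Arguments monomial {R d P K} X Theta r _.

(** 1 (x) v. *)
HB.lock Definition fibre_op (R : realType) (d P : nat) (K : choiceType) (X : lattice d P K)
    (v : 'M[R[i]]_P) : op R K :=
  op_of (fun x i => \sum_k v (lfib X i) k * x (lmk X (lpos X i) k)).
Arguments fibre_op {R d P K} X v _.

Section LatticeOps.
Variables (R : realType) (d P : nat) (K : choiceType) (X : lattice d P K).
Variables (Theta : 'M[R]_d) (f0 : 'I_P).
Local Notation C := R[i].
Local Notation pos := (lpos X).
Local Notation fib := (lfib X).
Local Notation mk := (lmk X).
Local Notation sg := (torus_cocycle Theta).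
Local Notation A := (torus_alg Theta pos fib).
Local Notation bas := (@Defs.basis R K).
Local Notation U := (monomial X Theta).
Local Notation F := (@fibre_op R d P K X).
Implicit Types (x y : ell2 R K) (s : seq 'rV[int]_d) (i j p : K) (T S : op R K).
Implicit Types (u v : 'M[R[i]]_P).

Lemma lmk_eq p r f : (p == mk r f) = (pos p == r) && (fib p == f).
Proof.
apply/eqP/andP => [->|[/eqP <- /eqP <-]]; first by rewrite lposK lfibK.
by rewrite lmkK.
Qed.

Lemma lattice_eq p q : (p == q) = (pos p == pos q) && (fib p == fib q).
Proof. by rewrite -lmk_eq lmkK. Qed.

Lemma basisE j i : bas j i = (i == j)%:R. Proof. by []. Qed.

Definition trunc s x : ell2 R K :=
  \sum_(r <- s) \sum_f x (mk r f) *: bas (mk r f).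

Lemma truncE s x p : uniq s -> trunc s x p = if pos p \in s then x p else 0.
Proof.
move=> us; rewrite /trunc ell2Esum.
under eq_bigr => r _.
  rewrite ell2Esum (bigD1 (fib p))// ell2EZ basisE lmk_eq eqxx andbT.
  rewrite big1 => [|f fp]; last first.
    by rewrite ell2EZ basisE lmk_eq [fib p == f]eq_sym (negPf fp) andbF mulr0.
  rewrite /= addr0; over.
case: ifPn => ps.
  rewrite (bigD1_seq (pos p))//= eqxx mulr1 lmkK big1 ?addr0// => r rp.
  by rewrite [pos p == r]eq_sym (negPf rp) mulr0.
rewrite big_seq big1// => r rs; case: eqP => [e|_]; last by rewrite mulr0.
by rewrite -e (negPf ps) in rs.
Qed.

Lemma approx x (e : R) : 0 < e -> exists s0, forall s, uniq s -> {subset s0 <= s} ->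
  sqn (x - trunc s x) <= e.
Proof.
move=> e0; have [F uF hF] := sqn_sup x e0; exists [seq pos p | p <- F] => s us ss.
apply: sqn_le => G uG; pose G' := [seq i <- G | pos i \notin s].
have -> : sqsum G (x - trunc s x) = sqsum G' x.
  rewrite /sqsum [RHS]big_filter [RHS]big_mkcond; apply: eq_bigr => i _.
  rewrite ell2ED ell2EN truncE//; case: ifP => _ /=; last by rewrite subr0.
  by rewrite subrr normc0 expr0n.
have uFG : uniq (F ++ G').
  rewrite cat_uniq uF filter_uniq// andbT; apply/hasPn => i /=.
  by rewrite mem_filter => /andP[+ _]; apply: contra => iF; exact/ss/map_f.
have := sqsum_sqn x uFG; rewrite /sqsum big_cat/= -!/(sqsum _ _).
by move: hF; lra.
Qed.

Definition row_sum T i x s : C := \sum_(r <- s) \sum_f x (mk r f) * entry T i (mk r f).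

Lemma trunc_op T i x s : linear T -> T (trunc s x) i = row_sum T i x s.
Proof.
move=> lT; rewrite /trunc linsum// ell2Esum; apply: eq_bigr => r _.
by rewrite linsum// ell2Esum; apply: eq_bigr => f _; rewrite linZ.
Qed.

(** A bounded operator is determined by its matrix: truncating x to finitely many
    lattice points changes T x by little.  Whole fibres are kept, which makes the
    truncation commute with Dirac operators. *)
Lemma row_sum_cvg T i x : bounded_op T -> scvg (row_sum T i x) (T x i).
Proof.
move=> bT e e0; have [M M0 hM] := bounded_bound bT.
have M1 : 0 < M + 1 by rewrite ltr_wpDl.
have e1 : 0 < e ^+ 2 / (M + 1) by rewrite divr_gt0// exprn_gt0.
have [s0 hs] := approx x e1; exists s0 => s us ss.
rewrite -(trunc_op _ _ _ (bounded_lin bT)) -normcN opprB.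
rewrite -ell2EN -ell2ED -(linB _ _ (bounded_lin bT)).
rewrite -(@ler_pXn2r _ 2) ?nnegrE ?normc_ge0 ?(ltW e0)//.
apply: le_trans (sqn_coord _ _) _; apply: le_trans (hM _) _.
apply: le_trans (ler_wpM2l M0 (hs s us ss)) _.
by rewrite mulrA ler_pdivrMr// mulrC ler_wpM2l ?sqr_ge0// lerDl.
Qed.

Lemma entry_ext T S : bounded_op T -> bounded_op S ->
  (forall i j, entry T i j = entry S i j) -> T = S.
Proof.
move=> bT bS h; apply/funext => x; apply: ell2P => i.
apply: scvg_uniq (row_sum_cvg i x bT) _.
have -> : row_sum T i x = row_sum S i x; last exact: row_sum_cvg.
by apply/funext => s; apply: eq_bigr => r _; apply: eq_bigr => f _; rewrite h.
Qed.

Lemma monomial_bounded r : bounded_op (U r).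
Proof.
rewrite monomial.unlock; apply: (@pperm_bounded _ _ _ _ 1) => [i|i j _ _ /eqP]; first by rewrite normc_cocycle.
by rewrite lmk_eq lposK lfibK (inj_eq (addIr _)) -lattice_eq => /eqP.
Qed.

Lemma monomial_sqn r x : sqn (U r x) <= sqn x.
Proof.
rewrite monomial.unlock -[leRHS]mul1r -[X in X * _](expr1n _ 2).
apply: (@pperm_sqn _ _ _ (fun i => mk (pos i - r) (fib i)) 1) => [i|i j _ _ /eqP].
  by rewrite normc_cocycle.
by rewrite lmk_eq lposK lfibK (inj_eq (addIr _)) -lattice_eq => /eqP.
Qed.

Lemma monomialE r x i : U r x i = sg r (pos i - r) * x (mk (pos i - r) (fib i)).
Proof.
rewrite monomial.unlock op_ofE//; apply: (@pperm_sqsummable _ _ _ _ 1) => [j|j k _ _ /eqP].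
  by rewrite normc_cocycle.
by rewrite lmk_eq lposK lfibK (inj_eq (addIr _)) -lattice_eq => /eqP.
Qed.

Lemma entry_monomial r i j : entry (U r) i j =
  if fib i == fib j then (pos i - pos j == r)%:R * sg (pos i - pos j) (pos j) else 0.
Proof.
rewrite /entry monomialE basisE [_ == j]eq_sym lmk_eq [fib j == _]eq_sym andbC.
case: ifP => _ /=; last by rewrite mulr0.
rewrite [RHS]mulrC [pos j == _]eq_sym subr_eq [pos j + r]addrC -subr_eq.
case: eqP => [<-|_]; last by rewrite !mulr0.
by rewrite opprB [pos i + _]addrC subrK mulrC.
Qed.

Let fterm (v : 'M[C]_P) (f k : 'I_P) : op R K :=
  op_of (fun x i => (if fib i == f then v f k else 0) * x (mk (pos i) k)).

Let fterm_inj (v : 'M[C]_P) f k i j :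
  (if fib i == f then v f k else 0) != 0 -> (if fib j == f then v f k else 0) != 0 ->
  mk (pos i) k = mk (pos j) k -> i = j.
Proof.
case: ifP => [/eqP fi|_]; last by rewrite eqxx.
case: ifP => [/eqP fj|_ _]; last by rewrite eqxx.
move=> _ _ /eqP; rewrite lmk_eq lposK => /andP[/eqP pp _].
by apply/eqP; rewrite lattice_eq pp fi fj !eqxx.
Qed.

Let fterm_le (v : 'M[C]_P) f k i : normc (if fib i == f then v f k else 0) <= normc (v f k).
Proof. by case: ifP => // _; rewrite normc0 normc_ge0. Qed.

Let F_fterm (v : 'M[C]_P) x : (fun i => \sum_k v (fib i) k * x (mk (pos i) k)) =
  ((\sum_f \sum_k fterm v f k) x : K -> R[i]^o).
Proof.
apply/funext => i.
have fE f k : fterm v f k x i = (if fib i == f then v f k else 0) * x (mk (pos i) k).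
  rewrite op_ofE//.
  exact: (@pperm_sqsummable _ _ _ (fun i => mk (pos i) k) _ (fterm_le v f k) (@fterm_inj v f k)).
have e f : (\sum_k fterm v f k) x i =
    if fib i == f then \sum_k v f k * x (mk (pos i) k) else 0.
  rewrite opEsum ell2Esum; under eq_bigr do rewrite fE.
  by case: ifP => // _; rewrite big1// => k _; rewrite mul0r.
rewrite opEsum ell2Esum; under [RHS]eq_bigr do rewrite e.
rewrite -big_mkcond (big_pred1 (fib i))// => f /=; exact: eq_sym.
Qed.

Lemma fibre_opE v x i : F v x i = \sum_k v (fib i) k * x (mk (pos i) k).
Proof. by rewrite fibre_op.unlock op_ofE// F_fterm; exact: ell2_valP. Qed.

Lemma fibre_op_bounded v : bounded_op (F v).
Proof.
have -> : F v = \sum_f \sum_k fterm v f k.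
  by apply/funext => x; apply: ell2P => i; rewrite fibre_opE -F_fterm.
apply: bounded_sum => f _; apply: bounded_sum => k _.
exact: (@pperm_bounded _ _ _ (fun i => mk (pos i) k) _ (fterm_le v f k) (@fterm_inj v f k)).
Qed.

Lemma entry_fibre_op v i j : entry (F v) i j = if pos i == pos j then v (fib i) (fib j) else 0.
Proof.
rewrite /entry fibre_opE; under eq_bigr do rewrite basisE [_ == j]eq_sym lmk_eq.
rewrite [pos j == _]eq_sym; case: ifP => _ /=; last by rewrite big1// => k _; rewrite mulr0.
rewrite (bigD1 (fib j))//= eqxx mulr1 big1 ?addr0// => k kj.
by rewrite eq_sym (negPf kj) mulr0.
Qed.

Lemma entry_fibre_comp v T i j : entry (F v \o T) i j = \sum_k v (fib i) k * entry T (mk (pos i) k) j.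
Proof. exact: fibre_opE. Qed.

Lemma fibre_op_basis v j : F v (bas j) = \sum_k v k (fib j) *: bas (mk (pos j) k).
Proof.
apply: ell2P => i; rewrite -/(entry (F v) i j) entry_fibre_op ell2Esum.
under eq_bigr do rewrite ell2EZ basisE lmk_eq.
case: ifP => _ /=; last by rewrite big1// => k _; rewrite mulr0.
rewrite (bigD1 (fib i))//= eqxx mulr1 big1 ?addr0// => k ki.
by rewrite eq_sym (negPf ki) mulr0.
Qed.

Lemma entry_comp_fibre v T i j : linear T ->
  entry (T \o F v) i j = \sum_k v k (fib j) * entry T i (mk (pos j) k).
Proof.
move=> lT; rewrite /entry /= fibre_op_basis linsum// ell2Esum.
by apply: eq_bigr => k _; rewrite linZ.
Qed.

Lemma fibre_op_linear (c : C) (u v : 'M[C]_P) : F (c *: u + v) = c *: F u + F v.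
Proof.
apply/funext => x; apply: ell2P => i; rewrite opED opEZ ell2ED ell2EZ !fibre_opE mulr_sumr -big_split/=.
by apply: eq_bigr => k _; rewrite !mxE mulrDl mulrA.
Qed.
Lemma fibre_op0 : F 0 = 0.
Proof.
by apply/funext => x; apply: ell2P => i; rewrite fibre_opE big1// => k _; rewrite mxE mul0r.
Qed.
Lemma fibre_opD (u v : 'M[C]_P) : F (u + v) = F u + F v.
Proof. by have := fibre_op_linear 1 u v; rewrite !scale1r. Qed.
Lemma fibre_opZ c (u : 'M[C]_P) : F (c *: u) = c *: F u.
Proof. by have := fibre_op_linear c u 0; rewrite !addr0 fibre_op0 addr0. Qed.
Lemma fibre_opB (u v : 'M[C]_P) : F (u - v) = F u - F v.
Proof. by rewrite fibre_opD -scaleN1r fibre_opZ scaleN1r. Qed.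
Lemma fibre_op_sum J (r : seq J) (Q : pred J) (v : J -> 'M[C]_P) :
  F (\sum_(j <- r | Q j) v j) = \sum_(j <- r | Q j) F (v j).
Proof. by apply: (big_morph F fibre_opD fibre_op0). Qed.

Lemma fibre_op1 : F 1%:M = id.
Proof.
apply/funext => x; apply: ell2P => i; rewrite fibre_opE (bigD1 (fib i))//= mxE eqxx mul1r lmkK.
by rewrite big1 ?addr0// => k ki; rewrite mxE eq_sym (negPf ki) mul0r.
Qed.

Lemma fibre_opM u v : F u \o F v = F (u *m v).
Proof.
apply/funext => x; apply: ell2P => i; rewrite /= !fibre_opE.
under [RHS]eq_bigr do rewrite mxE mulr_suml.
rewrite exchange_big/=; apply: eq_bigr => k _; rewrite fibre_opE lfibK mulr_sumr.
by apply: eq_bigr => l _; rewrite lposK mulrA.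
Qed.

(** The seminorm of index k is at most M. *)
Definition decays k T (M : R) := forall i j, wt R (pos i - pos j) ^+ k * normc (entry T i j) <= M.

Lemma decays_ge0 k T M i : decays k T M -> 0 <= M.
Proof. by move=> /(_ i i); apply: le_trans; rewrite mulr_ge0 ?normc_ge0 ?wtX_ge0. Qed.

Lemma decaysD k T S M N : decays k T M -> decays k S N -> decays k (T + S) (M + N).
Proof.
move=> hT hS i j; apply: le_trans (lerD (hT i j) (hS i j)).
by rewrite -mulrDr ler_wpM2l ?wtX_ge0// le_normcD.
Qed.

(** The weight is submultiplicative, so the product of two matrices that decay
    decays; the extra exponent 2 d on one factor pays for the sum over the
    lattice. *)
Lemma decays_comp k T S (MT MS : R) : bounded_op T -> bounded_op S ->
  decays (k + 2 * d) T MT -> decays k S MS ->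
  decays k (T \o S) (P%:R * 3 ^+ d * (MT * MS)).
Proof.
move=> bT bS hT hS i j; have MT0 := decays_ge0 i hT; have MS0 := decays_ge0 i hS.
rewrite mulrC -ler_pdivlMr ?wtX_gt0//.
apply: scvg_le (row_sum_cvg i (S (bas j)) bT) _ => s us.
rewrite ler_pdivlMr ?wtX_gt0// mulrC.
apply: (@le_trans _ _ (\sum_(r <- s) \sum_(f < P) (wt R (pos i - r) ^+ (2 * d))^-1 * (MT * MS))).
  apply: le_trans (ler_wpM2l (wtX_ge0 R _ k) (normc_sum _ _ _)) _.
  rewrite mulr_sumr; apply: ler_sum => r _.
  apply: le_trans (ler_wpM2l (wtX_ge0 R _ k) (normc_sum _ _ _)) _.
  rewrite mulr_sumr; apply: ler_sum => f _; rewrite normcM -/(entry S _ _).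
  have := hT i (mk r f); have := hS (mk r f) j; rewrite !lposK => hS' hT'.
  rewrite [leRHS]mulrC ler_pdivlMr ?wtX_gt0//.
  have -> : pos i - pos j = (pos i - r) + (r - pos j) by rewrite addrA subrK.
  apply: (@le_trans _ _ ((wt R (pos i - r) ^+ (k + 2 * d) * normc (entry T i (mk r f))) *
    (wt R (r - pos j) ^+ k * normc (entry S (mk r f) j)))); last first.
    by apply: ler_pM => //; rewrite mulr_ge0 ?normc_ge0 ?wtX_ge0.
  rewrite exprD.
  set a : R := normc (entry T _ _); set b : R := normc (entry S _ _).
  set w := wt _ (_ + _) ^+ k; set w1 := wt _ _ ^+ k; set w2 := wt _ _ ^+ (2 * d); set w3 := wt _ _ ^+ k.
  have h : w <= w1 * w3 by exact: wtDX.
  have ab : 0 <= a * b * w2 by rewrite !mulr_ge0 ?normc_ge0 ?wtX_ge0.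
  rewrite [leLHS](_ : _ = w * (a * b * w2)); last by ring.
  rewrite [leRHS](_ : _ = (w1 * w3) * (a * b * w2)); last by ring.
  exact: ler_wpM2r.
rewrite exchange_big/= sumr_const card_ord -[leLHS]mulr_natl -[leRHS]mulrA ler_wpM2l// -mulr_suml.
rewrite ler_wpM2r ?mulr_ge0//.
rewrite -(big_map (fun r => pos i - r) predT (fun r => (wt R r ^+ (2 * d))^-1))/=.
by apply: sum_wt; rewrite map_inj_uniq// => r r' /addrI/oppr_inj.
Qed.

Definition has_coef T (a : 'rV[int]_d -> C) := forall i j, entry T i j =
  if fib i == fib j then a (pos i - pos j) * sg (pos i - pos j) (pos j) else 0.

Lemma talgP T : A T <-> bounded_op T /\ exists2 a, rdecr a & has_coef T a.
Proof.
by split=> -[bT [a ha hT]]; split=> //; exists a => //; apply/rdecrP.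
Qed.

Lemma talg_bounded T : A T -> bounded_op T. Proof. by case. Qed.
Lemma talg_linear T : A T -> linear T. Proof. by case=> -[]. Qed.

Lemma talg_decays k T : A T -> exists M, decays k T M.
Proof.
move=> /talgP [_ [a /(_ k)[M M0 hM] hT]]; exists M => i j; rewrite hT.
case: ifP => _; last by rewrite normc0 mulr0.
by rewrite normcM normc_cocycle mulr1.
Qed.

Lemma talg0 : A 0.
Proof.
apply/talgP; split; first exact: bounded0; exists (fun _ => 0); first exact: rdecr0.
by move=> i j; rewrite entry0 mul0r if_same.
Qed.

Lemma talgD T S : A T -> A S -> A (T + S).
Proof.
move=> /talgP[bT [a ra ha]] /talgP[bS [b rb hb]]; apply/talgP; split; first exact: boundedD.
exists (fun r => a r + b r); first exact: rdecrD.
by move=> i j; rewrite entryD ha hb; case: ifP => _; rewrite ?addr0// mulrDl.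
Qed.

Lemma talgZ c T : A T -> A (c *: T).
Proof.
move=> /talgP[bT [a ra ha]]; apply/talgP; split; first exact: boundedZ.
exists (fun r => c * a r); first exact: rdecrZ.
by move=> i j; rewrite entryZ ha; case: ifP => _; rewrite ?mulr0// mulrA.
Qed.

Lemma talgN T : A T -> A (- T). Proof. by move=> h; rewrite -scaleN1r; exact: talgZ. Qed.
Lemma talgB T S : A T -> A S -> A (T - S). Proof. by move=> hT hS; exact/talgD/talgN. Qed.

Lemma talg_sum J (r : seq J) (Q : pred J) (T : J -> op R K) :
  (forall t, Q t -> A (T t)) -> A (\sum_(t <- r | Q t) T t).
Proof. by move=> h; apply: big_ind => //; [exact: talg0|exact: talgD]. Qed.

Lemma talg_monomial r : A (U r).
Proof.
apply/talgP; split; first exact: monomial_bounded.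
by exists (fun t => (t == r)%:R) => [|i j]; [exact: rdecr_delta|exact: entry_monomial].
Qed.

Lemma monomialM r (s : 'rV[int]_d) : U r \o U s = sg r s *: U (r + s).
Proof.
apply/funext => x; apply: ell2P => i; rewrite opEZ ell2EZ /= !monomialE lposK lfibK.
rewrite [r + s]addrC opprD addrA -addrA [- s - r]addrC addrA.
rewrite cocycleDl [sg s _ * sg r _]mulrC !mulrA; congr (_ * _ * _).
by rewrite -cocycleDr [s + _]addrC subrK.
Qed.

Lemma monomial0 : U 0 = id.
Proof.
by apply/funext => x; apply: ell2P => i; rewrite monomialE cocycle0l mul1r !subr0 lmkK.
Qed.

(** The relation between entries that defines the algebra involves two entries at
    a time, hence passes to limits, and the decay comes from one approximant. *)
Lemma talg_closed T : bounded_op T ->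
  (forall k (e : R), 0 < e -> exists2 T', A T' & decays k (T - T') e) -> A T.
Proof.
move=> bT h; apply/talgP; split=> //.
pose a r := entry T (mk r f0) (mk 0 f0).
have aE T' b k (e : R) : has_coef T' b -> decays k (T - T') e ->
  forall r, wt R r ^+ k * normc (a r - b r) <= e.
  move=> hb hd r; have := hd (mk r f0) (mk 0 f0).
  by rewrite entryB hb !lposK !lfibK eqxx subr0 cocycle0r mulr1.
exists a => [k|i j].
  have [T' /talgP[_ [b /(_ k)[M M0 hM] hb]] hd] := h k 1 ltr01.
  exists (M + 1) => [|r]; first by rewrite addr_ge0.
  apply: le_trans (lerD (hM r) (aE _ _ _ _ hb hd r)).
  rewrite -mulrDr ler_wpM2l ?wtX_ge0//.
  by apply: le_trans (le_normcD _ _); rewrite addrC subrK.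
apply/eqP; rewrite -subr_eq0; apply/eqP/normc_small => e e0.
have e2 : 0 < e / 2 by rewrite divr_gt0.
have [T' /talgP[_ [b _ hb]] hd] := h 0%N _ e2.
have := hd i j; rewrite expr0 mul1r entryB hb => h1.
have := aE _ _ _ _ hb hd (pos i - pos j); rewrite expr0 mul1r => h2.
move: h1; case: ifP => _ h1; last by apply: le_trans h1 _; lra.
set u := entry T i j in h1 *; set v := sg _ _ in h1 *.
rewrite (_ : _ - _ = (u - b (pos i - pos j) * v) - (a (pos i - pos j) - b (pos i - pos j)) * v); last by ring.
apply: le_trans (le_normcD _ _) _; rewrite normcN normcM normc_cocycle mulr1 [leRHS](splitr e).
exact: lerD.
Qed.

Definition trig_poly s (a : 'rV[int]_d -> C) : op R K := \sum_(r <- s) a r *: U r.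

Lemma talg_trig_poly s a : A (trig_poly s a).
Proof. by apply: talg_sum => r _; exact/talgZ/talg_monomial. Qed.

Lemma has_coef_trig_poly s a : uniq s ->
  has_coef (trig_poly s a) (fun r => if r \in s then a r else 0).
Proof.
move=> us i j; rewrite entry_sum; under eq_bigr do rewrite entryZ entry_monomial.
case: ifP => _; last by rewrite big1// => r _; rewrite mulr0.
case: ifPn => ps.
  rewrite (bigD1_seq (pos i - pos j))//= eqxx mul1r big1 ?addr0// => r rp.
  by rewrite eq_sym (negPf rp) mul0r mulr0.
rewrite big_seq big1 ?mul0r// => r rs; case: eqP => [e|_]; last by rewrite mul0r mulr0.
by rewrite e rs in ps.
Qed.

Lemma trig_poly_approx T a k (e : R) : rdecr a -> has_coef T a -> 0 < e ->
  exists2 s, uniq s & decays k (T - trig_poly s a) e.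
Proof.
move=> ra ha e0; have [s us hs] := rdecr_tail k ra e0; exists s => // i j.
rewrite entryB ha has_coef_trig_poly//; case: ifP => _; last first.
  by rewrite subrr normc0 mulr0 ltW.
case: ifPn => ps; first by rewrite subrr normc0 mulr0 ltW.
by rewrite mul0r subr0 normcM normc_cocycle mulr1 hs.
Qed.

Lemma decaysW k T M N : decays k T M -> M <= N -> decays k T N.
Proof. by move=> h MN i j; exact: le_trans (h i j) MN. Qed.

(** The twisted convolution of the coefficients is avoided: products of
    trigonometric polynomials are in the algebra because the unitaries multiply up
    to phases, and [decays_comp] makes the product continuous. *)
Lemma talg_comp T S : A T -> A S -> A (T \o S).
Proof.
move=> AT AS; have bT := talg_bounded AT; have bS := talg_bounded AS.
apply: talg_closed => [|k e e0]; first exact: bounded_comp.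
have [MT hT] := talg_decays (k + 2 * d) AT; have [MS hS] := talg_decays k AS.
have /talgP[_ [a ra ha]] := AT; have /talgP[_ [b rb hb]] := AS.
pose Z : R := P%:R * 3 ^+ d; have Z0 : 0 <= Z by rewrite mulr_ge0// exprn_ge0.
have MT0 := decays_ge0 (mk 0 f0) hT; have MS0 := decays_ge0 (mk 0 f0) hS.
(* T S - T' S' = (T - T') S + T' (S - S') has decay at most Z e1 (MS + MT + e1). *)
pose W := Z * (MT + MS + 1) + 1.
have W0 : 0 < W by rewrite ltr_wpDl// mulr_ge0// !addr_ge0.
pose e1 := Num.min 1 (e / W).
have e10 : 0 < e1 by rewrite lt_min ltr01 divr_gt0.
have e11 : e1 <= 1 by rewrite ge_min lexx.
have e1W : e1 * W <= e by rewrite -ler_pdivlMr// ge_min lexx orbT.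
have [s1 us1 h1] := trig_poly_approx (k + 2 * d) ra ha e10.
have [s2 us2 h2] := trig_poly_approx k rb hb e10.
set T' := trig_poly s1 a in h1; set S' := trig_poly s2 b in h2.
have bT' : bounded_op T' by exact/talg_bounded/talg_trig_poly.
have bS' : bounded_op S' by exact/talg_bounded/talg_trig_poly.
exists (T' \o S').
  rewrite /T' /S' /trig_poly comp_suml; apply: talg_sum => r _.
  rewrite comp_sumr; last by apply: talg_linear; exact/talgZ/talg_monomial.
  apply: talg_sum => r' _; rewrite compZl compZr; last exact/talg_linear/talg_monomial.
  by rewrite monomialM; do !apply: talgZ; exact: talg_monomial.
have -> : (T \o S) - (T' \o S') = ((T - T') \o S) + ((T - (T - T')) \o (S - S')).
  have -> : T - (T - T') = T' by rewrite opprB addrC subrK.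
  rewrite compDl compNl compBr; last exact: bounded_lin.
  by rewrite addrA subrK.
apply: decaysW (decaysD (decays_comp _ bS h1 hS) (decays_comp _ _ _ h2)) _.
- exact: boundedB.
- by apply: boundedB => //; exact: boundedB.
- exact: boundedB.
- apply: (decaysD hT); move=> i j; have := h1 i j; rewrite !entryB => h.
  by rewrite /entry opEN ell2EN normcN; exact: h.
apply: le_trans e1W; rewrite -!/Z /W.
have := mulr_ge0 Z0 MT0; have := mulr_ge0 Z0 MS0.
rewrite (_ : _ + _ = e1 * (Z * (MT + MS + e1))); last by ring.
move=> _ _; rewrite ler_pM2l//; apply: (@le_trans _ _ (Z * (MT + MS + 1))); last by rewrite lerDl.
by rewrite ler_wpM2l// lerD2l.
Qed.

(** The algebra acts on the lattice and v on the fibre. *)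
Lemma talg_fibre_comm T v : A T -> T \o F v = F v \o T.
Proof.
move=> AT; have bT := talg_bounded AT; have /talgP[_ [a _ ha]] := AT.
apply: entry_ext => [||i j]; [exact/bounded_comp/fibre_op_bounded|exact/bounded_comp/bT/fibre_op_bounded|].
rewrite entry_comp_fibre ?entry_fibre_comp; last exact: talg_linear.
set c := a (pos i - pos j) * sg (pos i - pos j) (pos j).
transitivity (v (fib i) (fib j) * c).
  under eq_bigr do rewrite ha lposK lfibK -/c.
  rewrite (bigD1 (fib i))//= eqxx big1 ?addr0// => k ki.
  by rewrite eq_sym (negPf ki) mulr0.
under eq_bigr do rewrite ha lposK lfibK -/c.
rewrite (bigD1 (fib j))//= eqxx big1 ?addr0// => k ki.
by rewrite (negPf ki) mulr0.
Qed.

End LatticeOps.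

(** * Operators with prescribed Fourier coefficients *)

Section Families.
Variables (R : realType) (T : eqType).
Local Notation C := R[i].
Implicit Types (b : T -> R) (c : T -> C).

Lemma normc_real (a : R) : normc (a%:C)%C = `|a|.
Proof. by rewrite /= expr0n addr0 sqrtr_sqr. Qed.

Lemma scvg_nonneg b (B : R) : (forall t, 0 <= b t) ->
  (forall s, uniq s -> \sum_(t <- s) b t <= B) ->
  exists l : C, scvg (fun s => \sum_(t <- s) (b t)%:C%C) l.
Proof.
move=> b0 hB; pose E : set R := [set \sum_(t <- s) b t | s in [set s | uniq s]].
have supE : has_sup E.
  split; first by exists (\sum_(t <- [::]) b t), [::].
  by exists B => _ [s us <-]; exact: hB.
exists (sup E)%:C%C => e e0.
have [_ [s0 us0 <-] hs0] := sup_adherent e0 supE.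
exists s0 => s us ss.
rewrite -rmorph_sum -rmorphB [normc _]normc_real ler_norml.
have le_sup : \sum_(t <- s) b t <= sup E by apply: sup_upper_bound => //; exists s.
have : \sum_(t <- s0) b t <= \sum_(t <- s) b t.
  rewrite [leRHS](bigID (mem s0))/= -[X in _ <= X + _]big_filter.
  have pe : perm_eq s0 [seq t <- s | t \in s0].
    apply: uniq_perm => //; first exact: filter_uniq.
    by move=> t; rewrite mem_filter andb_idr//; exact: ss.
  rewrite -(perm_big _ pe)/=.
  by rewrite lerDl sumr_ge0.
move: hs0 le_sup; lra.
Qed.

(** Absolute convergence, reduced to nonnegative families by taking positive and
    negative parts of the real and imaginary parts. *)
Lemma scvg_summable c (B : R) :
  (forall s, uniq s -> \sum_(t <- s) normc (c t) <= B) ->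
  exists l, scvg (fun s => \sum_(t <- s) c t) l.
Proof.
move=> hB.
have dom b : (forall t, 0 <= b t <= normc (c t)) ->
    exists l : C, scvg (fun s => \sum_(t <- s) (b t)%:C%C) l.
  move=> hb; apply: (@scvg_nonneg _ B) => [t|s us]; first by case/andP: (hb t).
  by apply: le_trans (hB s us); apply: ler_sum => t _; case/andP: (hb t).
have bounds (z : C) : `|complex.Re z| <= normc z /\ `|complex.Im z| <= normc z.
  case: z => u v /=; rewrite -!sqrtr_sqr !ler_sqrt ?addr_ge0 ?sqr_ge0//.
  by rewrite lerDl lerDr !sqr_ge0.
have half (u : C -> R) : (forall z, `|u z| <= normc z) ->
    exists l : C, scvg (fun s => \sum_(t <- s) (u (c t))%:C%C) l.
  move=> hu.
  have [t|p hp] := dom (fun t => (`|u (c t)| + u (c t)) / 2).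
    by move: (hu (c t)); rewrite ler_norml; case: (ger0P (u (c t))); lra.
  have [t|n hn] := dom (fun t => (`|u (c t)| - u (c t)) / 2).
    by move: (hu (c t)); rewrite ler_norml; case: (ger0P (u (c t))); lra.
  exists (p + (-1) * n); move: (scvgD hp (scvgZ (-1) hn)).
  congr (scvg _ _); apply/funext => s; rewrite mulr_sumr -big_split/=.
  apply: eq_bigr => t _; rewrite mulN1r -rmorphB; congr (_%:C)%C.
  by field.
have [p hp] := half (@complex.Re R) (fun z => (bounds z).1).
have [q hq] := half (@complex.Im R) (fun z => (bounds z).2).
exists (p + 'i%C * q); move: (scvgD hp (scvgZ 'i%C hq)).
congr (scvg _ _); apply/funext => s; rewrite mulr_sumr -big_split/=.
by apply: eq_bigr => t _; rewrite -complexE.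
Qed.

End Families.

Section Construction.
Variables (R : realType) (d P : nat) (K : choiceType) (X : lattice d P K).
Variables (Theta : 'M[R]_d).
Local Notation C := R[i].
Local Notation pos := (lpos X).
Local Notation fib := (lfib X).
Local Notation mk := (lmk X).
Local Notation sg := (torus_cocycle Theta).
Local Notation A := (torus_alg Theta pos fib).
Local Notation bas := (@Defs.basis R K).
Implicit Types (x y : ell2 R K).

(** Weak compactness: the partial sums of |l|^2 are limits of
    sum conj(l) y, which the arithmetic-geometric inequality bounds by half of
    themselves plus B / 2. *)
Lemma ell2_complete (T : eqType) (y : seq T -> ell2 R K) (B : R) (l : K -> C) :
  (forall s, sqn (y s) <= B) -> (forall i, scvg (fun s => y s i) (l i)) ->
  exists2 z : ell2 R K, sqn z <= B & forall i, z i = l i.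
Proof.
move=> yB hl.
have bd G : uniq G -> sqsum G l <= B.
  move=> uG; pose cj (z : C) := conjc z.
  have sq (z : C) : cj z * z = (normc z ^+ 2)%:C%C.
    case: z => u v; rewrite normc_sqr /cj /=; apply/eqP; rewrite eq_complex/=.
    by apply/andP; split; apply/eqP; ring.
  have ncj (z : C) : normc (cj z) = normc z by case: z => u v; rewrite /cj /= sqrrN.
  have h : scvg (fun s => \sum_(i <- G) cj (l i) * y s i) (\sum_(i <- G) cj (l i) * l i).
    by apply: scvg_sum => i; exact: scvgZ.
  have : normc (\sum_(i <- G) cj (l i) * l i) <= (sqsum G l + B) / 2.
    apply: scvg_le h _ => s _; apply: le_trans (normc_sum _ _ _) _.
    apply: (@le_trans _ _ ((sqsum G l + sqsum G (y s)) / 2)); last first.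
      by rewrite ler_pM2r ?invr_gt0// lerD2l; apply: le_trans (yB s); exact: sqsum_sqn.
    rewrite /sqsum -big_split/= mulr_suml; apply: ler_sum => i _.
    rewrite normcM ncj; have := sqr_ge0 (normc (l i) - normc (y s i)).
    by nra.
  under eq_bigr do rewrite sq.
  rewrite -rmorph_sum [normc _]normc_real -/(sqsum G l).
  have : sqsum G l <= `|sqsum G l| by exact: ler_norm.
  by lra.
exists (Ell2 (sqsummable_le bd : (l : K -> R[i]^o) \in @sqsummable R K)) => //.
exact: sqn_le.
Qed.

(** The operator is the coordinatewise limit of the trigonometric polynomials, which
    exists because the coefficients are summable and the unitaries do not increase
    the norm. *)
Lemma talg_of_coef a : rdecr a -> exists2 T, A T & has_coef X Theta T a.
Proof.
move=> ra; have [B B0 hB] := rdecr_sum ra.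
have row x : exists y, sqn y <= B ^+ 2 * sqn x /\
    forall i, scvg (fun s => trig_poly X Theta (undup s) a x i) (y i).
  have lex i : exists l, scvg (fun s => trig_poly X Theta (undup s) a x i) l.
    have [s us|l hl] := @scvg_summable R _ (fun r => a r * monomial X Theta r x i) (B * (1 + sqn x)).
      apply: (@le_trans _ _ ((\sum_(r <- s) normc (a r)) * (1 + sqn x))).
        rewrite mulr_suml; apply: ler_sum => r _; rewrite normcM ler_wpM2l ?normc_ge0//.
        have := sqn_coord (monomial X Theta r x) i; have := monomial_sqn X Theta r x.
        have := sqr_ge0 (normc (monomial X Theta r x i) - 1); have := normc_ge0 (monomial X Theta r x i).
        by nra.
      by rewrite ler_wpM2r ?hB// addr_ge0// sqn_ge0.
    exists l => e e0; have [s0 hs] := hl e e0; exists s0 => s us ss.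
    by rewrite undup_id// /trig_poly opEsum ell2Esum; exact: hs.
  have [l hl] := choice lex.
  have [s|z zB zl] := ell2_complete (B := B ^+ 2 * sqn x) _ hl.
    rewrite /trig_poly opEsum; under eq_bigr do rewrite opEZ.
    apply: le_trans (sqn_sum _ _ (fun r => monomial_sqn X Theta r x)) _.
    rewrite ler_wpM2r ?sqn_ge0// lerXn2r ?nnegrE ?sumr_ge0//.
      by move=> r _; exact: normc_ge0.
    by apply: hB; exact: undup_uniq.
  by exists z; split=> // i; rewrite zl.
have [T hT] := choice row.
have bT : bounded_op T.
  apply: (@boundedI _ _ _ (B ^+ 2)) => [c x y|x]; last by have [] := hT x.
  apply: ell2P => i; have [_ /(_ i) h] := hT (c *: x + y); apply: scvg_uniq h _.
  have [_ /(_ i) h1] := hT x; have [_ /(_ i) h2] := hT y.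
  move: (scvgD (scvgZ c h1) h2); congr (scvg _ _); apply/funext => s.
  by rewrite (talg_linear (talg_trig_poly _ _ _ _)).
have cT : has_coef X Theta T a.
  move=> i j; have [_ /(_ i) h] := hT (bas j); apply: scvg_uniq h _ => e e0.
  exists [:: pos i - pos j] => s us ss.
  rewrite undup_id//; have := has_coef_trig_poly X Theta a us i j; rewrite /entry => ->.
  by rewrite ss ?mem_head// subrr normc0 ltW.
by exists T => //; apply/talgP; split=> //; exists a.
Qed.

End Construction.

(** * Derivations and Dirac operators *)

Definition two_pi (R : realType) : R[i] := 2 * (pi : R)%:C%C.

(** The partial derivative - i delta_l, expressed on matrix entries: up to the
    factor, it is the commutator with the l-th position operator. *)
Definition is_pderiv (R : realType) (d P : nat) (K : choiceType) (X : lattice d P K)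
    (Theta : 'M[R]_d) (l : 'I_d) (T T' : op R K) :=
  torus_alg Theta (lpos X) (lfib X) T' /\
  forall i j, entry T' i j = two_pi R * ((lpos X i - lpos X j) 0 l)%:~R * entry T i j.

HB.lock Definition pderiv (R : realType) (d P : nat) (K : choiceType) (X : lattice d P K)
    (Theta : 'M[R]_d) (l : 'I_d) (T : op R K) : op R K :=
  xget 0 [set T' | is_pderiv X Theta l T T'].
Arguments pderiv {R d P K} X Theta l T _.

HB.lock Definition grad (R : realType) (d P : nat) (K : choiceType) (X : lattice d P K)
    (Theta : 'M[R]_d) (G : 'I_d -> 'M[R[i]]_P) (T : op R K) : op R K :=
  \sum_l (pderiv X Theta l T \o fibre_op X (G l)).
Arguments grad {R d P K} X Theta G T _.

Section Derivations.
Variables (R : realType) (d P : nat) (K : choiceType) (X : lattice d P K).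
Variables (Theta : 'M[R]_d).
Local Notation C := R[i].
Local Notation pos := (lpos X).
Local Notation fib := (lfib X).
Local Notation mk := (lmk X).
Local Notation sg := (torus_cocycle Theta).
Local Notation A := (torus_alg Theta pos fib).
Local Notation bas := (@Defs.basis R K).
Local Notation F := (@fibre_op R d P K X).
Local Notation U := (monomial X Theta).
Implicit Types (x y : ell2 R K) (T S a b : op R K).

Local Notation pderiv := (pderiv X Theta).
Local Notation two_pi := (two_pi R).

Lemma two_pi_neq0 : two_pi != 0.
Proof.
rewrite /two_pi mulf_neq0 ?pnatr_eq0//; apply/eqP => /complexI /eqP.
by rewrite gt_eqF// pi_gt0.
Qed.

Lemma pderivP l T : A T -> is_pderiv X Theta l T (pderiv l T).
Proof.
move=> AT; rewrite pderiv.unlock; apply: xgetPex; have /talgP[_ [a ra ha]] := AT.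
have [T' AT' hT'] := talg_of_coef X Theta (rdecrZ two_pi (rdecr_coord l ra)).
exists T'; split=> // i j; rewrite hT' ha; case: ifP => _; last by rewrite mulr0.
by rewrite !mulrA.
Qed.

Lemma talg_pderiv l T : A T -> A (pderiv l T). Proof. by move=> /(pderivP l)[]. Qed.

Lemma entry_pderiv l T i j : A T ->
  entry (pderiv l T) i j = two_pi * ((pos i - pos j) 0 l)%:~R * entry T i j.
Proof. by move=> /(pderivP l)[]. Qed.

Lemma talg_ext T S : A T -> A S -> (forall i j, entry T i j = entry S i j) -> T = S.
Proof. by move=> /talg_bounded bT /talg_bounded bS; exact: (entry_ext X). Qed.

Lemma pderivD l T S : A T -> A S -> pderiv l (T + S) = pderiv l T + pderiv l S.
Proof.
move=> AT AS; apply: talg_ext => [||i j]; [exact/talg_pderiv/talgD|by apply: talgD; exact: talg_pderiv|].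
by rewrite entryD !entry_pderiv ?entryD ?mulrDr//; exact: talgD.
Qed.

Lemma pderiv0 l : pderiv l 0 = 0.
Proof.
apply: talg_ext => [||i j]; [exact/talg_pderiv/talg0|exact: talg0|].
by rewrite entry_pderiv ?entry0 ?mulr0//; exact: talg0.
Qed.

Lemma pderiv_sum l J (r : seq J) (T : J -> op R K) : (forall t, A (T t)) ->
  pderiv l (\sum_(t <- r) T t) = \sum_(t <- r) pderiv l (T t).
Proof.
move=> AT; elim: r => [|t r ih]; first by rewrite !big_nil pderiv0.
by rewrite !big_cons pderivD ?ih//; exact: talg_sum.
Qed.

Lemma pderivC l m T : A T -> pderiv l (pderiv m T) = pderiv m (pderiv l T).
Proof.
move=> AT; apply: talg_ext => [||i j]; [by do !apply: talg_pderiv|by do !apply: talg_pderiv|].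
by rewrite !entry_pderiv//; try exact: talg_pderiv; rewrite mulrCA.
Qed.

Lemma pderiv_monomial l r : pderiv l (U r) = (two_pi * (r 0 l)%:~R) *: U r.
Proof.
apply: talg_ext => [||i j]; [exact/talg_pderiv/talg_monomial|exact/talgZ/talg_monomial|].
rewrite entry_pderiv; last exact: talg_monomial.
rewrite entryZ entry_monomial; case: ifP => _; last by rewrite !mulr0.
by case: eqP => [->//|_]; rewrite mul0r !mulr0.
Qed.

Lemma entry_coef_fibre T v (c : 'rV[int]_d -> C) i j : linear T -> has_coef X Theta T c ->
  entry (T \o F v) i j = v (fib i) (fib j) * (c (pos i - pos j) * sg (pos i - pos j) (pos j)).
Proof.
move=> lT ha; rewrite entry_comp_fibre//; under eq_bigr do rewrite ha lposK lfibK.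
rewrite (bigD1 (fib i))//= eqxx big1 ?addr0// => k ki.
by rewrite eq_sym (negPf ki) mulr0.
Qed.

Section Dirac.
Variable G : 'I_d -> 'M[C]_P.

(** The Dirac operator acts on the fibre over r by a matrix linear in r. *)
Definition symbol (r : 'rV[int]_d) : 'M[C]_P := \sum_l (two_pi * (r 0 l)%:~R) *: G l.

Definition dirac (x : K -> R[i]^o) : K -> R[i]^o :=
  fun p => \sum_k symbol (pos p) (fib p) k * x (mk (pos p) k).

Local Notation grad := (grad X Theta G).

Lemma gradE T : grad T = \sum_l (pderiv l T \o F (G l)).
Proof. by rewrite grad.unlock. Qed.

Lemma symbolB r s : symbol (r - s) = symbol r - symbol s.
Proof.
rewrite /symbol -sumrB; apply: eq_bigr => l _.
by rewrite !mxE rmorphB/= mulrBr scalerBl.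
Qed.

Lemma grad_bounded T : A T -> bounded_op (grad T).
Proof.
move=> AT; rewrite gradE; apply: bounded_sum => l _; apply: bounded_comp; last exact: fibre_op_bounded.
exact/talg_bounded/talg_pderiv.
Qed.

Lemma entry_grad T (c : 'rV[int]_d -> C) i j : has_coef X Theta T c -> A T -> entry (grad T) i j =
  symbol (pos i - pos j) (fib i) (fib j) * (c (pos i - pos j) * sg (pos i - pos j) (pos j)).
Proof.
move=> ha AT; rewrite gradE entry_sum /symbol summxE mulr_suml; apply: eq_bigr => l _.
rewrite (entry_coef_fibre _ (c := fun r => two_pi * (r 0 l)%:~R * c r)); last 2 first.
- exact/talg_linear/talg_pderiv.
- move=> p q; rewrite entry_pderiv// ha; case: ifP => _; last by rewrite mulr0.
  by rewrite mulrA.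
by rewrite !mxE; ring.
Qed.

(** Every vector of the domain is compared with its truncations to finitely many
    lattice points, where both sides are finite sums with equal terms. *)
Lemma grad_commutator T : A T -> is_commutator dirac T (grad T).
Proof.
move=> AT; split=> [|x y Dxy]; first exact: grad_bounded.
have /talgP[bT [a _ ha]] := AT.
apply/funext => i; rewrite ell2ED.
have h1 : scvg (fun s => \sum_k symbol (pos i) (fib i) k * row_sum X T (mk (pos i) k) x s)
    (dirac (T x) i).
  exact: (scvg_sum _ (fun k => scvgZ (symbol (pos i) (fib i) k) (row_sum_cvg X (mk (pos i) k) x bT))).
apply: scvg_uniq h1 _.
move: (scvgD (row_sum_cvg X i y bT) (row_sum_cvg X i x (grad_bounded AT))).
congr (scvg _ _); apply/funext => s.
rewrite /row_sum; under [RHS]eq_bigr do rewrite mulr_sumr.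
rewrite [RHS]exchange_big -big_split; apply: eq_bigr => r _ /=.
under [RHS]eq_bigr do rewrite mulr_sumr.
rewrite [RHS]exchange_big/=.
have yE k : y (mk r k) = \sum_f symbol r k f * x (mk r f).
  by rewrite -Dxy /dirac lposK lfibK.
set c := a (pos i - r) * sg (pos i - r) r.
transitivity (\sum_f symbol (pos i) (fib i) f * x (mk r f) * c); last first.
  apply: eq_bigr => f _; rewrite (bigD1 f)//= ha !lposK !lfibK eqxx -/c.
  rewrite big1 => [|k kf]; first by rewrite addr0 -[LHS]mulrA.
  rewrite ha !lposK !lfibK (negPf kf).
  by rewrite !mulr0.
rewrite (bigD1 (fib i))//= ha !lposK !lfibK eqxx -/c.
rewrite big1 => [|f ff]; last by rewrite ha lposK lfibK eq_sym (negPf ff) mulr0.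
rewrite addr0 yE mulr_suml -big_split/=; apply: eq_bigr => f _.
rewrite (entry_grad _ _ ha AT) lposK lfibK -/c symbolB !mxE.
by ring.
Qed.

Lemma dirac_basis j : exists y : ell2 R K, dirac (bas j) = y.
Proof.
exists (\sum_k symbol (pos j) k (fib j) *: bas (mk (pos j) k)).
apply/funext => i; rewrite ell2Esum /dirac.
under eq_bigr do rewrite basisE [_ == j]eq_sym lmk_eq.
under [RHS]eq_bigr do rewrite ell2EZ basisE lmk_eq.
rewrite [pos j == _]eq_sym; case: eqP => [->|_] /=; last first.
  by rewrite !big1// => k _; rewrite mulr0.
rewrite (bigD1 (fib j))//= eqxx big1 => [|k kj]; last by rewrite eq_sym (negPf kj) mulr0.
rewrite [RHS](bigD1 (fib i))//= eqxx big1 => [//|k ki].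
by rewrite eq_sym (negPf ki) mulr0.
Qed.

(** Basis vectors lie in the domain, and they determine a bounded operator. *)
Lemma commutator_uniq b S T : is_commutator dirac b S -> is_commutator dirac b T -> S = T.
Proof.
move=> [bS hS] [bT hT]; apply: (entry_ext X) => // i j.
have [y hy] := dirac_basis j; have := hS _ _ hy; rewrite (hT _ _ hy).
by move=> /(congr1 (fun f => f i)); rewrite !ell2ED => /addrI.
Qed.

Lemma commutatorE b T : A b -> is_commutator dirac b T <-> T = grad b.
Proof.
move=> Ab; split=> [h|->]; last exact: grad_commutator.
exact: commutator_uniq h (grad_commutator Ab).
Qed.

(** Leibniz rule. *)
Lemma commutator_comp a b S T : bounded_op a -> bounded_op b ->
  is_commutator dirac a S -> is_commutator dirac b T ->
  is_commutator dirac (a \o b) ((S \o b) + (a \o T)).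
Proof.
move=> ba bb [bS hS] [bT hT]; split.
  by apply: boundedD; exact: bounded_comp.
move=> x y Dxy; have h := hS _ _ (hT _ _ Dxy).
rewrite -[LHS]/(dirac (a (b x))) h; congr ell2_val.
by rewrite linD; [rewrite -addrA [a (T x) + _]addrC|exact: bounded_lin].
Qed.

End Dirac.

Lemma grad_pderiv l T : A T -> grad X Theta (fun m => (m == l)%:R%:M) T = pderiv l T.
Proof.
move=> AT; rewrite gradE (bigD1 l)//= eqxx fibre_op1 big1 => [|m ml]; last first.
  rewrite (negPf ml) (_ : 0%:R%:M = 0 :> 'M[C]_P) ?fibre_op0; last by rewrite raddf0.
  by rewrite comp0r//; apply: talg_linear; exact: talg_pderiv.
by rewrite addr0.
Qed.

(** Seeing a partial derivative as the commutator with a Dirac operator having a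
    single, trivial gamma matrix brings the Leibniz rule without any convolution
    of coefficients. *)
Lemma pderiv_comp (f0 : 'I_P) l a b : A a -> A b ->
  pderiv l (a \o b) = (pderiv l a \o b) + (a \o pderiv l b).
Proof.
move=> Aa Ab; pose G (m : 'I_d) : 'M[C]_P := (m == l)%:R%:M.
have ha := grad_commutator G Aa; have hb := grad_commutator G Ab.
have := commutator_uniq (grad_commutator G (talg_comp f0 Aa Ab))
  (commutator_comp (talg_bounded Aa) (talg_bounded Ab) ha hb).
by rewrite !grad_pderiv//; exact: talg_comp.
Qed.

End Derivations.

(** * The algebra tensored with a space of matrices *)

Section Modules.
Variables (R : realType) (d P : nat) (K : choiceType) (X : lattice d P K).
Variables (Theta : 'M[R]_d) (f0 : 'I_P).
Local Notation C := R[i].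
Local Notation pos := (lpos X).
Local Notation fib := (lfib X).
Local Notation mk := (lmk X).
Local Notation sg := (torus_cocycle Theta).
Local Notation A := (torus_alg Theta pos fib).
Local Notation bas := (@Defs.basis R K).
Local Notation F := (@fibre_op R d P K X).
Local Notation U := (monomial X Theta).
Local Notation pderiv := (pderiv X Theta).
Local Notation decays := (@decays R d P K X).
Implicit Types (T S a b : op R K) (u v : 'M[C]_P) (V W : {vspace 'M[C]_P}).

(** A (x) V, written on a fixed basis of V so that sums stay in this form. *)
Definition amod V : set (op R K) := [set T |
  exists2 a : 'I_(\dim V) -> op R K, forall l, A (a l) &
    T = \sum_l (a l \o F (vbasis V)`_l)].

Lemma amod0 V : amod V 0.
Proof.
exists (fun _ => 0) => [l|]; first exact: talg0.
by rewrite big1// => l _; rewrite comp0l.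
Qed.

Lemma amodD V T S : amod V T -> amod V S -> amod V (T + S).
Proof.
move=> [a Aa ->] [b Ab ->]; exists (fun l => a l + b l) => [l|]; first exact: talgD.
by rewrite -big_split; apply: eq_bigr => l _; rewrite compDl.
Qed.

Lemma amodN V T : amod V T -> amod V (- T).
Proof.
move=> [a Aa ->]; exists (fun l => - a l) => [l|]; first exact: talgN.
by rewrite -sumrN; apply: eq_bigr => l _; rewrite compNl.
Qed.

Lemma amodB V T S : amod V T -> amod V S -> amod V (T - S).
Proof. by move=> hT hS; exact/amodD/amodN. Qed.

Lemma amod_sum V J (r : seq J) (Q : pred J) (T : J -> op R K) :
  (forall t, Q t -> amod V (T t)) -> amod V (\sum_(t <- r | Q t) T t).
Proof. by move=> h; apply: big_ind => //; [exact: amod0|exact: amodD]. Qed.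

Lemma amod_mem V a v : A a -> v \in V -> amod V (a \o F v).
Proof.
move=> Aa vV; exists (fun l => coord (vbasis V) l v *: a) => [l|]; first exact: talgZ.
have la := talg_linear Aa.
rewrite [in LHS](coord_vbasis vV) fibre_op_sum comp_sumr//.
by apply: eq_bigr => l _; rewrite fibre_opZ compZr ?compZl.
Qed.

Lemma amod_ind V (Q : op R K -> Prop) : Q 0 -> (forall T S, Q T -> Q S -> Q (T + S)) ->
  (forall a v, A a -> v \in V -> Q (a \o F v)) -> forall T, amod V T -> Q T.
Proof.
move=> Q0 QD Qm _ [a Aa ->]; apply: big_ind => // l _.
by apply: Qm => //; apply: vbasis_mem; rewrite mem_nth// size_tuple.
Qed.

Lemma amodS V W T : (V <= W)%VS -> amod V T -> amod W T.
Proof.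
move=> VW; apply: amod_ind => [|S S'|a v Aa vV]; [exact: amod0|exact: amodD|].
by apply: amod_mem => //; exact: (subvP VW).
Qed.

Lemma amod_bounded V T : amod V T -> bounded_op T.
Proof.
apply: amod_ind => [|S S'|a v Aa _]; [exact: bounded0|exact: boundedD|].
by apply: bounded_comp (talg_bounded Aa) _; exact: fibre_op_bounded.
Qed.

Lemma amod_lmul V a T : A a -> amod V T -> amod V (a \o T).
Proof.
move=> Aa; move: T; apply: (amod_ind (Q := fun T => amod V (a \o T))) => [|S S' hS hS'|b v Ab vV].
- by rewrite comp0r; [exact: amod0|exact: talg_linear Aa].
- by rewrite compDr; [exact: amodD|exact: talg_linear Aa].
- exact: (amod_mem (talg_comp f0 Aa Ab) vV).
Qed.

Lemma amod_rmul V a T : A a -> amod V T -> amod V (T \o a).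
Proof.
move=> Aa; move: T; apply: (amod_ind (Q := fun T => amod V (T \o a))) => [|S S' hS hS'|b v Ab vV].
- by rewrite comp0l; exact: amod0.
- by rewrite compDl; exact: amodD.
- rewrite -[_ \o a]/(b \o (F v \o a)) -(talg_fibre_comm _ Aa).
  exact: (amod_mem (talg_comp f0 Ab Aa) vV).
Qed.

Lemma amod_fibre V W T v : (forall u, u \in V -> u *m v \in W) -> amod V T -> amod W (T \o F v).
Proof.
move=> h; move: T; apply: (amod_ind (Q := fun T => amod W (T \o F v))) => [|S S' hS hS'|b u Ab uV].
- by rewrite comp0l; exact: amod0.
- by rewrite compDl; exact: amodD.
- by rewrite -[_ \o F v]/(b \o (F u \o F v)) fibre_opM; apply: amod_mem => //; exact: h.
Qed.

Lemma amod_one T : amod <[1%:M]>%VS T <-> A T.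
Proof.
split=> [|AT]; last first.
  by rewrite -[T]/(T \o id) -(fibre_op1 R X); apply: amod_mem => //; exact: memv_line.
move: T; apply: (amod_ind (Q := A)) => [|S S'|a v Aa /vlineP[c ->]]; [exact: talg0|exact: talgD|].
by rewrite fibre_opZ fibre_op1 compZr; [exact: talgZ|exact: talg_linear Aa].
Qed.

Lemma amod_zero T : amod 0%VS T <-> T = 0.
Proof.
split=> [|->]; last exact: amod0.
move: T; apply: (amod_ind (Q := fun T => T = 0)) => [//|S S' -> ->|a v Aa]; first by rewrite addr0.
by rewrite memv0 => /eqP ->; rewrite fibre_op0 comp0r//; exact: talg_linear Aa.
Qed.

Definition spanf (J : finType) (w : J -> 'M[C]_P) : {vspace 'M[C]_P} := (\sum_j <[w j]>)%VS.

Lemma mem_spanf (J : finType) (w : J -> 'M[C]_P) j : w j \in spanf w.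
Proof. by apply: (subvP (sumv_sup j _ (subvv _))) => //; exact: memv_line. Qed.

Lemma spanfP (J : finType) (w : J -> 'M[C]_P) v : v \in spanf w ->
  exists c : J -> C, v = \sum_j c j *: w j.
Proof.
move=> /memv_sumP[u hu ->].
have /choice[c hc] : forall j, exists c, u j = c *: w j.
  by move=> j; apply/vlineP; exact: hu.
by exists c; apply: eq_bigr.
Qed.

Lemma spanf_sub (J : finType) (w : J -> 'M[C]_P) V : (forall j, w j \in V) -> (spanf w <= V)%VS.
Proof. by move=> h; apply/subv_sumP => j _; rewrite -memvE. Qed.

Lemma amod_spanf (J : finType) (w : J -> 'M[C]_P) T : amod (spanf w) T ->
  exists2 a : J -> op R K, forall j, A (a j) & T = \sum_j (a j \o F (w j)).
Proof.
move: T; apply: (amod_ind (Q := fun T =>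
  exists2 a : J -> op R K, forall j, A (a j) & T = \sum_j (a j \o F (w j)))).
- by exists (fun _ => 0) => [j|]; [exact: talg0|rewrite big1// => j _; rewrite comp0l].
- move=> S S' [a Aa ->] [b Ab ->]; exists (fun j => a j + b j) => [j|]; first exact: talgD.
  by rewrite -big_split; apply: eq_bigr => j _; rewrite compDl.
- move=> b v Ab /spanfP[c ->].
  exists (fun j => c j *: b) => [j|]; first exact: talgZ.
  have lb := talg_linear Ab.
  by rewrite fibre_op_sum comp_sumr//; apply: eq_bigr => j _; rewrite fibre_opZ compZr ?compZl.
Qed.

(** The coefficient of T on the matrix unit of index (p, q) of the fibre, as an
    operator acting trivially on the fibre.  Multiplying by matrix units on both
    sides keeps it additive in T and linear over the algebra. *)
Definition fib_coef (p q : 'I_P) T : op R K := \sum_f (F (delta_mx f p) \o T \o F (delta_mx q f)).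

(** 1 (x) L, for a linear map L on the matrices of the fibre. *)
Definition fib_map (L : 'M[C]_P -> 'M[C]_P) T : op R K :=
  \sum_p \sum_q (fib_coef p q T \o F (L (delta_mx p q))).

Let F_lin v : linear (F v). Proof. exact/bounded_lin/fibre_op_bounded. Qed.

Lemma fib_coefD p q T S : fib_coef p q (T + S) = fib_coef p q T + fib_coef p q S.
Proof.
rewrite -big_split; apply: eq_bigr => f _.
by rewrite compDr ?compDl.
Qed.

Lemma fib_coefB p q T S : fib_coef p q (T - S) = fib_coef p q T - fib_coef p q S.
Proof.
rewrite -sumrB; apply: eq_bigr => f _.
by rewrite compBr// compDl compNl.
Qed.

Lemma fib_coef_lmul p q a T : A a -> fib_coef p q (a \o T) = a \o fib_coef p q T.
Proof.
move=> Aa; rewrite [RHS]comp_sumr; last exact: talg_linear Aa.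
by apply: eq_bigr => f _; rewrite -[LHS]/((F (delta_mx f p) \o a) \o (T \o _)) -(talg_fibre_comm _ Aa).
Qed.

Lemma fib_coef_rmul p q a T : A a -> fib_coef p q (T \o a) = fib_coef p q T \o a.
Proof.
move=> Aa; rewrite [RHS]comp_suml; apply: eq_bigr => f _.
by rewrite -[LHS]/((F (delta_mx f p) \o T) \o (a \o F _)) (talg_fibre_comm _ Aa).
Qed.

Lemma fib_coef_fibre p q a v : A a -> fib_coef p q (a \o F v) = v p q *: a.
Proof.
move=> Aa; have la := talg_linear Aa; rewrite fib_coef_lmul// /fib_coef.
under eq_bigr do rewrite !fibre_opM.
have e f : delta_mx f p *m v *m delta_mx q f = v p q *: delta_mx f f.
  apply/matrixP => i j; rewrite mxE (bigD1 q)//= big1 => [|k kq]; last first.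
    by rewrite [delta_mx q f k j]mxE (negPf kq) mulr0.
  rewrite addr0 mxE (bigD1 p)//= big1 => [|k kp]; last first.
    by rewrite mxE (negPf kp) andbF mul0r.
  by rewrite addr0 !mxE !eqxx andbT/= mulrAC -natrM mulnb mulrC.
under eq_bigr do rewrite e.
by rewrite -fibre_op_sum -scaler_sumr -mx1_sum_delta fibre_opZ fibre_op1 compZr.
Qed.

Lemma fib_coef_bounded p q T : bounded_op T -> bounded_op (fib_coef p q T).
Proof.
move=> bT; apply: bounded_sum => f _.
by apply: bounded_comp; [apply: bounded_comp => //|]; exact: fibre_op_bounded.
Qed.

Lemma entry_fib_coef p q T i j : linear T ->
  entry (fib_coef p q T) i j = if fib i == fib j then entry T (mk (pos i) p) (mk (pos j) q) else 0.
Proof.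
move=> lT; rewrite entry_sum.
have lTF u : linear (T \o F u) by move=> c x y; rewrite /= F_lin lT.
transitivity (\sum_f (fib i == f)%:R * ((fib j == f)%:R * entry T (mk (pos i) p) (mk (pos j) q))).
  apply: eq_bigr => f _; rewrite -[_ \o F _]/(F (delta_mx f p) \o (T \o F (delta_mx q f))).
  rewrite entry_fibre_comp (bigD1 p)//= big1 => [|k kp]; last by rewrite !mxE (negPf kp) andbF mul0r.
  rewrite addr0 !mxE eqxx andbT; congr (_ * _).
  rewrite entry_comp_fibre// (bigD1 q)//= big1 => [|k kq]; last by rewrite !mxE (negPf kq) mul0r.
  by rewrite addr0 !mxE eqxx.
rewrite (bigD1 (fib i))//= eqxx mul1r big1 ?addr0 => [|f fi]; last first.
  by rewrite eq_sym (negPf fi) mul0r.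
by rewrite eq_sym; case: eqP => _; rewrite ?mul1r ?mul0r.
Qed.

Lemma fib_mapD L T S : fib_map L (T + S) = fib_map L T + fib_map L S.
Proof.
rewrite /fib_map -big_split; apply: eq_bigr => p _; rewrite -big_split.
by apply: eq_bigr => q _; rewrite fib_coefD compDl.
Qed.

Lemma fib_mapB L T S : fib_map L (T - S) = fib_map L T - fib_map L S.
Proof.
rewrite /fib_map -sumrB; apply: eq_bigr => p _; rewrite -sumrB.
by apply: eq_bigr => q _; rewrite fib_coefB compDl compNl.
Qed.

Lemma fib_map0 L : fib_map L 0 = 0.
Proof. by rewrite -[X in fib_map L X](subrr 0) fib_mapB subrr. Qed.

Lemma fib_map_lmul L a T : A a -> fib_map L (a \o T) = a \o fib_map L T.
Proof.
move=> Aa; have la := talg_linear Aa; rewrite [RHS]comp_sumr//; apply: eq_bigr => p _.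
by rewrite [RHS]comp_sumr//; apply: eq_bigr => q _; rewrite fib_coef_lmul.
Qed.

Lemma fib_map_rmul L a T : A a -> fib_map L (T \o a) = fib_map L T \o a.
Proof.
move=> Aa; rewrite [RHS]comp_suml; apply: eq_bigr => p _.
rewrite [RHS]comp_suml; apply: eq_bigr => q _; rewrite fib_coef_rmul//.
by rewrite -[LHS]/(fib_coef p q T \o (a \o F _)) (talg_fibre_comm _ Aa).
Qed.

Lemma fib_map_fibre (L : {linear 'M[C]_P -> 'M[C]_P}) a v : A a -> fib_map L (a \o F v) = a \o F (L v).
Proof.
move=> Aa; have la := talg_linear Aa.
rewrite [in RHS](matrix_sum_delta v) linear_sum fibre_op_sum comp_sumr//; apply: eq_bigr => p _.
rewrite linear_sum fibre_op_sum comp_sumr//; apply: eq_bigr => q _.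
by rewrite fib_coef_fibre// linearZ fibre_opZ compZr// compZl.
Qed.

Lemma fib_map_id (L : {linear 'M[C]_P -> 'M[C]_P}) V T :
  (forall v, v \in V -> L v = v) -> amod V T -> fib_map L T = T.
Proof.
move=> h; move: T; apply: (amod_ind (Q := fun T => fib_map L T = T)) => [|S S' hS hS'|b u Ab uV].
- by rewrite fib_map0.
- by rewrite fib_mapD hS hS'.
- by rewrite fib_map_fibre// h.
Qed.

Lemma entry_fib_map L T i j : linear T -> entry (fib_map L T) i j =
  \sum_p \sum_q L (delta_mx p q) (fib i) (fib j) * entry T (mk (pos i) p) (mk (pos j) q).
Proof.
move=> lT; rewrite entry_sum; apply: eq_bigr => p _; rewrite entry_sum.
apply: eq_bigr => q _; rewrite entry_comp_fibre; last first.
  rewrite /fib_coef => c x y; rewrite !opEsum scaler_sumr -big_split/=; apply: eq_bigr => f _.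
  by rewrite /= F_lin lT F_lin.
under eq_bigr do rewrite entry_fib_coef// lposK lfibK.
rewrite (bigD1 (fib i))//= eqxx big1 ?addr0// => k ki.
by rewrite eq_sym (negPf ki) mulr0.
Qed.

Lemma amod_fib_coef V p q T : amod V T -> A (fib_coef p q T).
Proof.
move: T; apply: (amod_ind (Q := fun T => A (fib_coef p q T))) => [|S S' hS hS'|b u Ab uV].
- by rewrite -[0](subrr 0) fib_coefB subrr; exact: talg0.
- by rewrite fib_coefD; exact: talgD.
- by rewrite fib_coef_fibre//; exact: talgZ.
Qed.

(** The coefficients of T on matrix units are limits of elements of the algebra,
    so they lie in it.  Applying a projection onto V fibrewise fixes the
    approximants, hence T, and shows that T has all its components in V. *)
Lemma amod_closed V T : bounded_op T ->
  (forall k (e : R), 0 < e -> exists2 T', amod V T' & decays k (T - T') e) -> amod V T.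
Proof.
move=> bT h.
have lin T' : amod V T' -> linear (T - T').
  by move=> hT'; apply/bounded_lin/boundedB => //; exact: amod_bounded hT'.
have AE p q : A (fib_coef p q T).
  apply: (talg_closed f0) => [|k e e0]; first exact: fib_coef_bounded.
  have [T' hT' hd] := h k e e0; exists (fib_coef p q T'); first exact: amod_fib_coef hT'.
  move=> i j; rewrite -fib_coefB entry_fib_coef; last exact: lin.
  case: ifP => _; last by rewrite normc0 mulr0 ltW.
  by have := hd (mk (pos i) p) (mk (pos j) q); rewrite !lposK.
have bH : bounded_op (fib_map (projv V) T).
  apply: bounded_sum => p _; apply: bounded_sum => q _; apply: bounded_comp; last exact: fibre_op_bounded.
  exact: talg_bounded.
suff -> : T = fib_map (projv V) T.
  apply: amod_sum => p _; apply: amod_sum => q _; apply: amod_mem => //; exact: memv_proj.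
apply: (entry_ext X) => // i j.
apply/eqP; rewrite -subr_eq0 -entryB; apply/eqP/normc_small => e e0.
pose B := \sum_p \sum_q normc (projv V (delta_mx p q) (fib i) (fib j)).
have B0 : 0 <= B by do 2![apply: sumr_ge0 => ? _]; exact: normc_ge0.
have e1 : 0 < e / (B + 1) by rewrite divr_gt0// ltr_wpDl.
have [T' hT' hd] := h 0%N _ e1.
have -> : T - fib_map (projv V) T = (T - T') - fib_map (projv V) (T - T').
  rewrite fib_mapB (fib_map_id _ hT'); first by rewrite opprB addrA subrK.
  by move=> v; exact: projv_id.
rewrite entryB; apply: le_trans (le_normcD _ _) _; rewrite normcN entry_fib_map; last exact: lin.
have dT i' j' : normc (entry (T - T') i' j') <= e / (B + 1).
  by have := hd i' j'; rewrite expr0 mul1r.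
apply: (@le_trans _ _ (e / (B + 1) + B * (e / (B + 1)))).
  rewrite lerD// /B mulr_suml; apply: le_trans (normc_sum _ _ _) _; apply: ler_sum => p _.
  rewrite mulr_suml; apply: le_trans (normc_sum _ _ _) _; apply: ler_sum => q _.
  by rewrite normcM ler_wpM2l ?normc_ge0.
rewrite -[X in X + _]mul1r -mulrDl [1 + B]addrC mulrC divfK// gt_eqF// ltr_wpDl//.
Qed.

End Modules.

(** * Clifford relations *)

Definition clifford_rel (C : fieldType) (n N : nat) (g : 'I_n -> 'M[C]_N) : Prop :=
  forall r s, g r *m g s + g s *m g r = (2 * (r == s)%:R)%:M.

Section Chirality.
Variables (C : fieldType) (n N : nat) (g : 'I_n -> 'M[C]_N).
Hypothesis two_neq0 : 2%:R != 0 :> C.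
Hypothesis g_cliff : clifford_rel g.

Lemma clifford_rel_sqr r : g r *m g r = 1%:M.
Proof.
have := g_cliff r r; rewrite eqxx mulr1 -mulr2n -scaler_nat => /(congr1 (fun v => 2%:R^-1 *: v)).
by rewrite scalerA -scalemx1 scalerA mulVf// !scale1r.
Qed.

Lemma clifford_relN r s : r != s -> g r *m g s = - (g s *m g r).
Proof.
move=> rs; apply/eqP; rewrite -subr_eq0 opprK g_cliff (negPf rs) mulr0.
by rewrite raddf0.
Qed.

(** The product inside the chirality operator, over any list of directions so
    that it can be studied by induction. *)
Definition gprod (s : seq 'I_n) : 'M[C]_N := \big[mulmx/1%:M]_(j <- s) g j.

Lemma gprod_notin s j : j \notin s -> g j *m gprod s = (-1) ^+ size s *: (gprod s *m g j).
Proof.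
rewrite /gprod; elim: s => [|i s ih]; first by rewrite big_nil mulmx1 mul1mx scale1r.
rewrite inE negb_or => /andP[ji js]; rewrite !big_cons [LHS]mulmxA clifford_relN// mulNmx -[X in - X = _]mulmxA.
by rewrite ih// -scalemxAr exprS mulN1r scaleNr mulmxA.
Qed.

Lemma gprod_comm s j : j \notin s -> gprod s *m g j = (-1) ^+ size s *: (g j *m gprod s).
Proof.
by move=> js; rewrite gprod_notin// scalerA -exprD addnn -mul2n exprM sqrrN expr1n expr1n scale1r.
Qed.

Lemma gprod_in s j : uniq s -> j \in s ->
  g j *m gprod s = (-1) ^+ (size s).-1 *: (gprod s *m g j).
Proof.
elim: s => [//|i s ih] /= /andP[is_ us].
rewrite inE /gprod !big_cons -/(gprod s); have [-> _|ji /= js] := eqVneq j i.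
  rewrite -[in RHS]mulmxA gprod_comm// -scalemxAr scalerA -exprD addnn -mul2n.
  by rewrite exprM sqrrN expr1n expr1n scale1r.
rewrite [LHS]mulmxA clifford_relN// mulNmx -[X in - X = _]mulmxA ih// -scalemxAr mulmxA.
by rewrite -scaleNr -mulN1r -exprS prednK//; case: s js {ih us is_}.
Qed.

(** Moving each factor across the others produces one sign per pair. *)
Lemma gprod_sqr s : uniq s -> gprod s *m gprod s = (-1) ^+ 'C(size s, 2) *: 1%:M.
Proof.
elim: s => [|i s ih] /=; first by rewrite /gprod big_nil mulmx1 scale1r.
move=> /andP[is_ us]; rewrite /gprod !big_cons -/(gprod s) [X in X *m _]gprod_notin//.
rewrite -scalemxAl -mulmxA [g i *m (g i *m _)]mulmxA clifford_rel_sqr mul1mx ih// scalerA.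
by rewrite -exprD binS bin1 addnC.
Qed.

End Chirality.

(** * Connes forms of a torus *)

(** The power U_j^s of a generator. *)
HB.lock Definition gen_pow (R : realType) (d P : nat) (K : choiceType) (X : lattice d P K)
    (Theta : 'M[R]_d) (s : int) (j : 'I_d) : op R K := monomial X Theta (s *: delta_mx 0 j).
Arguments gen_pow {R d P K} X Theta s j _.

Section Axis.
Variables (R : realType) (d P : nat) (K : choiceType) (X : lattice d P K).
Variables (Theta : 'M[R]_d).
Local Notation A := (torus_alg Theta (lpos X) (lfib X)).

Local Notation gen_pow := (gen_pow X Theta).

Lemma talg_gen_pow s j : A (gen_pow s j).
Proof. by rewrite gen_pow.unlock; exact: talg_monomial. Qed.

Lemma gen_pow_bounded s j : bounded_op (gen_pow s j).
Proof. by rewrite gen_pow.unlock; exact: monomial_bounded. Qed.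

Lemma grad_gen_pow G s j :
  grad X Theta G (gen_pow s j) = (two_pi R * s%:~R) *: (gen_pow s j \o fibre_op X (G j)).
Proof.
rewrite gen_pow.unlock gradE (bigD1 j)//= big1 => [|l lj]; last first.
  by rewrite pderiv_monomial !mxE/= (negPf lj) mulr0 mulr0 scale0r comp0l.
by rewrite addr0 pderiv_monomial !mxE !eqxx mulr1 compZl.
Qed.

(** The cocycle involves pairs of distinct directions only. *)
Lemma cocycle_line (s t : int) j : torus_cocycle Theta (s *: delta_mx 0 j) (t *: delta_mx 0 j) = 1.
Proof.
rewrite /torus_cocycle big1 ?mulr0 ?expi0// => i _; rewrite big1// => k ik.
rewrite !mxE/=; case: (eqVneq k j) => [kj|_]; last by rewrite mulr0 mulr0 mul0r.
have -> : (i == j) = false by apply/eqP => ij; rewrite ij kj ltnn in ik.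
by rewrite mulr0 mulr0.
Qed.

Lemma gen_powV s t j : s + t = 0 -> gen_pow s j \o gen_pow t j = id.
Proof. by move=> st; rewrite gen_pow.unlock monomialM cocycle_line scale1r -scalerDl st scale0r monomial0. Qed.

End Axis.

Section Forms.
Variables (R : realType) (d P : nat) (K : choiceType) (X : lattice d P K).
Variables (Theta : 'M[R]_d) (f0 : 'I_P) (G : 'I_d -> 'M[R[i]]_P).
Local Notation C := R[i].
Local Notation pos := (lpos X).
Local Notation fib := (lfib X).
Local Notation sg := (torus_cocycle Theta).
Local Notation A := (torus_alg Theta pos fib).
Local Notation F := (@fibre_op R d P K X).
Local Notation gen_pow := (gen_pow X Theta).
Local Notation pderiv := (pderiv X Theta).
Local Notation amod := (@amod R d P K X Theta).
Local Notation grad := (grad X Theta G).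
Local Notation D := (dirac X G).
Local Notation two_pi := (two_pi R).
Implicit Types (T S a b : op R K) (u v : 'M[C]_P).

Lemma talg_fibreM a b u v : A b -> (a \o F u) \o (b \o F v) = (a \o b) \o F (u *m v).
Proof.
by move=> Ab; rewrite -[LHS]/(a \o (F u \o b) \o F v) -(talg_fibre_comm _ Ab) -fibre_opM.
Qed.

(** The product of two commutators: the derivatives multiply in the algebra, the
    gamma matrices in the fibre. *)
Lemma grad_comp a b : A a -> A b -> (grad a) \o (grad b) =
  \sum_j \sum_k (pderiv j a \o pderiv k b \o F (G j *m G k)).
Proof.
move=> Aa Ab; rewrite !gradE comp_suml; apply: eq_bigr => j _.
rewrite comp_sumr; last first.
  apply/bounded_lin/bounded_comp; last exact: fibre_op_bounded.
  exact/talg_bounded/talg_pderiv.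
by apply: eq_bigr => k _; rewrite talg_fibreM//; exact: talg_pderiv.
Qed.

Lemma grad_gen j : grad (gen_pow 1 j) = two_pi *: (gen_pow 1 j \o F (G j)).
Proof. by rewrite grad_gen_pow mulr1. Qed.

(** The form a G_j is (2 pi)^-1 (a U_j^-1) [D, U_j]. *)
Lemma Omega1E : Omega1 A D = amod (spanf G).
Proof.
apply/seteqP; split=> T.
  move=> [k [a [b [S [h ->]]]]]; apply: amod_sum => t _.
  have [Aa Ab /(commutatorE _ _ Ab) ->] := h t.
  rewrite gradE; apply: amod_lmul => //; apply: amod_sum => l _; apply: amod_mem; first exact: talg_pderiv.
  exact: mem_spanf.
move=> /amod_spanf[a Aa ->].
exists d, (fun j => two_pi^-1 *: (a j \o gen_pow (-1) j)), (fun j => gen_pow 1 j),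
  (fun j => grad (gen_pow 1 j)); split=> [j|].
  by split; [apply/talgZ/talg_comp => //; exact: talg_gen_pow|exact: talg_gen_pow|
    exact/grad_commutator/talg_gen_pow].
apply: eq_bigr => j _; rewrite grad_gen.
have la : linear (a j \o gen_pow (-1) j).
  by apply: talg_linear (talg_comp f0 (Aa j) _); exact: talg_gen_pow.
rewrite compZl compZr// scalerA mulVf ?two_pi_neq0// [RHS]scale1r.
by rewrite -[LHS]/(a j \o id \o F (G j)) -(@gen_powV _ _ _ _ X Theta (-1) 1 j)// addNr.
Qed.

(** The form a G_i G_j comes from [D, U_i][D, U_j] = (2 pi)^2 U_i U_j G_i G_j, the
    unitaries being absorbed into the left factor. *)
Lemma Omega2E : pi_Omega2 A D = amod (spanf (fun p : 'I_d * 'I_d => G p.1 *m G p.2)).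
Proof.
apply/seteqP; split=> T.
  move=> [k [a [b [c [S [S' [h ->]]]]]]]; apply: amod_sum => t _.
  have [Aa Ab Ac /(commutatorE _ _ Ab) -> /(commutatorE _ _ Ac) ->] := h t.
  rewrite -[_ \o grad (c t)]/(a t \o (grad (b t) \o grad (c t))) grad_comp//.
  apply: amod_lmul => //; apply: amod_sum => i _; apply: amod_sum => j _; apply: amod_mem.
    by apply: talg_comp => //; exact: talg_pderiv.
  exact: (mem_spanf (fun p : 'I_d * 'I_d => G p.1 *m G p.2) (i, j)).
move=> /amod_spanf[a Aa ->].
pose ev (t : 'I_#|{: 'I_d * 'I_d}|) : 'I_d * 'I_d := enum_val t.
have /choice[q hq] : forall p, exists q, A q /\ q \o (gen_pow 1 p.1 \o gen_pow 1 p.2) = two_pi^-1 ^+ 2 *: a p.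
  move=> [i j]; exists (two_pi^-1 ^+ 2 *: (a (i, j) \o (gen_pow (-1) j \o gen_pow (-1) i))); split.
    by apply: talgZ; apply: talg_comp => //; apply: talg_comp => //; exact: talg_gen_pow.
  rewrite compZl; congr (_ *: _); rewrite /=.
  rewrite -[LHS]/(a (i, j) \o (gen_pow (-1) j \o (gen_pow (-1) i \o gen_pow 1 i) \o gen_pow 1 j)).
  by rewrite !gen_powV ?addNr.
have Aq p : A (q p) by have [] := hq p.
exists #|{: 'I_d * 'I_d}|, (fun t => q (ev t)), (fun t => gen_pow 1 (ev t).1),
  (fun t => gen_pow 1 (ev t).2), (fun t => grad (gen_pow 1 (ev t).1)),
  (fun t => grad (gen_pow 1 (ev t).2)); split=> [t|].
  by split=> //; (try exact: talg_gen_pow); exact/grad_commutator/talg_gen_pow.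
rewrite [LHS](reindex_onto (@enum_val _ _ : 'I_#|{: 'I_d * 'I_d}| -> _) enum_rank)/=; last first.
  by move=> p _; rewrite enum_rankK.
under eq_bigl do rewrite enum_valK eqxx.
apply: eq_bigr => t _; rewrite -/(ev t); case: (ev t) => i j /=.
have lq := talg_linear (Aq (i, j)).
rewrite !grad_gen.
set gi := gen_pow 1 i \o F (G i); set gj := gen_pow 1 j \o F (G j).
have lqi : linear (q (i, j) \o gi).
  apply/bounded_lin/bounded_comp; first exact: talg_bounded.
  by apply: bounded_comp; [exact: gen_pow_bounded|exact: fibre_op_bounded].
rewrite (compZr _ _ lq) compZl (compZr _ _ lqi) scalerA.
rewrite -[X in _ *: X]/(q (i, j) \o (gi \o gj)) talg_fibreM; last exact: talg_gen_pow.
have [_ e] := hq (i, j).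
rewrite -[X in _ *: X]/((q (i, j) \o (gen_pow 1 i \o gen_pow 1 j)) \o F (G i *m G j)) e.
by rewrite compZl scalerA -expr2 -exprMn mulfV ?two_pi_neq0// expr1n [RHS]scale1r.
Qed.

Hypothesis clif : clifford_rel G.

Let clif_sqr r : G r *m G r = 1%:M.
Proof. by apply: clifford_rel_sqr; rewrite ?pnatr_eq0. Qed.

Lemma comp_fibre_scalar T (c : C) : linear T -> T \o F c%:M = c *: T.
Proof. by move=> lT; rewrite -scalemx1 fibre_opZ fibre_op1 compZr. Qed.

(** A symmetric coefficient sees only the anticommutators of the gamma matrices,
    which are scalars. *)
Lemma sum_symm (Y : 'I_d -> 'I_d -> op R K) : (forall i j, A (Y i j)) ->
  (forall i j, Y i j = Y j i) ->
  \sum_i \sum_j (Y i j \o F (G i *m G j)) = \sum_i (Y i i \o F 1%:M).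
Proof.
move=> AY sY; have lY i j := talg_linear (AY i j).
set S := LHS.
have S2 : S = \sum_i \sum_j (Y i j \o F (G j *m G i)).
  by rewrite /S exchange_big; apply: eq_bigr => i _; apply: eq_bigr => j _; rewrite sY.
suff e : 2%:R *: S = 2%:R *: (\sum_i (Y i i \o F 1%:M)).
  by apply: (scalerI (a := 2%:R : C)) e; rewrite pnatr_eq0.
rewrite scaler_nat mulr2n {2}S2 -big_split scaler_sumr; apply: eq_bigr => i _.
rewrite -big_split/= (bigD1 i)//= big1 => [|j ji]; rewrite -compDr// -fibre_opD clif.
  by rewrite addr0 eqxx mulr1 !comp_fibre_scalar// scale1r.
by rewrite eq_sym (negPf ji) mulr0 comp_fibre_scalar// scale0r.
Qed.

(** The anticommutator with G_k picks out twice the coefficient of G_k. *)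
Lemma clifford_free (x : 'I_d -> op R K) : (forall j, A (x j)) ->
  \sum_j (x j \o F (G j)) = 0 -> forall k, x k = 0.
Proof.
move=> Ax h k; have lx j := talg_linear (Ax j).
have : \sum_j (x j \o F (G j *m G k + G k *m G j)) = 0.
  transitivity (((\sum_j (x j \o F (G j))) \o F (G k)) + (F (G k) \o (\sum_j (x j \o F (G j))))).
    have lF : linear (F (G k)) by exact/bounded_lin/fibre_op_bounded.
    rewrite comp_suml comp_sumr// -big_split; apply: eq_bigr => j _ /=.
    rewrite fibre_opD compDr//; congr (_ + _); first by rewrite -fibre_opM.
    by rewrite -fibre_opM -[LHS]/((x j \o F (G k)) \o F (G j)) (talg_fibre_comm _ (Ax j)).
  by rewrite h comp0l comp0r ?addr0//; exact/bounded_lin/fibre_op_bounded.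
rewrite (bigD1 k)//= big1 => [|j jk]; rewrite clif; last first.
  by rewrite (negPf jk) mulr0 comp_fibre_scalar// scale0r.
rewrite addr0 eqxx mulr1 comp_fibre_scalar// => /(congr1 (fun T => 2%:R^-1 *: T)).
by rewrite scalerA mulVf ?pnatr_eq0// scale1r scaler0.
Qed.

(** The junk forms are scalars by [sum_symm].  To reach a given a in direction j,
    use q U_j^-1 [D, U_j] + q U_j [D, U_j^-1] = 0, whose differential is
    - 2 (2 pi)^2 q; the terms containing the derivative of q cancel between the
    two signs. *)
Lemma dJ1E : pi_dJ1 A D = amod (spanf (fun _ : 'I_d => 1%:M)).
Proof.
apply/seteqP; split=> T.
  move=> [k [b [c [S [S' [h h0 ->]]]]]].
  have Ab t : A (b t) by have [] := h t.
  have Ac t : A (c t) by have [] := h t.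
  have Sb t : S t = grad (b t) by have [_ _ /(commutatorE _ _ (Ab t))] := h t.
  have Sc t : S' t = grad (c t) by have [_ _ _ /(commutatorE _ _ (Ac t))] := h t.
  have lA t : linear (b t) by exact: talg_linear (Ab t).
  have Abc t l : A (b t \o pderiv l (c t)) by apply: talg_comp => //; exact: talg_pderiv.
  have z l : \sum_t (b t \o pderiv l (c t)) = 0.
    apply: (@clifford_free (fun l => \sum_t (b t \o pderiv l (c t)))) => [j|]; first exact: talg_sum.
    rewrite -[RHS]h0; under eq_bigr do rewrite comp_suml.
    rewrite exchange_big; apply: eq_bigr => t _; rewrite Sc gradE comp_sumr//.
  pose Y i j := \sum_t (pderiv i (b t) \o pderiv j (c t)).
  have AY i j : A (Y i j) by apply: talg_sum => t _; apply: talg_comp => //; exact: talg_pderiv.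
  (* Differentiate the relation z. *)
  have YE i j : Y i j = - \sum_t (b t \o pderiv i (pderiv j (c t))).
    apply/eqP; rewrite -subr_eq0 opprK -big_split/=; apply/eqP.
    rewrite -[RHS](pderiv0 X Theta i) -[in RHS](z j) pderiv_sum => [|t]; last exact: Abc.
    apply: eq_bigr => t _ /=.
    by rewrite pderiv_comp//; exact: talg_pderiv.
  have -> : \sum_t (S t \o S' t) = \sum_i (Y i i \o F 1%:M).
    rewrite -sum_symm// => [|i j]; last first.
      by rewrite !YE; congr (- _); apply: eq_bigr => t _; rewrite pderivC.
    under eq_bigr => t _ do rewrite Sb Sc grad_comp//.
    rewrite exchange_big; apply: eq_bigr => i _; rewrite exchange_big; apply: eq_bigr => j _.
    by rewrite comp_suml.
  apply: amod_sum => i _; apply: amod_mem => //; exact: (mem_spanf (fun _ : 'I_d => 1%:M) i).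
move=> /amod_spanf[a Aa ->].
pose J := ('I_d * bool)%type.
pose sn (e : bool) : int := if e then 1 else -1.
(* sn is the exponent of U_j in the second factor. *)
pose q i := ((-2 * two_pi ^+ 2)^-1) *: a i.
have Aq i : A (q i) by exact: talgZ.
have lq i : linear (q i) by exact: talg_linear (Aq i).
pose b (p : J) := q p.1 \o gen_pow (- sn p.2) p.1.
pose c (p : J) := gen_pow (sn p.2) p.1.
have Ab p : A (b p) by apply: talg_comp => //; exact: talg_gen_pow.
have Ac p : A (c p) by exact: talg_gen_pow.
have lb p : linear (b p) by exact: talg_linear (Ab p).
have bc p : b p \o c p = q p.1.
  by rewrite -[LHS]/(q p.1 \o (_ \o _)) gen_powV// addNr.
have sn2 e : sn e * sn e = 1 by case: e.
pose ev (t : 'I_#|{: J}|) : J := enum_val t.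
have sumJ (f : J -> op R K) : \sum_t f (ev t) = \sum_i (f (i, true) + f (i, false)).
  transitivity (\sum_p f p).
    rewrite [RHS](reindex_onto (@enum_val _ _ : 'I_#|{: J}| -> _) enum_rank)/=; last first.
      by move=> p _; rewrite enum_rankK.
    by apply: eq_big => [t|//]; rewrite enum_valK eqxx.
  transitivity (\sum_i \sum_e f (i, e)); first by rewrite pair_bigA; apply: eq_bigr => -[].
  apply: eq_bigr => i _.
  by rewrite big_bool.
have bT p : b p \o grad (c p) = (two_pi * (sn p.2)%:~R) *: (q p.1 \o F (G p.1)).
  by rewrite grad_gen_pow compZr// -[b p \o _]/((b p \o c p) \o F (G p.1)) bc.
have ST p : grad (b p) \o grad (c p) =
    ((two_pi * (sn p.2)%:~R) *: (grad (q p.1) \o F (G p.1))) - two_pi ^+ 2 *: q p.1.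
  have AUm : A (gen_pow (- sn p.2) p.1) by exact: talg_gen_pow.
  have bG : bounded_op (grad (b p)) by exact: grad_bounded.
  have gb : grad (b p) = (grad (q p.1) \o gen_pow (- sn p.2) p.1)
      - (two_pi * (sn p.2)%:~R) *: (b p \o F (G p.1)).
    apply: commutator_uniq (grad_commutator G (Ab p)) _.
    have := commutator_comp (talg_bounded (Aq p.1)) (talg_bounded AUm)
      (grad_commutator G (Aq p.1)) (grad_commutator G AUm).
    by rewrite grad_gen_pow rmorphN mulrN scaleNr -scaleNr compZr// scaleNr.
  rewrite {1}gb compDl compNl; congr (_ - _).
    rewrite grad_gen_pow compZr; last exact/bounded_lin/bounded_comp/talg_bounded/AUm/grad_bounded.
    congr (_ *: _).
    by rewrite -[LHS]/((grad (q p.1) \o (gen_pow (- sn p.2) p.1 \o c p)) \o F (G p.1)) gen_powV ?addNr.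
  have lbF : linear (b p \o F (G p.1)).
    by apply/bounded_lin/bounded_comp; [exact: talg_bounded|exact: fibre_op_bounded].
  rewrite compZl grad_gen_pow compZr// -/(c p) talg_fibreM// bc clif_sqr fibre_op1 scalerA.
  by rewrite mulrACA -rmorphM/= sn2 mulr1 expr2.
exists #|{: J}|, (fun t => b (ev t)), (fun t => c (ev t)), (fun t => grad (b (ev t))),
  (fun t => grad (c (ev t))); split => [t||].
- by split=> //; exact: grad_commutator.
- rewrite (sumJ (fun p => b p \o grad (c p))) big1// => i _; rewrite !bT/= -scalerDl.
  by rewrite -mulrDr -rmorphD/= mulr0 scale0r.
rewrite (sumJ (fun p => grad (b p) \o grad (c p))); apply: eq_bigr => i _.
rewrite !ST/= fibre_op1 addrACA -scalerDl -mulrDr -rmorphD/= mulr0 scale0r add0r.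
rewrite -opprD -scalerDl -scaleNr /q scalerA (_ : _ * _ = 1) ?scale1r//.
by field; rewrite ?two_pi_neq0.
Qed.

End Forms.

(** * Smooth closures *)

Section Closure.
Variables (R : realType) (d P : nat) (K : choiceType) (X : lattice d P K).
Variables (Theta : 'M[R]_d) (f0 : 'I_P).
Local Notation C := R[i].
Local Notation pos := (lpos X).
Local Notation fib := (lfib X).
Local Notation mk := (lmk X).
Local Notation A := (torus_alg Theta pos fib).
Local Notation F := (@fibre_op R d P K X).
Local Notation U := (monomial X Theta).
Local Notation amod := (@amod R d P K X Theta).
Local Notation decays := (@decays R d P K X).
Implicit Types (T S : op R K) (v : 'M[C]_P).

Lemma smooth_closureP (Z : set (op R K)) T : smooth_closure pos Z T <->
  bounded_op T /\ forall k (e : R), 0 < e -> exists2 T', Z T' & decays k (T - T') e.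
Proof.
split=> -[bT h]; split=> // k e e0.
  have [|T' ZT' hT'] := h k e%:C%C; first by rewrite ltcR.
  exists T' => // i j; have := hT' i j.
  by rewrite weightE norm_normc -rmorphXn -rmorphM/= lecR.
have [Re0 eE] : 0 < complex.Re e /\ (complex.Re e)%:C%C = e.
  case: e e0 => a b; rewrite ltcE/= => /andP[/eqP -> a0]; split=> //.
have [T' ZT' hT'] := h k _ Re0; exists T' => // i j.
by rewrite weightE norm_normc -rmorphXn -rmorphM -eE lecR; exact: hT'.
Qed.

(** Multiplying by a fixed matrix of the fibre only changes the constant. *)
Lemma decays_fibre k T v (e : R) : linear T -> 0 <= e -> decays k T e ->
  decays k (T \o F v) ((\sum_p \sum_q normc (v p q)) * e).
Proof.
move=> lT e0 hT i j; rewrite entry_comp_fibre// exchange_big/=.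
apply: (@le_trans _ _ ((\sum_p normc (v p (fib j))) * e)); last first.
  rewrite ler_wpM2r// [leRHS](bigD1 (fib j))//= lerDl.
  by apply: sumr_ge0 => q _; apply: sumr_ge0 => p _; exact: normc_ge0.
apply: le_trans (ler_wpM2l (wtX_ge0 R _ k) (normc_sum _ _ _)) _.
rewrite mulr_sumr mulr_suml; apply: ler_sum => p _.
rewrite normcM mulrCA ler_wpM2l ?normc_ge0//.
by have := hT i (mk (pos j) p); rewrite lposK.
Qed.

Lemma decays_sum k J (r : seq J) (T : J -> op R K) (e : J -> R) :
  (forall t, decays k (T t) (e t)) -> decays k (\sum_(t <- r) T t) (\sum_(t <- r) e t).
Proof.
move=> h; elim: r => [|t r ih]; last by rewrite !big_cons; exact: decaysD.
by rewrite !big_nil => i j; rewrite entry0 normc0 mulr0.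
Qed.

(** Elements of A V are approximated by truncating their Fourier series; the
    converse inclusion is [amod_closed]. *)
Lemma smooth_closure_amod (J : finType) (w : J -> 'M[C]_P) (Z : set (op R K)) :
  Z `<=` amod (spanf w) -> Z 0 -> (forall S T, Z S -> Z T -> Z (S + T)) ->
  (forall c r j, Z (c *: U r \o F (w j))) ->
  smooth_closure pos Z = amod (spanf w).
Proof.
move=> ZA Z0 ZD ZU; apply/seteqP; split=> T.
  move=> /smooth_closureP[bT h]; apply: (amod_closed f0) => // k e e0.
  by have [T' /ZA hT' hd] := h k e e0; exists T'.
move=> /[dup] /amod_bounded bT /amod_spanf[a Aa TE]; apply/smooth_closureP; split=> // k e e0.
pose B := \sum_j \sum_p \sum_q normc (w j p q).
have B0 : 0 <= B by do 3![apply: sumr_ge0 => ? _]; exact: normc_ge0.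
have e1 : 0 < e / (B + 1) by rewrite divr_gt0// ltr_wpDl.
have /choice[T' hT'] : forall j, exists T', [/\ A T', (forall v, v \in codom w -> Z (T' \o F v)) &
    decays k (a j - T') (e / (B + 1))].
  move=> j; have /talgP[_ [b rb hb]] := Aa j; have [s us hs] := trig_poly_approx k rb hb e1.
  exists (trig_poly X Theta s b); split=> //; first exact: talg_trig_poly.
  move=> _ /codomP[l ->]; rewrite comp_suml.
  by apply: big_ind => // r _; exact: ZU.
exists (\sum_j (T' j \o F (w j))).
  by apply: big_ind => // j _; have [_ h _] := hT' j; apply: h; exact: codom_f.
have -> : T - \sum_j (T' j \o F (w j)) = \sum_j ((a j - T' j) \o F (w j)).
  by rewrite TE -sumrB; apply: eq_bigr => j _; rewrite compDl compNl.
apply: (@decaysW _ _ _ _ _ k _ (\sum_j (\sum_p \sum_q normc (w j p q)) * (e / (B + 1)))).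
  apply: decays_sum => j; have [AT' _ h] := hT' j.
  by apply: decays_fibre => //; [exact/talg_linear/talgB|exact: ltW].
by rewrite -mulr_suml -/B mulrA ler_pdivrMr ?ltr_wpDl// mulrC ler_pM2l// lerDl.
Qed.

End Closure.

(** * Tensor products of tori *)

Section AlgTensor.
Variables (R : realType) (I J : choiceType).
Implicit Types (Y : set (op R I)) (Z : set (op R J)).

Lemma alg_tensor0 Y Z : alg_tensor Y Z 0.
Proof.
have x0 : forall (I : choiceType), 'I_0 -> op R I by move=> ? [].
by exists 0%N, (@x0 I), (@x0 J), (@x0 _); split=> [[]//|]; rewrite big_ord0.
Qed.

Lemma alg_tensorD Y Z S T : alg_tensor Y Z S -> alg_tensor Y Z T -> alg_tensor Y Z (S + T).
Proof.
move=> [k [x [y [t [h ->]]]]] [k' [x' [y' [t' [h' ->]]]]].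
pose glue (I' : choiceType) (f : 'I_k -> op R I') (g : 'I_k' -> op R I') (l : 'I_(k + k')) :=
  match fintype.split l with inl a => f a | inr b => g b end.
exists (k + k')%N, (glue _ x x'), (glue _ y y'), (glue _ t t'); split=> [l|].
  by rewrite /glue; case: (fintype.split l) => [a|b]; [exact: h|exact: h'].
rewrite big_split_ord; congr (_ + _); apply: eq_bigr => a _; rewrite /glue.
  by have := unsplitK (inl a : 'I_k + 'I_k'); rewrite /= => ->.
by have := unsplitK (inr a : 'I_k + 'I_k'); rewrite /= => ->.
Qed.

Lemma alg_tensor1 Y Z x y t : Y x -> Z y -> is_tensor_op x y t -> alg_tensor Y Z t.
Proof.
move=> Yx Zy h; exists 1%N, (fun _ => x), (fun _ => y), (fun _ => t); split=> //.
by rewrite big_ord1.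
Qed.

End AlgTensor.

Section TensorSpaces.
Variables (C : fieldType) (N M : nat).
Implicit Types (v : 'M[C]_N) (w : 'M[C]_M).

Lemma tensmxP (u u' : 'M[C]_(N * M)) :
  (forall i1 i2 k1 k2, u (mxtens_index (i1, i2)) (mxtens_index (k1, k2)) =
                      u' (mxtens_index (i1, i2)) (mxtens_index (k1, k2))) -> u = u'.
Proof.
move=> h; apply/matrixP => i k.
by case: (mxtens_indexP i) => i1 i2; case: (mxtens_indexP k) => k1 k2.
Qed.

Lemma tensmxDl v v' w : (v + v') *t w = v *t w + v' *t w.
Proof. by apply: tensmxP => *; rewrite [RHS]mxE !tensmxE mxE mulrDl. Qed.

Lemma tensmxDr v w w' : v *t (w + w') = v *t w + v *t w'.
Proof. by apply: tensmxP => *; rewrite [RHS]mxE !tensmxE mxE mulrDr. Qed.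

Lemma tensmxZl c v w : (c *: v) *t w = c *: (v *t w).
Proof. by apply: tensmxP => *; rewrite [RHS]mxE !tensmxE mxE mulrA. Qed.

Lemma tensmxZr c v w : v *t (c *: w) = c *: (v *t w).
Proof. by apply: tensmxP => *; rewrite [RHS]mxE !tensmxE mxE mulrCA. Qed.

Lemma tensmxNl v w : (- v) *t w = - (v *t w).
Proof. by apply: tensmxP => *; rewrite [RHS]mxE !tensmxE mxE mulNr. Qed.

Lemma tensmx_suml (J : finType) (c : J -> C) (v : J -> 'M[C]_N) w :
  (\sum_j c j *: v j) *t w = \sum_j c j *: (v j *t w).
Proof.
elim/big_rec2: _ => [|j y u _ <-]; first exact: tens0mx.
by rewrite tensmxDl tensmxZl.
Qed.

Lemma tensmx_sumr (J : finType) (c : J -> C) (w : J -> 'M[C]_M) v :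
  v *t (\sum_j c j *: w j) = \sum_j c j *: (v *t w j).
Proof.
elim/big_rec2: _ => [|j y u _ <-]; first exact: tensmx0.
by rewrite tensmxDr tensmxZr.
Qed.

Lemma tens1mx1 : (1%:M : 'M[C]_N) *t (1%:M : 'M[C]_M) = 1%:M.
Proof.
apply: tensmxP => *.
by rewrite tensmxE !mxE -natrM mulnb (can_eq (@mxtens_indexK _ _)).
Qed.

End TensorSpaces.

Section Product.
Variables (R : realType) (n m N M : nat) (Theta : 'M[R]_n) (Phi : 'M[R]_m).
Variables (f1 : 'I_N) (f2 : 'I_M).
Local Notation C := R[i].
Local Notation K1 := (spinor_idx n N).
Local Notation K2 := (spinor_idx m M).
Local Notation Psi := (block_mx Theta 0 0 Phi).

Definition spinor_lattice (d P : nat) : lattice d P (spinor_idx d P) :=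
  @Lattice d P (spinor_idx d P) (fun p => p.1) (fun p => p.2) pair
    (fun _ _ => erefl) (fun _ _ => erefl) (fun p => esym (surjective_pairing p)).

Local Notation X1 := (spinor_lattice n N).
Local Notation X2 := (spinor_lattice m M).

Definition prod_ind (p : K1 * K2) : 'I_(N * M) := mxtens_index (prod_fib p).

Definition prod_mk (r : 'rV[int]_(n + m)) (f : 'I_(N * M)) : K1 * K2 :=
  ((lsubmx r, (mxtens_unindex f).1), (rsubmx r, (mxtens_unindex f).2)).

Lemma prod_posK r f : prod_pos (prod_mk r f) = r.
Proof. by rewrite /prod_pos/= hsubmxK. Qed.

Lemma prod_indK r f : prod_ind (prod_mk r f) = f.
Proof.
by rewrite /prod_ind (_ : prod_fib _ = mxtens_unindex f) ?mxtens_unindexK// [RHS]surjective_pairing.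
Qed.

Lemma prod_mkK p : prod_mk (prod_pos p) (prod_ind p) = p.
Proof.
case: p => -[r f] [s g]; rewrite /prod_mk /prod_pos /prod_ind /prod_fib mxtens_indexK/=.
by rewrite row_mxKl row_mxKr.
Qed.

Definition prod_lattice : lattice (n + m) (N * M) (K1 * K2)%type :=
  Lattice prod_posK prod_indK prod_mkK.
Local Notation X := prod_lattice.

Local Notation A1 := (torus_alg Theta (lpos X1) (lfib X1)).
Local Notation A2 := (torus_alg Phi (lpos X2) (lfib X2)).
Local Notation A := (torus_alg Psi (lpos X) (lfib X)).
Local Notation f0 := (mxtens_index (f1, f2)).
Implicit Types (V : {vspace 'M[C]_N}) (W : {vspace 'M[C]_M}) (v : 'M[C]_N) (w : 'M[C]_M).

Lemma prod_algE : prod_alg Theta Phi = A.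
Proof.
have e (i j : K1 * K2) : (prod_ind i == prod_ind j) = (prod_fib i == prod_fib j).
  exact: (can_eq (@mxtens_indexK _ _)).
apply/seteqP; split=> T [bT [a ra ha]]; split=> //; exists a => // i j.
  by rewrite ha/= e.
by rewrite ha/= e.
Qed.

(** No off-diagonal block: the cocycle of the product torus is the product of the
    two cocycles, with no phase between the factors. *)
Lemma cocycle_prod (r r' : 'rV[int]_n) (s s' : 'rV[int]_m) : torus_cocycle Psi (row_mx r s) (row_mx r' s') =
  torus_cocycle Theta r r' * torus_cocycle Phi s s'.
Proof.
rewrite /torus_cocycle -expiD -mulrDr; congr (expi (_ * _)).
rewrite big_split_ord/=; congr (_ + _); apply: eq_bigr => i _.
  rewrite [LHS]big_mkcond [RHS]big_mkcond big_split_ord/= [X in _ + X]big1 ?addr0 => [|j _].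
    by apply: eq_bigr => j _; rewrite block_mxEul !row_mxEl.
  by rewrite block_mxEur mxE !mul0r if_same.
rewrite [LHS]big_mkcond [RHS]big_mkcond big_split_ord/= [X in X + _]big1 ?add0r => [|j _].
  by apply: eq_bigr => j _; rewrite block_mxEdr !row_mxEr ltn_add2l.
by rewrite block_mxEdl mxE !mul0r if_same.
Qed.

Lemma wt_prod (r : 'rV[int]_n) (s : 'rV[int]_m) : wt R (row_mx r s) <= wt R r * wt R s.
Proof.
rewrite /wt -rmorphM/= ler_int big_split_ord/=.
under eq_bigr do rewrite row_mxEl.
under [X in _ + (_ + X)]eq_bigr do rewrite row_mxEr.
have a0 : 0 <= \sum_j `|r 0 j| by apply: sumr_ge0.
have b0 : 0 <= \sum_j `|s 0 j| by apply: sumr_ge0.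
move: (\sum_j `|r 0 j|) (\sum_j `|s 0 j|) a0 b0 => a b a0 b0.
by rewrite -subr_ge0 (_ : _ - _ = a * b) ?mulr_ge0//; ring.
Qed.

Lemma rdecr_prod (a : 'rV[int]_n -> C) (b : 'rV[int]_m -> C) : rdecr a -> rdecr b ->
  rdecr (fun r : 'rV[int]_(n + m) => a (lsubmx r) * b (rsubmx r)).
Proof.
move=> ra rb k; have [Ma Ma0 ha] := ra k; have [Mb Mb0 hb] := rb k.
exists (Ma * Mb) => [|r]; first exact: mulr_ge0.
rewrite -[r in wt _ r]hsubmxK normcM.
apply: (@le_trans _ _ ((wt R (lsubmx r) ^+ k * normc (a (lsubmx r))) *
    (wt R (rsubmx r) ^+ k * normc (b (rsubmx r))))).
  rewrite mulrACA ler_wpM2r ?mulr_ge0 ?normc_ge0// -exprMn.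
  by rewrite lerXn2r ?nnegrE ?mulr_ge0 ?wt_ge0 ?wt_prod.
by apply: ler_pM; rewrite ?ha ?hb ?mulr_ge0 ?normc_ge0 ?wtX_ge0.
Qed.

Lemma is_tensor_uniq (x : op R K1) (y : op R K2) (S T : op R (K1 * K2)%type) : is_tensor_op x y S ->
  bounded_op T -> (forall i j, entry T i j = entry x i.1 j.1 * entry y i.2 j.2) -> S = T.
Proof. by move=> [bS hS] bT hT; apply: (entry_ext X) => // i j; rewrite hS hT. Qed.

(** The tensor product of two elements exists: its Fourier coefficients are the
    products of those of the factors, still rapidly decreasing since the weight of
    a pair is at most the product of the weights. *)
Lemma tensor_talg_fibre (a : op R K1) (b : op R K2) (v : 'M[C]_N) (w : 'M[C]_M) : A1 a -> A2 b ->
  exists2 t, A t & is_tensor_op (a \o fibre_op X1 v) (b \o fibre_op X2 w) (t \o fibre_op X (v *t w)).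
Proof.
move=> /[dup] Aa /talgP[_ [al ra ha]] /[dup] Ab /talgP[_ [be rb hb]].
have [t At ht] := talg_of_coef X Psi (rdecr_prod ra rb); exists t => //; split.
  by apply: bounded_comp; [exact: talg_bounded At|exact: fibre_op_bounded].
move=> i j; rewrite (entry_coef_fibre _ _ _ _ ht) ?(entry_coef_fibre _ _ _ _ ha) ?(entry_coef_fibre _ _ _ _ hb);
  try exact: talg_linear At; try exact: talg_linear Aa; try exact: talg_linear Ab.
rewrite /= /prod_pos opp_row_mx add_row_mx row_mxKl row_mxKr cocycle_prod.
rewrite /prod_ind /prod_fib tensmxE.
by ring.
Qed.

Definition tensv (V : {vspace 'M[C]_N}) (W : {vspace 'M[C]_M}) : {vspace 'M[C]_(N * M)} :=
  spanf (fun p : 'I_(\dim V) * 'I_(\dim W) => (vbasis V)`_p.1 *t (vbasis W)`_p.2).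

Lemma mem_tensv V W v w : v \in V -> w \in W -> v *t w \in tensv V W.
Proof.
move=> vV wW; rewrite (coord_vbasis vV) (coord_vbasis wW) tensmx_suml.
apply: memv_suml => i _; apply: memvZ; rewrite tensmx_sumr.
apply: memv_suml => j _; apply: memvZ; exact: (mem_spanf _ (i, j)).
Qed.

Lemma tensv_sub V W (Z : {vspace 'M[C]_(N * M)}) :
  (forall v w, v \in V -> w \in W -> v *t w \in Z) -> (tensv V W <= Z)%VS.
Proof.
by move=> h; apply: spanf_sub => -[i j]; apply: h; apply: vbasis_mem; rewrite mem_nth ?size_tuple.
Qed.

(** An operator with the entries of x (x) y is unique, so it suffices to exhibit
    one in the right-hand side, bilinearly in x and y. *)
Lemma alg_tensor_sub V W :
  alg_tensor (amod X1 Theta V) (amod X2 Phi W) `<=` amod X Psi (tensv V W).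
Proof.
move=> _ [k [x [y [t [h ->]]]]]; apply: amod_sum => l _; have [hx hy ht] := h l.
suff [T hT eT] : exists2 T, amod X Psi (tensv V W) T &
    forall i j, entry T i j = entry (x l) i.1 j.1 * entry (y l) i.2 j.2.
  by rewrite (is_tensor_uniq ht (amod_bounded hT) eT).
move: (x l) hx; apply: (amod_ind (Q := fun x => exists2 T, amod X Psi (tensv V W) T &
    forall i j, entry T i j = entry x i.1 j.1 * entry (y l) i.2 j.2)).
- by exists 0 => [|i j]; [exact: amod0|rewrite !entry0 mul0r].
- move=> S S' [T hT eT] [T' hT' eT']; exists (T + T') => [|i j]; first exact: amodD.
  by rewrite !entryD eT eT' mulrDl.
move=> a v Aa vV; move: (y l) hy; apply: (amod_ind (Q := fun y => exists2 T, amod X Psi (tensv V W) T &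
    forall i j, entry T i j = entry (a \o fibre_op X1 v) i.1 j.1 * entry y i.2 j.2)).
- by exists 0 => [|i j]; [exact: amod0|rewrite !entry0 mulr0].
- move=> S S' [T hT eT] [T' hT' eT']; exists (T + T') => [|i j]; first exact: amodD.
  by rewrite !entryD eT eT' mulrDr.
move=> b w Ab wW; have [s As [_ hs]] := tensor_talg_fibre v w Aa Ab.
by exists (s \o fibre_op X (v *t w)) => //; apply: amod_mem => //; exact: mem_tensv.
Qed.

Lemma alg_tensor_monomial V W c r v w : v \in V -> w \in W ->
  alg_tensor (amod X1 Theta V) (amod X2 Phi W) (c *: monomial X Psi r \o fibre_op X (v *t w)).
Proof.
move=> vV wW.
apply: (@alg_tensor1 _ _ _ _ _ (c *: monomial X1 Theta (lsubmx r) \o fibre_op X1 v)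
  (monomial X2 Phi (rsubmx r) \o fibre_op X2 w)).
- by apply: amod_mem => //; exact/talgZ/talg_monomial.
- by apply: amod_mem => //; exact/talg_monomial.
split.
  apply: bounded_comp; last exact: fibre_op_bounded.
  by apply: boundedZ; exact: monomial_bounded.
have c1 : has_coef X1 Theta (c *: monomial X1 Theta (lsubmx r)) (fun s => c * (s == lsubmx r)%:R).
  by move=> i j; rewrite entryZ entry_monomial; case: ifP => _; rewrite ?mulr0// mulrA.
have c0 : has_coef X Psi (c *: monomial X Psi r) (fun s => c * (s == r)%:R).
  by move=> i j; rewrite entryZ entry_monomial; case: ifP => _; rewrite ?mulr0// mulrA.
have c2 : has_coef X2 Phi (monomial X2 Phi (rsubmx r)) (fun s => (s == rsubmx r)%:R).
  exact: entry_monomial.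
move=> i j; rewrite (entry_coef_fibre _ _ _ _ c0); last by apply/bounded_lin/boundedZ/monomial_bounded.
rewrite (entry_coef_fibre _ _ _ _ c1); last by apply/bounded_lin/boundedZ/monomial_bounded.
rewrite (entry_coef_fibre _ _ _ _ c2); last exact/bounded_lin/monomial_bounded.
rewrite /= /prod_pos opp_row_mx add_row_mx cocycle_prod /prod_ind /prod_fib tensmxE.
rewrite -[r in _ == r]hsubmxK.
have -> (a a' : 'rV[int]_n) (b b' : 'rV[int]_m) :
    (row_mx a b == row_mx a' b') = (a == a') && (b == b').
  by apply/eqP/andP => [/eq_row_mx[-> ->]|[/eqP -> /eqP ->]].
by rewrite -mulnb natrM; ring.
Qed.

Lemma closure_alg_tensor V W : smooth_closure (lpos X) (alg_tensor (amod X1 Theta V) (amod X2 Phi W)) =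
  amod X Psi (tensv V W).
Proof.
apply: (smooth_closure_amod f0); first exact: alg_tensor_sub.
- exact: alg_tensor0.
- by move=> S T; exact: alg_tensorD.
move=> c r [i j]; apply: alg_tensor_monomial; apply: vbasis_mem; by rewrite mem_nth ?size_tuple.
Qed.

End Product.


(** * Spinor matrices of the product *)

Section Spinors.
Variable R : realType.
Local Notation C := R[i].

Let two_neq0 : 2%:R != 0 :> C. Proof. by rewrite pnatr_eq0. Qed.

Lemma clifford_clifford_rel n N (g : 'I_n -> 'M[C]_N) : clifford g -> (0 < N)%N /\ clifford_rel g.
Proof. by case=> NE h _; split=> //; rewrite NE expn_gt0. Qed.

Lemma pauli_sqr k : pauli R k *m pauli R k = 1%:M.
Proof.
apply/matrixP => i j; rewrite !mxE !big_ord_recl big_ord0 !mxE.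
case: k => -[|[|[|//]]] hk; case: i => -[|[|//]] hi; case: j => -[|[|//]] hj;
  rewrite /= ?mul0r ?mulr0 ?mul1r ?addr0 ?add0r ?mulNr ?mulrN
    ?mulrNN ?mulCii ?opprK ?expr0 ?expr1 ?mulrNN ?mulr1//.
Qed.

Lemma pauli_anti k l : k != l -> pauli R k *m pauli R l = - (pauli R l *m pauli R k).
Proof.
move=> kl; apply/matrixP => i j; rewrite !mxE !big_ord_recl !big_ord0 !mxE.
move: kl; case: k => -[|[|[|//]]] hk; case: l => -[|[|[|//]]] hl //= _;
case: i => -[|[|//]] hi; case: j => -[|[|//]] hj;
  by rewrite /=; ring.
Qed.

(** The properties common to the Clifford spinors in even dimension and to the
    doubled ones in odd dimension. *)
Definition graded n N (g : 'I_n -> 'M[C]_N) (G : 'M[C]_N) : Prop :=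
  [/\ (0 < N)%N, clifford_rel g, G *m G = 1%:M & forall j, G *m g j = - (g j *m G)].

(** In even dimension n = 2 k the grading squares to the sign of exponent
    k + k (2 k - 1), which is even, and it anticommutes with the gamma matrices
    since n - 1 is odd; in the doubled case distinct Pauli matrices
    anticommute. *)
Lemma even_graded n N (g : 'I_n -> 'M[C]_N) G : even_spinors g G -> graded g G.
Proof.
case=> {N g G} N g.
  move=> e en /clifford_clifford_rel[N0 cg].
  have chE : chirality g = 'i ^+ n./2 *: gprod g (index_enum 'I_n) by [].
  have us := index_enum_uniq 'I_n.
  have sz : size (index_enum 'I_n) = n by rewrite -[RHS]card_ord cardT enumT.
  have n2 : n = n./2.*2 by rewrite -[LHS]odd_double_half (negPf en).
  split=> // [|j].
    rewrite -scalemxAl -scalemxAr scalerA -signr_addb addbb expr0 scale1r chE.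
    rewrite -scalemxAl -scalemxAr scalerA gprod_sqr// scalerA sz -exprD addnn -mul2n.
    rewrite exprM sqrCi -exprD -signr_odd {2}n2 -[odd _]/(odd _).
    have -> : odd (n./2 + 'C(n./2.*2, 2)) = false.
      rewrite bin2 -doubleMl doubleK oddD oddM.
      by case: n./2 => [//|k] /=; rewrite odd_double; case: (odd k).
    by rewrite expr0 scale1r.
  have := gprod_in cg us (mem_index_enum j); rewrite sz => hj.
  rewrite chE -!scalemxAl -!scalemxAr hj !scalerA -scaleNr; congr (_ *: _).
  have n0 : (0 < n)%N by exact: leq_ltn_trans (leq0n j) (ltn_ord j).
  have -> : (-1) ^+ n.-1 = -1 :> C.
    by rewrite -signr_odd -[in odd _]subn1 oddB// (negPf en).
  by rewrite mulrN1 opprK.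
move=> k l on /clifford_clifford_rel[N0 cg] kl; split=> [|r s||j].
- by rewrite muln_gt0 N0.
- by rewrite !tensmx_mul pauli_sqr -tensmxDl cg -scalemx1 tensmxZl tens1mx1 scalemx1.
- by rewrite tensmx_mul mulmx1 pauli_sqr tens1mx1.
- rewrite !tensmx_mul mul1mx mulmx1 pauli_anti 1?eq_sym//.
  by rewrite -scaleN1r tensmxZr scaleN1r.
Qed.

End Spinors.

Section Gammas.
Variables (R : realType) (n m N M : nat) (g : 'I_n -> 'M[R[i]]_N) (gamma : 'M[R[i]]_N)
  (h : 'I_m -> 'M[R[i]]_M).
Local Notation C := R[i].
Hypotheses (gG : graded g gamma) (M_gt0 : (0 < M)%N) (h_cliff : clifford_rel h).

(** The matrices for which the product Dirac operator has symbol
    sum_a r_a prod_gamma_a, see [prod_diracE]. *)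
Definition prod_gamma (a : 'I_(n + m)) : 'M[C]_(N * M) :=
  match fintype.split a with inl j => g j *t 1%:M | inr k => gamma *t h k end.

Lemma prod_gamma_l j : prod_gamma (lshift m j) = g j *t 1%:M.
Proof. by rewrite /prod_gamma; have := unsplitK (inl j : 'I_n + 'I_m) => /= ->. Qed.

Lemma prod_gamma_r k : prod_gamma (rshift n k) = gamma *t h k.
Proof. by rewrite /prod_gamma; have := unsplitK (inr k : 'I_n + 'I_m) => /= ->. Qed.

(** The grading in the second family makes the two families anticommute. *)
Lemma prod_gamma_clifford : clifford_rel prod_gamma.
Proof.
have [_ cg gg ga] := gG.
move=> a b; rewrite -(splitK a) -(splitK b).
case: (fintype.split a) => j; case: (fintype.split b) => k; rewrite /= ?prod_gamma_l ?prod_gamma_r !tensmx_mul.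
- rewrite !mulmx1 -tensmxDl cg -scalemx1 tensmxZl tens1mx1 scalemx1.
  by rewrite (inj_eq (@lshift_inj _ _)).
- rewrite mul1mx mulmx1 ga tensmxNl subrr eq_lrshift mulr0.
  by rewrite raddf0.
- rewrite mul1mx mulmx1 ga tensmxNl addNr eq_rlshift mulr0.
  by rewrite raddf0.
- rewrite gg -tensmxDr h_cliff -[X in _ *t X]scalemx1 tensmxZr tens1mx1 scalemx1.
  by rewrite (inj_eq (@rshift_inj _ _)).
Qed.

Lemma torus_diracE d P (G : 'I_d -> 'M[C]_P) : torus_dirac G = dirac (spinor_lattice d P) G.
Proof.
apply/funext => x; apply/funext => p; rewrite /torus_dirac /dirac /symbol /fib_mx /torus_deriv.
rewrite exchange_big mulr_sumr; apply: eq_bigr => k _ /=.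
rewrite summxE mulr_suml mulr_sumr; apply: eq_bigr => l _; rewrite !mxE /two_pi.
set z := x _; set w := (_)%:~R.
transitivity (- ('i * 'i) * (2 * (pi : R)%:C%C * w * G l p.2 k * z)); first by ring.
by rewrite mulCii opprK mul1r.
Qed.

Lemma symbol_prod_gamma r s : symbol prod_gamma (row_mx r s) = symbol g r *t 1%:M + gamma *t symbol h s.
Proof.
rewrite /symbol tensmx_suml tensmx_sumr big_split_ord; congr (_ + _); apply: eq_bigr => j _.
  by rewrite row_mxEl prod_gamma_l.
by rewrite row_mxEr prod_gamma_r.
Qed.

Lemma prod_diracE : prod_dirac g gamma h = dirac (prod_lattice n m N M) prod_gamma.
Proof.
apply/funext => x; apply/funext => -[[r f] [s e]].
rewrite /prod_dirac /fun_tensl /fun_tensr /fib_mx !torus_diracE.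
rewrite -[LHS]/(dirac (spinor_lattice n N) g (fun i => x (i, (s, e))) (r, f) +
  \sum_k gamma f k * dirac (spinor_lattice m M) h (fun j => x ((r, k), j)) (s, e)).
rewrite /dirac /=.
rewrite [RHS](reindex (@mxtens_index N M)) /=; last first.
  exact: onW_bij (Bijective (@mxtens_indexK N M) (@mxtens_unindexK N M)).
transitivity (\sum_k \sum_l symbol prod_gamma (prod_pos (r, f, (s, e))) (prod_ind (r, f, (s, e)))
  (mxtens_index (k, l)) * x (prod_mk (prod_pos (r, f, (s, e))) (mxtens_index (k, l)))); last first.
  by rewrite pair_bigA; apply: eq_bigr => -[k l] _.
rewrite -big_split /=; apply: eq_bigr => k _.
have xE l : x (prod_mk (prod_pos (r, f, (s, e))) (mxtens_index (k, l))) = x ((r, k), (s, l)).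
  by rewrite /prod_mk mxtens_indexK/= /prod_pos/= row_mxKl row_mxKr.
have sE l : symbol prod_gamma (prod_pos (r, f, (s, e))) (prod_ind (r, f, (s, e))) (mxtens_index (k, l)) =
    symbol g r f k * (e == l)%:R + gamma f k * symbol h s e l.
  by rewrite /prod_pos /= symbol_prod_gamma mxE /prod_ind /prod_fib /= !tensmxE mxE.
under [RHS]eq_bigr do rewrite xE sE mulrDl.
rewrite big_split/=; congr (_ + _).
  rewrite (bigD1 e)//= eqxx mulr1 big1 ?addr0// => l le.
  by rewrite eq_sym (negPf le) mulr0 mul0r.
by rewrite mulr_sumr; apply: eq_bigr => l _; rewrite mulrA.
Qed.

End Gammas.

(** * Components of a product of two gamma matrices *)

Section Traces.
Variables (R : realType) (q P : nat) (G : 'I_q -> 'M[R[i]]_P).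
Local Notation C := R[i].
Hypotheses (P_gt0 : (0 < P)%N) (G_cliff : clifford_rel G).

Let two_neq0 : 2%:R != 0 :> C. Proof. by rewrite pnatr_eq0. Qed.

Lemma tr_gamma2 a b : \tr (G a *m G b) = (a == b)%:R * P%:R.
Proof.
have := congr1 mxtrace (G_cliff a b); rewrite mxtraceD [\tr (G b *m _)]mxtrace_mulC mxtrace_scalar => h.
by apply: (mulfI two_neq0); rewrite [LHS]mulr_natl [LHS]mulr2n h -[LHS]mulr_natr -[LHS]mulrA.
Qed.

(** Move the first matrix to the last place by the Clifford relations, then back to
    the first by cyclicity of the trace. *)
Lemma tr_gamma4 c d b a : \tr (G c *m G d *m (G b *m G a)) =
  ((c == d)%:R * (b == a)%:R - (c == b)%:R * (d == a)%:R + (c == a)%:R * (d == b)%:R) * P%:R.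
Proof.
have swap x y (u v : 'M[C]_P) : \tr (u *m (G x *m G y) *m v) =
    2 * (x == y)%:R * \tr (u *m v) - \tr (u *m (G y *m G x) *m v).
  have -> : G x *m G y = (2 * (x == y)%:R)%:M - G y *m G x by rewrite -G_cliff addrK.
  rewrite mulmxBr mulmxBl raddfB /= -scalemx1 -scalemxAr mulmx1 -scalemxAl.
  by rewrite mxtraceZ.
(* The three transpositions that carry c past d, b and a. *)
have e1 := swap c d 1%:M (G b *m G a).
have e2 := swap c b (G d) (G a).
have e3 := swap c a (G d *m G b) 1%:M.
rewrite !mul1mx in e1; rewrite !mulmx1 in e3; rewrite !mulmxA in e1 e2 e3 *.
have e4 : \tr (G d *m G b *m G a *m G c) = \tr (G c *m G d *m G b *m G a).
  by rewrite mxtrace_mulC !mulmxA.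
rewrite e4 in e3; rewrite !tr_gamma2 in e1 e2 e3.
set t := \tr (G c *m G d *m G b *m G a) in e1 e3 *.
rewrite e3 in e2; rewrite e2 in e1.
apply: (mulfI two_neq0).
have -> : 2%:R * t = t + t by ring.
by rewrite {1}e1; ring.
Qed.

(** Pairing with this matrix by the trace extracts the antisymmetric coefficient
    of the product of the gamma matrices a and b, see [tr_dual2]. *)
Definition dual2 a b : 'M[C]_P := (4 * P%:R)^-1 *: (G b *m G a - G a *m G b).

Lemma tr_dual2 c d a b : \tr (G c *m G d *m dual2 a b) =
  2^-1 * ((c == a)%:R * (d == b)%:R - (c == b)%:R * (d == a)%:R).
Proof.
rewrite /dual2 -scalemxAr mxtraceZ mulmxBr raddfB /= !tr_gamma4.
have P0 : P%:R != 0 :> C by rewrite pnatr_eq0 -lt0n.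
by rewrite [b == a]eq_sym; field.
Qed.

Lemma tr_dual2_1 a b : \tr (1%:M *m dual2 a b) = 0.
Proof.
by rewrite /dual2 mul1mx mxtraceZ raddfB /= mxtrace_mulC subrr mulr0.
Qed.

Definition tr_map (J : finType) (c w : J -> 'M[C]_P) (x : 'M[C]_P) : 'M[C]_P :=
  \sum_j \tr (x *m c j) *: w j.

Lemma tr_map_linear (J : finType) (c w : J -> 'M[C]_P) : linear (tr_map c w).
Proof.
move=> z x y; rewrite /tr_map scaler_sumr -big_split; apply: eq_bigr => j _.
by rewrite mulmxDl -scalemxAl raddfD /= mxtraceZ scalerDl scalerA.
Qed.

HB.instance Definition _ (J : finType) (c w : J -> 'M[C]_P) :=
  GRing.isLinear.Build C 'M[C]_P 'M[C]_P _ (tr_map c w) (tr_map_linear c w).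

Lemma sum_delta2 (J1 J2 : finType) (W : J1 * J2 -> 'M[C]_P) i k :
  \sum_p ((i == p.1)%:R * (k == p.2)%:R) *: W p = W (i, k).
Proof.
rewrite (bigD1 (i, k))//= !eqxx mulr1 scale1r big1 ?addr0// => -[i' k'] /=.
rewrite xpair_eqE [i == _]eq_sym [k == _]eq_sym => /nandP[/negPf ->|/negPf ->].
  by rewrite mul0r scale0r.
by rewrite mulr0 scale0r.
Qed.

(** The projection onto the antisymmetric products of the gamma matrices in the
    directions e, killing scalars and all other products. *)
Definition proj2 (I : finType) (e : I -> 'I_q) : 'M[C]_P -> 'M[C]_P :=
  tr_map (fun p : I * I => dual2 (e p.1) (e p.2)) (fun p => G (e p.1) *m G (e p.2)).

HB.instance Definition _ (I : finType) (e : I -> 'I_q) := GRing.Linear.on (proj2 e).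

(** Antisymmetrizing the product subtracts half the anticommutator. *)
Lemma proj2_in (I : finType) (e : I -> 'I_q) i k : injective e ->
  proj2 e (G (e i) *m G (e k)) = G (e i) *m G (e k) - (i == k)%:R%:M.
Proof.
move=> e_inj; rewrite /proj2 /tr_map.
pose W (p : I * I) := G (e p.1) *m G (e p.2).
transitivity (2^-1 *: (\sum_p ((i == p.1)%:R * (k == p.2)%:R) *: W p) -
              2^-1 *: (\sum_p ((k == p.1)%:R * (i == p.2)%:R) *: W p)).
  rewrite !scaler_sumr -sumrB; apply: eq_bigr => p _.
  rewrite tr_dual2 !(inj_eq e_inj) !scalerA -scalerBl -mulrBr.
  by rewrite [(k == p.1)%:R * _]mulrC.
rewrite !sum_delta2 /W /=.
have -> : (i == k)%:R%:M = 2^-1 *: (G (e i) *m G (e k) + G (e k) *m G (e i)) :> 'M[C]_P.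
  rewrite G_cliff (inj_eq e_inj) -[in RHS]scalemx1 scalerA mulrA mulVf// mul1r.
  by rewrite scalemx1.
set x := G (e i) *m G (e k); set y := G (e k) *m G (e i).
rewrite [X in _ = X - _](_ : x = 2^-1 *: x + 2^-1 *: x); last first.
  by rewrite -scalerDl (_ : _ + _ = 1) ?scale1r//; field.
by rewrite scalerDr opprD addrACA subrr add0r.
Qed.

Lemma proj2_out (I : finType) (e : I -> 'I_q) c d :
  (forall i, c != e i) \/ (forall i, d != e i) -> proj2 e (G c *m G d) = 0.
Proof.
move=> h; rewrite /proj2 /tr_map big1// => p _; rewrite tr_dual2.
by case: h => h; rewrite !(negPf (h _)) ?mul0r ?mulr0 subrr mulr0 scale0r.
Qed.

Lemma proj2_1 (I : finType) (e : I -> 'I_q) : proj2 e 1%:M = 0.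
Proof. by rewrite /proj2 /tr_map big1// => p _; rewrite tr_dual2_1 scale0r. Qed.

(** The component mixing two disjoint sets of directions, with the product of the
    gamma matrices i and k replaced by an arbitrary matrix W (i, k).  The factor 2
    accounts for the two orders of the product. *)
Section Mixed.
Variables (I1 I2 : finType) (e1 : I1 -> 'I_q) (e2 : I2 -> 'I_q) (W : I1 * I2 -> 'M[C]_P).
Hypotheses (e1_inj : injective e1) (e2_inj : injective e2).
Hypothesis e12 : forall i k, e1 i != e2 k.

Definition mixed2 : 'M[C]_P -> 'M[C]_P :=
  tr_map (fun p : I1 * I2 => 2 *: dual2 (e1 p.1) (e2 p.2)) W.

HB.instance Definition _ := GRing.Linear.on mixed2.

Lemma mixed2E c d : mixed2 (G c *m G d) =
  \sum_p ((c == e1 p.1)%:R * (d == e2 p.2)%:R - (c == e2 p.2)%:R * (d == e1 p.1)%:R) *: W p.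
Proof.
apply: eq_bigr => p _; rewrite -scalemxAr mxtraceZ tr_dual2 mulrA mulfV ?mul1r//.
Qed.

Lemma mixed2_12 i k : mixed2 (G (e1 i) *m G (e2 k)) = W (i, k).
Proof.
rewrite mixed2E -[RHS]sum_delta2; apply: eq_bigr => p _.
by rewrite (inj_eq e1_inj) (inj_eq e2_inj) (negPf (e12 _ _)) mul0r subr0.
Qed.

Lemma mixed2_21 i k : mixed2 (G (e2 k) *m G (e1 i)) = - W (i, k).
Proof.
rewrite mixed2E -[W _]sum_delta2 -sumrN; apply: eq_bigr => p _.
rewrite (inj_eq e1_inj) (inj_eq e2_inj) [e2 k == _]eq_sym (negPf (e12 _ _)) mul0r sub0r.
by rewrite mulrC scaleNr.
Qed.

Lemma mixed2_11 i k : mixed2 (G (e1 i) *m G (e1 k)) = 0.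
Proof.
rewrite mixed2E big1// => p _.
by rewrite !(negPf (e12 _ _)) mulr0 mul0r subrr scale0r.
Qed.

Lemma mixed2_22 i k : mixed2 (G (e2 i) *m G (e2 k)) = 0.
Proof.
rewrite mixed2E big1// => p _.
by rewrite ![e2 _ == e1 _]eq_sym !(negPf (e12 _ _)) mulr0 mul0r subrr scale0r.
Qed.

Lemma mixed2_1 : mixed2 1%:M = 0.
Proof.
rewrite /mixed2 /tr_map big1// => p _.
by rewrite -scalemxAr mxtraceZ tr_dual2_1 mulr0 scale0r.
Qed.

End Mixed.

End Traces.

(** * The isomorphism *)

Section LinearSpans.
Variables (R : realType) (P : nat).
Local Notation C := R[i].

Lemma lin_spanf (f : 'M[C]_P -> 'M[C]_P) (J : finType) (w : J -> 'M[C]_P) (V : {vspace 'M[C]_P}) :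
  linear f -> (forall j, f (w j) \in V) -> forall v, v \in spanf w -> f v \in V.
Proof.
move=> lf h _ /spanfP[c ->]; apply: (big_ind (fun x => f x \in V)) => [|x y hx hy|j _].
- by have := lf (-1) 0 0; rewrite scaler0 addr0 scaleN1r addNr => ->; exact: mem0v.
- by have := lf 1 x y; rewrite !scale1r => ->; exact: memvD.
- have f0 : f 0 = 0 by have := lf (-1) 0 0; rewrite scaler0 addr0 scaleN1r addNr.
  by have := lf (c j) (w j) 0; rewrite !addr0 f0 addr0 => ->; exact: memvZ.
Qed.

End LinearSpans.

Section TensorSpans.
Variables (R : realType) (N M : nat).
Local Notation C := R[i].

Lemma tensv_spanf (J1 J2 : finType) (a : J1 -> 'M[C]_N) (b : J2 -> 'M[C]_M) :
  (tensv (spanf a) (spanf b) <= spanf (fun p : J1 * J2 => a p.1 *t b p.2))%VS.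
Proof.
apply: tensv_sub => _ _ /spanfP[c ->] /spanfP[d ->]; rewrite tensmx_suml.
apply: memv_suml => i _; apply: memvZ; rewrite tensmx_sumr.
apply: memv_suml => j _; apply: memvZ; exact: (mem_spanf _ (i, j)).
Qed.

Lemma tensv_line_r (J : finType) (a : J -> 'M[C]_N) :
  (tensv (spanf a) <[1%:M : 'M[C]_M]> <= spanf (fun j => a j *t 1%:M))%VS.
Proof.
apply: tensv_sub => _ _ /spanfP[c ->] /vlineP[d ->]; rewrite tensmxZr tensmx_suml.
apply: memvZ; apply: memv_suml => i _; apply: memvZ; exact: mem_spanf.
Qed.

Lemma tensv_line_l (J : finType) (b : J -> 'M[C]_M) :
  (tensv <[1%:M : 'M[C]_N]> (spanf b) <= spanf (fun j => 1%:M *t b j))%VS.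
Proof.
apply: tensv_sub => _ _ /vlineP[d ->] /spanfP[c ->]; rewrite tensmxZl tensmx_sumr.
apply: memvZ; apply: memv_suml => i _; apply: memvZ; exact: mem_spanf.
Qed.

Lemma tensv0r (V : {vspace 'M[C]_N}) : tensv V (0%VS : {vspace 'M[C]_M}) = 0%VS.
Proof.
apply/eqP; rewrite -subv0; apply: tensv_sub => v w _; rewrite memv0 => /eqP ->.
by rewrite tensmx0 mem0v.
Qed.

End TensorSpans.

Section Bimod.
Variables (R : realType) (K : choiceType) (A : set (op R K)).

Lemma dsum_is_bimodule (M N : bimod R K) : is_bimodule A M -> is_bimodule A N -> is_bimodule A (dsum M N).
Proof.
move=> [[m0 mB mA] [m0' mB' mA'] mS mE] [[n0 nB nA] [n0' nB' nA'] nS nE]; split.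
- split=> //= [x y [hx hx'] [hy hy']|a x Aa [hx hx']]; first by split; [exact: mB|exact: nB].
  by have [? ?] := mA _ _ Aa hx; have [? ?] := nA _ _ Aa hx'.
- split=> //= [x y [hx hx'] [hy hy']|a x Aa [hx hx']]; first by split; [exact: mB'|exact: nB'].
  by have [? ?] := mA' _ _ Aa hx; have [? ?] := nA' _ _ Aa hx'.
- by move=> x [hx hx']; split; [exact: mS|exact: nS].
move=> a b x y Aa Ab [hx hx'] [hy hy'].
have [[e1 e2] [e3 e4] [e5 e6] [e7 e8] e9] := mE _ _ _ _ Aa Ab hx hy.
have [[e1' e2'] [e3' e4'] [e5' e6'] [e7' e8'] e9'] := nE _ _ _ _ Aa Ab hx' hy'.
rewrite /= e1 e2 e3 e4 e5 e6 e7 e8 e9 e1' e2' e3' e4' e5' e6' e7' e8' e9'.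
by case: x {hx hx' e1 e2 e3 e4 e5 e6 e7 e8 e9 e1' e2' e3' e4' e5' e6' e7' e8' e9'} => ? ?; split.
Qed.

End Bimod.

Section AVBimod.
Variables (R : realType) (d P : nat) (K : choiceType) (X : lattice d P K).
Variables (Theta : 'M[R]_d) (f0 : 'I_P).
Local Notation C := R[i].
Local Notation A := (torus_alg Theta (lpos X) (lfib X)).
Local Notation F := (@fibre_op R d P K X).
Local Notation amod := (@amod R d P K X Theta).

(** A map that commutes with A is controlled by its effect on the fibre. *)
Lemma amod_map (Phi : op R K -> op R K) (phi : 'M[C]_P -> 'M[C]_P) (V W : {vspace 'M[C]_P}) :
  Phi 0 = 0 -> (forall S T, Phi (S + T) = Phi S + Phi T) ->
  (forall a v, A a -> Phi (a \o F v) = a \o F (phi v)) ->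
  (forall v, v \in V -> phi v \in W) -> forall T, amod V T -> amod W (Phi T).
Proof.
move=> P0 PD Pm h; apply: amod_ind => [|S T hS hT|a v Aa vV].
- by rewrite P0; exact: amod0.
- by rewrite PD; exact: amodD.
- by rewrite Pm//; apply: amod_mem => //; exact: h.
Qed.

Lemma amod_is_bimod (V W : {vspace 'M[C]_P}) : (W <= V)%VS ->
  is_bimodule A (op_bimod (amod V) (amod W)).
Proof.
have stab U : bimod_stable A (M := op_bimod (amod V) (amod W)) (amod U).
  split=> [|x y|a x Aa hx]; [exact: amod0|exact: amodB|].
  by split; [exact: (amod_lmul f0)|exact: (amod_rmul f0)].
move=> WV; split; [exact: stab|exact: stab|by move=> T; exact: amodS|].
move=> a b x y Aa Ab hx hy; have la := talg_linear Aa.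
have lx : linear x := bounded_lin (amod_bounded hx).
by split; try split=> //; [exact: compDr|exact: compDr].
Qed.

End AVBimod.

Section Iso.
Variables (R : realType) (n m N M : nat) (Theta : 'M[R]_n) (Phi : 'M[R]_m).
Variables (g : 'I_n -> 'M[R[i]]_N) (gamma : 'M[R[i]]_N) (h : 'I_m -> 'M[R[i]]_M).
Hypotheses (gG : graded g gamma) (M_gt0 : (0 < M)%N) (h_cliff : clifford_rel h).
Local Notation C := R[i].
Local Notation X1 := (spinor_lattice n N).
Local Notation X2 := (spinor_lattice m M).
Local Notation X := (prod_lattice n m N M).
Local Notation Psi := (block_mx Theta 0 0 Phi).
Local Notation A := (torus_alg Psi (lpos X) (lfib X)).
Local Notation F := (@fibre_op R (n + m) (N * M) _ X).
Local Notation amod := (@amod R (n + m) (N * M) _ X Psi).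
Local Notation prod_gamma := (prod_gamma g gamma h).
Local Notation quad G := (spanf (fun p => G p.1 *m G p.2)).
Local Notation ones d P := (spanf (fun _ : 'I_d => 1%:M : 'M[C]_P)).

Let N_gt0 : (0 < N)%N. Proof. by case: gG. Qed.
Let g_cliff : clifford_rel g. Proof. by case: gG. Qed.
Let gg : gamma *m gamma = 1%:M. Proof. by case: gG. Qed.
Let ga j : gamma *m g j = - (g j *m gamma). Proof. by case: gG. Qed.
Let NM_gt0 : (0 < N * M)%N. Proof. by rewrite muln_gt0 N_gt0. Qed.
Let f0 : 'I_(N * M) := Ordinal NM_gt0.
Let Gc : clifford_rel prod_gamma. Proof. exact: prod_gamma_clifford. Qed.

(* Two-forms and junk of the product (V, V0), and of the three summands: (V1, D1),
   (V2, D2), and V3 whose junk is zero. *)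
Let V := quad prod_gamma.
Let V0 := ones (n + m) (N * M).
Let V1 := tensv (quad g) <[1%:M : 'M[C]_M]>.
Let D1 := tensv (ones n N) <[1%:M : 'M[C]_M]>.
Let V2 := tensv <[1%:M : 'M[C]_N]> (quad h).
Let D2 := tensv <[1%:M : 'M[C]_N]> (ones m M).
Let V3 := tensv (spanf g) (spanf h).

(* The three components of a two-form, and the matrix that restores the grading
   in the mixed one. *)
Let L1 := proj2 prod_gamma (@lshift n m).
Let L2 := proj2 prod_gamma (@rshift n m).
Let L3 := mixed2 prod_gamma (@lshift n m) (@rshift n m) (fun p => g p.1 *t h p.2).
Let kappa : 'M[C]_(N * M) := gamma *t 1%:M.

Let linL1 : linear L1. Proof. exact: linearP. Qed.
Let linL2 : linear L2. Proof. exact: linearP. Qed.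
Let linL3 : linear L3. Proof. exact: linearP. Qed.

Lemma prod_gamma_ll j k : prod_gamma (lshift m j) *m prod_gamma (lshift m k) = (g j *m g k) *t 1%:M.
Proof. by rewrite !prod_gamma_l tensmx_mul mulmx1. Qed.
Lemma prod_gamma_rr j k : prod_gamma (rshift n j) *m prod_gamma (rshift n k) = 1%:M *t (h j *m h k).
Proof. by rewrite !prod_gamma_r tensmx_mul gg. Qed.
Lemma prod_gamma_lr j k : prod_gamma (lshift m j) *m prod_gamma (rshift n k) = (g j *t h k) *m kappa.
Proof. by rewrite prod_gamma_l prod_gamma_r /kappa !tensmx_mul mul1mx mulmx1. Qed.
Lemma prod_gamma_rl j k : prod_gamma (rshift n k) *m prod_gamma (lshift m j) = - ((g j *t h k) *m kappa).
Proof. by rewrite -prod_gamma_lr clifford_relN ?eq_rlshift// pnatr_eq0. Qed.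

Let l_inj := @lshift_inj n m.
Let r_inj := @rshift_inj n m.
Let lr_neq (j : 'I_n) (k : 'I_m) : lshift m j != rshift n k.
Proof. by rewrite eq_lrshift. Qed.
Let rl_neq (j : 'I_n) (k : 'I_m) : rshift n k != lshift m j.
Proof. by rewrite eq_rlshift. Qed.

Lemma L1_ll j k : L1 (prod_gamma (lshift m j) *m prod_gamma (lshift m k)) =
  prod_gamma (lshift m j) *m prod_gamma (lshift m k) - (j == k)%:R%:M.
Proof. exact: proj2_in. Qed.
Lemma L2_rr j k : L2 (prod_gamma (rshift n j) *m prod_gamma (rshift n k)) =
  prod_gamma (rshift n j) *m prod_gamma (rshift n k) - (j == k)%:R%:M.
Proof. exact: proj2_in. Qed.
Lemma L1_r a k : L1 (prod_gamma a *m prod_gamma (rshift n k)) = 0.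
Proof. by apply: proj2_out => //; right => j; exact: rl_neq. Qed.
Lemma L1_r' a k : L1 (prod_gamma (rshift n k) *m prod_gamma a) = 0.
Proof. by apply: proj2_out => //; left => j; exact: rl_neq. Qed.
Lemma L2_l a k : L2 (prod_gamma a *m prod_gamma (lshift m k)) = 0.
Proof. by apply: proj2_out => //; right => j; exact: lr_neq. Qed.
Lemma L2_l' a k : L2 (prod_gamma (lshift m k) *m prod_gamma a) = 0.
Proof. by apply: proj2_out => //; left => j; exact: lr_neq. Qed.
Lemma L3_ll j k : L3 (prod_gamma (lshift m j) *m prod_gamma (lshift m k)) = 0.
Proof. exact: mixed2_11. Qed.
Lemma L3_rr j k : L3 (prod_gamma (rshift n j) *m prod_gamma (rshift n k)) = 0.
Proof. exact: mixed2_22. Qed.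
Lemma L3_lr j k : L3 (prod_gamma (lshift m j) *m prod_gamma (rshift n k)) = g j *t h k.
Proof. exact: mixed2_12. Qed.
Lemma L3_rl j k : L3 (prod_gamma (rshift n k) *m prod_gamma (lshift m j)) = - (g j *t h k).
Proof. exact: mixed2_21. Qed.

Lemma mem_one1 : 1%:M \in <[1%:M : 'M[C]_N]>%VS. Proof. exact: memv_line. Qed.
Lemma mem_one2 : 1%:M \in <[1%:M : 'M[C]_M]>%VS. Proof. exact: memv_line. Qed.

Lemma mem_quad d P (G : 'I_d -> 'M[C]_P) j k : G j *m G k \in quad G.
Proof. exact: (mem_spanf (fun p => G p.1 *m G p.2) (j, k)). Qed.

Lemma mem_ones d P (j : 'I_d) : 1%:M \in ones d P.
Proof. exact: (mem_spanf (fun _ : 'I_d => 1%:M) j). Qed.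

Lemma ones_quad d P (G : 'I_d -> 'M[C]_P) : clifford_rel G -> (ones d P <= quad G)%VS.
Proof.
move=> cG; apply: spanf_sub => j; rewrite -(clifford_rel_sqr _ cG j) ?pnatr_eq0//; exact: mem_quad.
Qed.

Lemma D1_V1 : (D1 <= V1)%VS.
Proof.
apply: tensv_sub => v w hv hw; apply: mem_tensv => //.
exact: (subvP (ones_quad g_cliff)).
Qed.

Lemma D2_V2 : (D2 <= V2)%VS.
Proof.
apply: tensv_sub => v w hv hw; apply: mem_tensv => //.
exact: (subvP (ones_quad h_cliff)).
Qed.

Lemma V1_V : (V1 <= V)%VS.
Proof.
apply: subv_trans (tensv_line_r _ _) _; apply: spanf_sub => -[j k] /=.
by rewrite -prod_gamma_ll; exact: mem_quad.
Qed.

Lemma V2_V : (V2 <= V)%VS.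
Proof.
apply: subv_trans (tensv_line_l _ _) _; apply: spanf_sub => -[j k] /=.
by rewrite -prod_gamma_rr; exact: mem_quad.
Qed.

Lemma D1_V0 : (D1 <= V0)%VS.
Proof.
apply: subv_trans (tensv_line_r _ _) _; apply: spanf_sub => j /=.
by rewrite tens1mx1; exact: (mem_ones _ (lshift m j)).
Qed.

Lemma D2_V0 : (D2 <= V0)%VS.
Proof.
apply: subv_trans (tensv_line_l _ _) _; apply: spanf_sub => j /=.
by rewrite tens1mx1; exact: (mem_ones _ (rshift n j)).
Qed.

Lemma V3_V v : v \in V3 -> v *m kappa \in V.
Proof.
move=> /(subvP (tensv_spanf _ _)); apply: (lin_spanf (f := fun v => v *m kappa)) => [c x y|[j k] /=].
  by rewrite mulmxDl scalemxAl.
by rewrite -prod_gamma_lr; exact: mem_quad.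
Qed.

Lemma L1_V v : v \in V -> L1 v \in V1.
Proof.
apply: lin_spanf => // -[a b] /=; rewrite -(splitK a) -(splitK b).
case: (fintype.split a) => j; case: (fintype.split b) => k /=.
- rewrite L1_ll memvB//; first by rewrite prod_gamma_ll mem_tensv ?mem_quad ?mem_one2.
  apply: (subvP D1_V1); rewrite -scalemx1 memvZ// -tens1mx1.
  by rewrite mem_tensv ?mem_one2//; exact: (mem_ones _ j).
- by rewrite L1_r mem0v.
- by rewrite L1_r' mem0v.
- by rewrite L1_r mem0v.
Qed.

Lemma L2_V v : v \in V -> L2 v \in V2.
Proof.
apply: lin_spanf => // -[a b] /=; rewrite -(splitK a) -(splitK b).
case: (fintype.split a) => j; case: (fintype.split b) => k /=.
- by rewrite L2_l mem0v.
- by rewrite L2_l' mem0v.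
- by rewrite L2_l mem0v.
- rewrite L2_rr memvB//; first by rewrite prod_gamma_rr mem_tensv ?mem_quad ?mem_one1.
  apply: (subvP D2_V2); rewrite -scalemx1 memvZ// -tens1mx1.
  by rewrite mem_tensv ?mem_one1//; exact: (mem_ones _ j).
Qed.

Lemma L3_V v : v \in V -> L3 v \in V3.
Proof.
have gh j k : g j *t h k \in V3 by rewrite mem_tensv ?mem_spanf.
apply: lin_spanf => // -[a b] /=; rewrite -(splitK a) -(splitK b).
case: (fintype.split a) => j; case: (fintype.split b) => k /=.
- by rewrite L3_ll mem0v.
- by rewrite L3_lr.
- by rewrite L3_rl memvN.
- by rewrite L3_rr mem0v.
Qed.

Lemma lin_ones (L : 'M[C]_(N * M) -> 'M[C]_(N * M)) v : linear L -> L 1%:M = 0 ->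
  v \in V0 -> L v \in 0%VS.
Proof. by move=> lL L_1; apply: lin_spanf => // j; rewrite L_1 mem0v. Qed.

(** The three components determine a two-form modulo junk: what they miss of a
    product of gamma matrices is its scalar part. *)
Lemma L_back v : v \in V -> L1 v + L2 v + L3 v *m kappa - v \in V0.
Proof.
have one (a : 'I_(n + m)) : (1%:M : 'M[C]_(N * M)) \in V0 by exact: (mem_ones _ a).
apply: (lin_spanf (f := fun v => L1 v + L2 v + L3 v *m kappa - v)).
  move=> c x y; rewrite linL1 linL2 linL3 mulmxDl -scalemxAl.
  rewrite [X in X + _ - _]addrACA [X in X - _]addrACA opprD [LHS]addrACA.
  by rewrite -!scalerDr -scalerBr.
move=> -[a b] /=; rewrite -(splitK a) -(splitK b).
case: (fintype.split a) => j; case: (fintype.split b) => k /=.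
- rewrite L1_ll L2_l L3_ll mul0mx !addr0 addrAC subrr sub0r -scalemx1 memvN memvZ//.
  exact: one (lshift m j).
- by rewrite L1_r L2_l' L3_lr -prod_gamma_lr !add0r subrr mem0v.
- by rewrite L1_r' L2_l L3_rl mulNmx -prod_gamma_rl !add0r subrr mem0v.
- rewrite L1_r L2_rr L3_rr mul0mx add0r !addr0 addrAC subrr sub0r -scalemx1 memvN memvZ//.
  exact: one (rshift n j).
Qed.

Lemma L1_V1 v : v \in V1 -> L1 v - v \in D1.
Proof.
move=> /(subvP (tensv_line_r _ _)); apply: (lin_spanf (f := fun v => L1 v - v)).
  by move=> c x y; rewrite linL1 scalerBr opprD addrACA.
move=> -[j k] /=; rewrite -prod_gamma_ll L1_ll addrAC subrr sub0r -scalemx1 memvN memvZ// -tens1mx1.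
by rewrite mem_tensv ?mem_one2//; exact: (mem_ones _ j).
Qed.

Lemma L2_V2 v : v \in V2 -> L2 v - v \in D2.
Proof.
move=> /(subvP (tensv_line_l _ _)); apply: (lin_spanf (f := fun v => L2 v - v)).
  by move=> c x y; rewrite linL2 scalerBr opprD addrACA.
move=> -[j k] /=; rewrite -prod_gamma_rr L2_rr addrAC subrr sub0r -scalemx1 memvN memvZ// -tens1mx1.
by rewrite mem_tensv ?mem_one1//; exact: (mem_ones _ j).
Qed.

Lemma L3_V3 v : v \in V3 -> L3 (v *m kappa) - v \in 0%VS.
Proof.
move=> /(subvP (tensv_spanf _ _)); apply: (lin_spanf (f := fun v => L3 (v *m kappa) - v)).
  by move=> c x y; rewrite mulmxDl -scalemxAl linL3 scalerBr opprD addrACA.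
by move=> -[j k] /=; rewrite -prod_gamma_lr L3_lr subrr mem0v.
Qed.

Lemma L2_V1 v : v \in V1 -> L2 v \in 0%VS.
Proof.
move=> /(subvP (tensv_line_r _ _)); apply: lin_spanf => // -[j k] /=.
by rewrite -prod_gamma_ll L2_l mem0v.
Qed.
Lemma L3_V1 v : v \in V1 -> L3 v \in 0%VS.
Proof.
move=> /(subvP (tensv_line_r _ _)); apply: lin_spanf => // -[j k] /=.
by rewrite -prod_gamma_ll L3_ll mem0v.
Qed.
Lemma L1_V2 v : v \in V2 -> L1 v \in 0%VS.
Proof.
move=> /(subvP (tensv_line_l _ _)); apply: lin_spanf => // -[j k] /=.
by rewrite -prod_gamma_rr L1_r mem0v.
Qed.
Lemma L3_V2 v : v \in V2 -> L3 v \in 0%VS.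
Proof.
move=> /(subvP (tensv_line_l _ _)); apply: lin_spanf => // -[j k] /=.
by rewrite -prod_gamma_rr L3_rr mem0v.
Qed.
Lemma L1_V3 v : v \in V3 -> L1 (v *m kappa) \in 0%VS.
Proof.
move=> /(subvP (tensv_spanf _ _)); apply: (lin_spanf (f := fun v => L1 (v *m kappa))).
  by move=> c x y; rewrite mulmxDl -scalemxAl linL1.
by move=> -[j k] /=; rewrite -prod_gamma_lr L1_r mem0v.
Qed.
Lemma L2_V3 v : v \in V3 -> L2 (v *m kappa) \in 0%VS.
Proof.
move=> /(subvP (tensv_spanf _ _)); apply: (lin_spanf (f := fun v => L2 (v *m kappa))).
  by move=> c x y; rewrite mulmxDl -scalemxAl linL2.
by move=> -[j k] /=; rewrite -prod_gamma_lr L2_l' mem0v.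
Qed.


Let hatL := @fib_map R (n + m) (N * M) _ X.

Let hat_map (L : 'M[C]_(N * M) -> 'M[C]_(N * M)) (V' W : {vspace 'M[C]_(N * M)}) :
      linear L -> (forall v, v \in V' -> L v \in W) ->
  forall T, amod V' T -> amod W (hatL L T).
Proof.
move=> lL; apply: amod_map; [exact: fib_map0|exact: fib_mapD|].
pose Ll := HB.pack_for {linear 'M[C]_(N * M) -> 'M[C]_(N * M)} L
  (GRing.isLinear.Build C 'M[C]_(N * M) 'M[C]_(N * M) _ L lL).
by move=> a v Aa; exact: (fib_map_fibre Ll v Aa).
Qed.

(** The three components, applied fibrewise, with inverse modulo junk
    y1 + y2 + y3 (gamma (x) 1). *)
Theorem amod_iso : bimod_iso A (op_bimod (amod V) (amod V0))
  (dsum (dsum (op_bimod (amod V1) (amod D1)) (op_bimod (amod V2) (amod D2)))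
        (op_bimod (amod V3) (amod 0%VS))).
Proof.
have hat_a L a v : linear L -> A a -> hatL L (a \o F v) = a \o F (L v).
  move=> lL Aa; pose Ll := HB.pack_for {linear 'M[C]_(N * M) -> 'M[C]_(N * M)} L
    (GRing.isLinear.Build C 'M[C]_(N * M) 'M[C]_(N * M) _ L lL).
  exact: (fib_map_fibre Ll v Aa).
have V0V : (V0 <= V)%VS by exact: ones_quad.
split; first exact: (amod_is_bimod X Psi f0 V0V).
  apply: dsum_is_bimodule; last exact: (amod_is_bimod X Psi f0 (sub0v _)).
  by apply: dsum_is_bimodule; [exact: (amod_is_bimod X Psi f0 D1_V1)|exact: (amod_is_bimod X Psi f0 D2_V2)].
pose f (T : op R (spinor_idx n N * spinor_idx m M)%type) := (hatL L1 T, hatL L2 T, hatL L3 T).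
pose back (y1 y2 y3 : op R (spinor_idx n N * spinor_idx m M)%type) := y1 + y2 + (y3 \o F kappa).
have zero (W : {vspace 'M[C]_(N * M)}) (T S : op R (spinor_idx n N * spinor_idx m M)%type) :
    T = S -> amod W (T - S).
  by move=> ->; rewrite subrr; exact: amod0.
have back_V T1 T2 T3 : amod V1 T1 -> amod V2 T2 -> amod V3 T3 -> amod V (back T1 T2 T3).
  move=> h1 h2 h3; apply: amodD; first by apply: amodD; [exact: amodS V1_V _|exact: amodS V2_V _].
  exact: amod_fibre V3_V h3.
have backK T : amod V T -> amod V0 (back (hatL L1 T) (hatL L2 T) (hatL L3 T) - T).
  apply: (amod_map (Phi := fun T => back (hatL L1 T) (hatL L2 T) (hatL L3 T) - T)
    (phi := fun v => L1 v + L2 v + L3 v *m kappa - v)).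
  - by rewrite /back /hatL !fib_map0 comp0l !addr0 subr0.
  - move=> S S'; rewrite /back /hatL !fib_mapD compDl.
    by rewrite [X in X + _ - _]addrACA [X in X - _]addrACA opprD [LHS]addrACA.
  - move=> a v Aa; have la := talg_linear Aa; rewrite /back !hat_a//.
    rewrite -[X in _ + X - _]/(a \o (F (L3 v) \o F kappa)) fibre_opM.
    by rewrite fibre_opB !fibre_opD compBr// !compDr.
  - exact: L_back.
exists f; split.
- move=> T hT; split; first split.
  + exact: hat_map linL1 L1_V _ hT.
  + exact: hat_map linL2 L2_V _ hT.
  + exact: hat_map linL3 L3_V _ hT.
- move=> S T _ _; split; first split; rewrite /f /hatL !fib_mapD; exact: zero.
- move=> a T Aa hT; split; (split; first split); rewrite /f /=; apply: zero.
  + exact: (fib_map_lmul _ _ Aa).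
  + exact: (fib_map_lmul _ _ Aa).
  + exact: (fib_map_lmul _ _ Aa).
  + exact: (fib_map_rmul _ _ Aa).
  + exact: (fib_map_rmul _ _ Aa).
  + exact: (fib_map_rmul _ _ Aa).
- move=> T hT; split=> [[[h1 h2] h3]|hT0].
    have -> : T = back (hatL L1 T) (hatL L2 T) (hatL L3 T) -
        (back (hatL L1 T) (hatL L2 T) (hatL L3 T) - T) by rewrite opprB addrC subrK.
    apply: amodB; last exact: backK.
    have h3' : amod 0%VS (hatL L3 T) := h3.
    rewrite /back; move/amod_zero : h3' => ->; rewrite comp0l addr0.
    by apply: amodD; [exact: amodS D1_V0 h1|exact: amodS D2_V0 h2].
  have z (L : 'M[C]_(N * M) -> 'M[C]_(N * M)) : linear L -> L 1%:M = 0 -> amod 0%VS (hatL L T).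
    by move=> lL L_1; apply: hat_map hT0 => // v; exact: lin_ones.
  split; first split.
  + by apply: amodS (sub0v _) _; apply: z => //; exact: proj2_1.
  + by apply: amodS (sub0v _) _; apply: z => //; exact: proj2_1.
  + by apply: z => //; exact: mixed2_1.
- move=> [[T1 T2] T3] [[/= h1 h2] h3]; exists (back T1 T2 T3); first exact: back_V.
  have zz (L : 'M[C]_(N * M) -> 'M[C]_(N * M)) (V' W : {vspace 'M[C]_(N * M)}) :
      linear L -> (forall v, v \in V' -> L v \in 0%VS) ->
      forall T, amod V' T -> amod W (hatL L T).
    by move=> lL hL T hT; apply: amodS (sub0v _) _; exact: hat_map hT.
  have zk (L : 'M[C]_(N * M) -> 'M[C]_(N * M)) (W : {vspace 'M[C]_(N * M)}) :
      linear L -> (forall v, v \in V3 -> L (v *m kappa) \in 0%VS) ->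
      amod W (hatL L (T3 \o F kappa)).
    move=> lL hL; apply: amodS (sub0v _) _.
    move: T3 h3; apply: (amod_map (Phi := fun T => hatL L (T \o F kappa))
      (phi := fun v => L (v *m kappa))) => //.
    + by rewrite comp0l /hatL fib_map0.
    + by move=> S S'; rewrite compDl /hatL fib_mapD.
    + by move=> a v Aa; rewrite -[_ \o F kappa]/(a \o (F v \o F kappa)) fibre_opM hat_a.
  have sub (L : 'M[C]_(N * M) -> 'M[C]_(N * M)) (V' W : {vspace 'M[C]_(N * M)}) T :
      linear L -> (forall v, v \in V' -> L v - v \in W) -> amod V' T ->
      amod W (hatL L T - T).
    move=> lL hL; apply: (amod_map (Phi := fun T => hatL L T - T) (phi := fun v => L v - v)) => //.
    + by rewrite /hatL fib_map0 subrr.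
    + by move=> S S'; rewrite /hatL fib_mapD opprD addrACA.
    + move=> a v Aa; have la := talg_linear Aa; rewrite hat_a//.
      by rewrite fibre_opB compBr.
  split; first split; rewrite /= /back /hatL !fib_mapD.
  + rewrite -[X in X - _]addrA addrAC; apply: amodD; first exact: sub linL1 L1_V1 h1.
    by apply: amodD; [exact: zz linL1 L1_V2 _ h2|exact: zk linL1 L1_V3].
  + rewrite [X in X + _ - _]addrC -[X in X - _]addrA addrAC.
    apply: amodD; first exact: sub linL2 L2_V2 h2.
    by apply: amodD; [exact: zz linL2 L2_V1 _ h1|exact: zk linL2 L2_V3].
  + rewrite -addrA; apply: amodD.
      by apply: amodD; [exact: zz linL3 L3_V1 _ h1|exact: zz linL3 L3_V2 _ h2].
    move: T3 h3 {zk}; apply: (amod_map (Phi := fun T => hatL L3 (T \o F kappa) - T)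
      (phi := fun v => L3 (v *m kappa) - v)).
    * by rewrite comp0l /hatL fib_map0 subrr.
    * by move=> S S'; rewrite compDl /hatL fib_mapD opprD addrACA.
    * move=> a v Aa; have la := talg_linear Aa.
      rewrite -[_ \o F kappa]/(a \o (F v \o F kappa)) fibre_opM hat_a//.
      by rewrite fibre_opB compBr.
    * exact: L3_V3.
Qed.

End Iso.

Section CTensor.
Variables (R : realType) (n m N M : nat) (Theta : 'M[R]_n) (Phi : 'M[R]_m).
Variables (f1 : 'I_N) (f2 : 'I_M).
Local Notation C := R[i].
Local Notation X1 := (spinor_lattice n N).
Local Notation X2 := (spinor_lattice m M).
Local Notation X := (prod_lattice n m N M).
Local Notation Psi := (block_mx Theta 0 0 Phi).
Implicit Types (V : {vspace 'M[C]_N}) (W : {vspace 'M[C]_M}).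

Lemma alg_tensor_V0 V : alg_tensor (amod X1 Theta V) (amod X2 Phi 0%VS) = [set 0].
Proof.
apply/seteqP; split=> T; last by move=> /= ->; exact: alg_tensor0.
move=> [k [x [y [t [h ->]]]]] /=; apply: big1 => l _; have [_ /amod_zero y0 ht] := h l.
apply: (is_tensor_uniq ht) => [|i j]; first exact: bounded0.
by rewrite y0 !entry0 mulr0.
Qed.

Lemma alg_tensor_0W W : alg_tensor (amod X1 Theta 0%VS) (amod X2 Phi W) = [set 0].
Proof.
apply/seteqP; split=> T; last by move=> /= ->; exact: alg_tensor0.
move=> [k [x [y [t [h ->]]]]] /=; apply: big1 => l _; have [/amod_zero x0 _ ht] := h l.
apply: (is_tensor_uniq ht) => [|i j]; first exact: bounded0.
by rewrite x0 !entry0 mul0r.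
Qed.

(** One of the two summands of the denominator vanishes in each tensor product of
    the theorem, so the denominator is again an algebraic tensor product. *)
Lemma ctensor_l V V0 W : ctensor (lpos X)
    (amod X1 Theta V) (amod X1 Theta V0) (amod X2 Phi W) (amod X2 Phi 0%VS) =
  op_bimod (amod X Psi (tensv V W)) (amod X Psi (tensv V0 W)).
Proof.
rewrite /ctensor closure_alg_tensor// -(closure_alg_tensor Theta Phi f1 f2 V0 W).
congr (op_bimod _ (smooth_closure _ _)).
apply/seteqP; split=> T.
  by move=> [S [S' [hS + ->]]]; rewrite alg_tensor_V0 => /= ->; rewrite addr0.
by move=> hT; exists T, 0; split=> //; [exact: alg_tensor0|rewrite addr0].
Qed.

Lemma ctensor_r V W W0 : ctensor (lpos X)
    (amod X1 Theta V) (amod X1 Theta 0%VS) (amod X2 Phi W) (amod X2 Phi W0) =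
  op_bimod (amod X Psi (tensv V W)) (amod X Psi (tensv V W0)).
Proof.
rewrite /ctensor closure_alg_tensor// -(closure_alg_tensor Theta Phi f1 f2 V W0).
congr (op_bimod _ (smooth_closure _ _)).
apply/seteqP; split=> T.
  by move=> [S [S' [+ hS' ->]]]; rewrite alg_tensor_0W => /= ->; rewrite add0r.
by move=> hT; exists 0, T; split=> //; [exact: alg_tensor0|rewrite add0r].
Qed.

End CTensor.

Lemma talg_amod (R : realType) d P (K : choiceType) (X : lattice d P K) (Theta : 'M[R]_d) :
  torus_alg Theta (lpos X) (lfib X) = amod X Theta <[1%:M]>%VS.
Proof. by apply/seteqP; split=> T; move/amod_one. Qed.

Lemma zero_amod (R : realType) d P (K : choiceType) (X : lattice d P K) (Theta : 'M[R]_d) :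
  [set 0] = amod X Theta 0%VS.
Proof. by apply/seteqP; split=> T; move/amod_zero. Qed.

Theorem proposition4p2 (R : realType) (n m N M : nat)
    (Theta : 'M[R]_n) (Phi : 'M[R]_m)
    (Theta_skew : Theta^T = - Theta) (Phi_skew : Phi^T = - Phi)
    (g : 'I_n -> 'M[R[i]]_N) (gamma : 'M[R[i]]_N) (g_even : even_spinors g gamma)
    (h : 'I_m -> 'M[R[i]]_M)
    (h_spin : clifford h \/ exists gamma', even_spinors h gamma') :
  let A1 := @spinor_alg R n N Theta in
  let D1 := torus_dirac g in
  let A2 := @spinor_alg R m M Phi in
  let D2 := torus_dirac h in
  let A := @prod_alg R n m N M Theta Phi in
  let D := prod_dirac g gamma h in
  let pos := @prod_pos n m N M in
  bimod_iso A
    (op_bimod (pi_Omega2 A D) (pi_dJ1 A D))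
    (dsum (dsum
      (ctensor pos (pi_Omega2 A1 D1) (pi_dJ1 A1 D1) A2 [set 0])
      (ctensor pos A1 [set 0] (pi_Omega2 A2 D2) (pi_dJ1 A2 D2)))
      (ctensor pos (Omega1 A1 D1) [set 0] (Omega1 A2 D2) [set 0])).
Proof.
move=> A1 D1 A2 D2 A D pos.
have gG := even_graded g_even.
have [M0 hc] : (0 < M)%N /\ clifford_rel h.
  case: h_spin => [/clifford_clifford_rel//|[gamma' /even_graded[]]//].
have N0 : (0 < N)%N by case: gG.
have gc : clifford_rel g by case: gG.
pose f1 := Ordinal N0; pose f2 := Ordinal M0.
pose X1 := spinor_lattice n N; pose X2 := spinor_lattice m M; pose X := prod_lattice n m N M.
pose Psi := block_mx Theta 0 0 Phi.
have A1E : A1 = torus_alg Theta (lpos X1) (lfib X1) by [].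
have A2E : A2 = torus_alg Phi (lpos X2) (lfib X2) by [].
have AE : A = torus_alg Psi (lpos X) (lfib X) by exact: prod_algE.
have D1E : D1 = dirac X1 g by exact: torus_diracE.
have D2E : D2 = dirac X2 h by exact: torus_diracE.
have DE : D = dirac X (prod_gamma g gamma h) by exact: prod_diracE.
have Gc : clifford_rel (prod_gamma g gamma h) by exact: prod_gamma_clifford.
rewrite AE DE (Omega2E X Psi (mxtens_index (f1, f2))) (dJ1E X Psi (mxtens_index (f1, f2)) Gc).
rewrite A1E D1E (Omega1E X1 Theta f1) (Omega2E X1 Theta f1) (dJ1E X1 Theta f1 gc).
rewrite A2E D2E (Omega1E X2 Phi f2) (Omega2E X2 Phi f2) (dJ1E X2 Phi f2 hc).
have pE : pos = lpos X by [].
rewrite pE.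
rewrite (talg_amod X1 Theta) (talg_amod X2 Phi) (zero_amod X1 Theta) (zero_amod X2 Phi).
rewrite (ctensor_l Theta Phi f1 f2) !(ctensor_r Theta Phi f1 f2) tensv0r.
exact: amod_iso.
Qed.
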